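(* Let $\mathcal S=\{S_g:g\in G\}$ be a representation of a semitopological semigroup $G$ as Markov operators on $C(K)$, and assume that $\mathcal S$ is uniquely ergodic with invariant probability measure $\mu$. Consider either of the following two settings: (a) $G$ is right amenable, and ''net'' below means strong right $\chi\mathcal S$-ergodic net; (b) $G$ is amenable, and ''net'' below means strong $\chi\mathcal S$-ergodic net. In each of the two settings, for every $\chi\in\widehat G$ the following assertions are equivalent. (1) $\operatorname{Fix}\chi\mathcal S_2\subseteq\operatorname{Fix}\chi\mathcal S$ (i.e. every element of $\operatorname{Fix}\chi\mathcal S_2$ has a representative in $\operatorname{Fix}\chi\mathcal S$). (2) $\chi\mathcal S$ is mean ergodic with mean ergodic projection $P_\chi$. (3) $\operatorname{Fix}\chi\mathcal S$ separates $\operatorname{Fix}(\chi\mathcal S)'$. (4) $C(K)=\operatorname{Fix}\chi\mathcal S\oplus\overline{\operatorname{lin}}\operatorname{rg}(I-\chi\mathcal S)$. (5) $A_\alpha f$ converges weakly (equivalently, converges weakly to a fixed point of $\chi\mathcal S$) for all $f\in C(K)$, for some (equivalently, for every) net $(A_\alpha)$. (6) $A_\alpha f$ converges in norm (equivalently, converges in norm to a fixed point of $\chi\mathcal S$) for all $f\in C(K)$, for some (equivalently, for every) net $(A_\alpha)$. The limit $P_\chi$ of the nets $(A_\alpha)$ in the strong (respectively weak) operator topology is the mean ergodic projection of $\chi\mathcal S$, mapping $C(K)$ onto $\operatorname{Fix}\chi\mathcal S$ along $\overline{\operatorname{lin}}\operatorname{rg}(I-\chi\mathcal S)$.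
   Context: $K$ is a compact (Hausdorff) space, $C(K)$ the Banach space of complex continuous functions with the sup norm, $C(K)'$ its dual, identified with the regular complex Borel measures on $K$. $\mathscr L(X)$ (bounded operators) carries the strong operator topology, in which closures are taken. $\mathbb T$ is the unit circle. A semitopological semigroup is a semigroup with a topology making multiplication separately continuous. A mean on $C_b(G)$ (bounded continuous functions on $G$) is $m\in C_b(G)'$ with $\langle m,\mathbf 1\rangle=\|m\|=1$. For $g\in G$ and $f\in C_b(G)$ put $R_gf(h)=f(hg)$ and $L_gf(h)=f(gh)$, $h\in G$. $G$ is called right amenable if there is a mean $m$ with $\langle m,R_gf\rangle=\langle m,f\rangle$ for all $g\in G$, $f\in C_b(G)$. $G$ is called amenable if there is a mean $m$ with $\langle m,R_gf\rangle=\langle m,L_gf\rangle=\langle m,f\rangle$ for all $g\in G$, $f\in C_b(G)$. A bounded representation of $G$ on a Banach space $X$ is a uniformly bounded family $\mathcal V=\{V_g:g\in G\}\subset\mathscr L(X)$ with $V_{g_1}V_{g_2}=V_{g_2g_1}$ and $g\mapsto V_gf$ continuous for each $f\in X$. Write $\operatorname{Fix}\mathcal V=\{f\in X:V_gf=f\ \forall g\}$, $\operatorname{Fix}\mathcal V'=\{\nu\in X':V_g'\nu=\nu\ \forall g\}$, and $\overline{\operatorname{lin}}\operatorname{rg}(I-\mathcal V)$ for the closed linear span of $\{f-V_gf:f\in X,g\in G\}$. $\mathcal V$ is mean ergodic if $\overline{\operatorname{co}}\,\mathcal V$ contains a zero element $P$ (i.e. $PT=TP=P$ for all $T\in\overline{\operatorname{co}}\,\mathcal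 V$); $P$ is the mean ergodic projection. A strong right $\mathcal V$-ergodic net is a net $(A_\alpha)$ in $\overline{\operatorname{co}}\,\mathcal V$ with $\lim_\alpha(A_\alpha f-A_\alpha V_gf)=0$ for all $f\in X,g\in G$; it is a strong $\mathcal V$-ergodic net if moreover $\lim_\alpha(A_\alpha f-V_gA_\alpha f)=0$ for all $f,g$. A set $E\subseteq X$ separates $F\subseteq X'$ if distinct elements of $F$ differ at some element of $E$. Markov operator: positive operator $S$ on $C(K)$ with $S\mathbf 1=\mathbf 1$; a representation as Markov operators is a (contractive) representation by such operators. $\mathcal S$ is uniquely ergodic with invariant measure $\mu$ if $\operatorname{Fix}\mathcal S'=\mathbb C\cdot\mu$ with $\mu$ a probability measure. $S_{g,2}$ is the continuous extension of $S_g$ to $L^2(K,\mu)$. $\widehat G$ is the set of continuous multiplicative maps $\chi:G\to\mathbb T$; $\chi\mathcal S=\{\chi(g)S_g:g\in G\}$, $\chi\mathcal S_2=\{\chi(g)S_{g,2}:g\in G\}$, and $(\chi\mathcal S)'$ is the adjoint semigroup on $C(K)'$.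
   Formalization: In (a), right amenability is taken for G with reversed multiplication (mean invariant under L_g, not R_g); in (a), ''converges for some net'' without a fixed-point limit is dropped from (5) and (6), and the final claim on limits of nets assumes mean ergodicity. *)

(* Defs.v *)
From HB Require Import structures.
From mathcomp Require Import all_boot all_order all_algebra.
From mathcomp Require Import complex.
From mathcomp Require Import all_classical all_reals all_analysis.
Set Warnings "-redundant-canonical-projection".
Set Implicit Arguments.
Unset Strict Implicit.
Unset Printing Implicit Defensive.
Import Order.TTheory GRing.Theory Num.Theory.
Import numFieldNormedType.Exports.
Local Open Scope classical_set_scope.
Local Open Scope ring_scope.
Local Open Scope complex_scope.

(* The complex numbers R[i] with the topology of the modulus. The order of    *)
(* R[i] is partial: 0 <= z means that z is real and nonnegative, and norms    *)
(* of complex normed modules are nonnegative reals seen in R[i].              *)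
HB.instance Definition _ (R : realType) := NormedModule.copy R[i] R[i]^o.

HB.mixin Record hasSeparatelyContinuousMul G & Semigroup G & Topological G := {
  mulg_continuousl : forall g : G, continuous (fun h : G => (g * h)%g);
  mulg_continuousr : forall g : G, continuous (fun h : G => (h * g)%g)
}.

#[short(type="semitopologicalSemigroupType")]
HB.structure Definition SemitopologicalSemigroup :=
  {G of Semigroup G & Topological G & hasSeparatelyContinuousMul G}.

(* The same space with the multiplication (g, h) |-> h * g.                   *)
Definition opposite (G : Type) : Type := G.

Section opposite.
Variable G : semitopologicalSemigroupType.

HB.instance Definition _ := Topological.copy (opposite G) G.

Let mulA : associative (fun g h : opposite G => ((h : G) * (g : G))%g).
Proof. by move=> x y z; rewrite mulgA. Qed.

HB.instance Definition _ := isSemigroup.Build (opposite G) mulA.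
HB.instance Definition _ := hasSeparatelyContinuousMul.Build (opposite G)
  (@mulg_continuousr G) (@mulg_continuousl G).
End opposite.

(* Cb R T is the space of bounded continuous functions T -> R[i] with the sup *)
(* norm. When T is compact every continuous function is bounded               *)
(* (compact_is_Cb), so that Cb R K is the space C(K).                         *)
Section Cb.
Variables (R : realType) (T : topologicalType).

Definition is_Cb : {pred T -> R[i]} :=
  mem [set f : T -> R[i] | continuous f /\ bounded_fun f].

Lemma normc_Re (z : R[i]) : `|z| = (complex.Re `|z|)%:C.
Proof. by rewrite normc_def. Qed.

Lemma is_CbP (f : T -> R[i]) :
  reflect (continuous f /\ exists M : R, forall x, `|f x| <= M%:C) (f \in is_Cb).
Proof.
apply: (iffP idP) => [|[cf [M fM]]].
  rewrite inE => -[cf [M [Mr fM]]]; split => //.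
  have /complex_realP[k kE] : M + 1 \is Num.real by rewrite realD// real1.
  exists k => x; rewrite -kE; apply: fM => //.
  by rewrite ltrDl ltr01.
rewrite inE; split => //; exists M%:C; split; first by rewrite complex_real.
by move=> N MN x _; apply: le_trans (fM x) _; exact: ltW.
Qed.

Record Cb := MkCb { Cb_fun :> T -> R[i]; _ : Cb_fun \in is_Cb }.

HB.instance Definition _ := [isSub for Cb_fun].
HB.instance Definition _ := [Choice of Cb by <:].

Lemma Cb_continuous (f : Cb) : continuous f.
Proof. by case: f => f /= /is_CbP[]. Qed.

Lemma Cb_bounded (f : Cb) : exists M : R, forall x, `|f x| <= M%:C.
Proof. by case: f => f /= /is_CbP[]. Qed.

Lemma CbP (f g : Cb) : f =1 g -> f = g.
Proof. by move=> fg; apply/val_inj/funext. Qed.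

Lemma is_Cb_submod_closed : submod_closed is_Cb.
Proof.
split=> [|a f g /is_CbP[cf [M fM]] /is_CbP[cg [N gN]]]; apply/is_CbP; split.
- by move=> x; exact: cvg_cst.
- by exists 0 => x; rewrite normr0.
- move=> x; apply: (@continuousD R[i] _ _ (a \*: f) g); last exact: cg.
  exact: (@continuousZl_tmp _ _ _ f a x (cf x)).
- exists (complex.Re `|a| * M + N) => x.
  rewrite (le_trans (ler_normD _ _))// rmorphD rmorphM/= -normc_Re lerD//.
  by rewrite normrZ ler_wpM2l.
Qed.

HB.instance Definition _ :=
  GRing.isSubmodClosed.Build _ _ is_Cb is_Cb_submod_closed.
HB.instance Definition _ := [SubChoice_isSubLmodule of Cb by <:].

Definition sup_norm (f : Cb) : R[i] :=
  (sup (range (fun x => complex.Re `|f x|)))%:C.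

Lemma ler_sup_norm (f : Cb) (x : T) : `|f x| <= sup_norm f.
Proof.
rewrite normc_Re lecR; apply: ub_le_sup; last by exists x.
have [M fM] := Cb_bounded f; exists M => _ [y _ <-].
by rewrite -lecR -normc_Re.
Qed.

Lemma sup_norm_le (f : Cb) (M : R[i]) :
  0 <= M -> (forall x, `|f x| <= M) -> sup_norm f <= M.
Proof.
move=> M0 fM; have /complex_realP[k kE] : M \is Num.real by exact: ger0_real.
rewrite {}kE in M0 fM *; rewrite lecR.
have [[x _]|/nonemptyPn T0] := pselect ([set: T] !=set0).
  apply: ge_sup; first by exists (complex.Re `|f x|), x.
  by move=> _ [y _ <-]; rewrite -lecR -normc_Re.
by rewrite T0 image_set0 sup0 -lecR.
Qed.

Lemma sup_norm_ge0 (f : Cb) : 0 <= sup_norm f.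
Proof.
have [[x _]|/nonemptyPn T0] := pselect ([set: T] !=set0).
  exact: le_trans (ler_sup_norm f x).
by rewrite /sup_norm T0 image_set0 sup0.
Qed.

Lemma sup_normD (f g : Cb) : sup_norm (f + g) <= sup_norm f + sup_norm g.
Proof.
apply: sup_norm_le => [|x]; first by rewrite addr_ge0 ?sup_norm_ge0.
by rewrite (le_trans (ler_normD _ _))// lerD ?ler_sup_norm.
Qed.

Lemma sup_normZ (a : R[i]) (f : Cb) : sup_norm (a *: f) = `|a| * sup_norm f.
Proof.
have H (b : R[i]) (g : Cb) : sup_norm (b *: g) <= `|b| * sup_norm g.
  apply: sup_norm_le => [|x]; first by rewrite mulr_ge0 ?sup_norm_ge0.
  by rewrite normrZ ler_wpM2l// ler_sup_norm.
apply/le_anti; rewrite H/=; have [->|a0] := eqVneq a 0.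
  by rewrite normr0 mul0r sup_norm_ge0.
rewrite -{1}[f](scalerK a0) -ler_pdivlMl ?normr_gt0// -normfV.
exact: H.
Qed.

Lemma sup_norm_eq0 (f : Cb) : sup_norm f = 0 -> f = 0.
Proof.
move=> f0; apply: CbP => x; apply/eqP; rewrite -normr_le0.
by rewrite -f0 ler_sup_norm.
Qed.

HB.instance Definition _ :=
  Lmodule_isNormed.Build R[i] Cb sup_normD sup_normZ sup_norm_eq0.

Lemma cst_is_Cb (c : R[i]) : cst c \in is_Cb.
Proof.
apply/is_CbP; split; first by move=> x; exact: cvg_cst.
by exists (complex.Re `|c|) => x; rewrite -normc_Re.
Qed.

Definition Cb_cst (c : R[i]) : Cb := MkCb (cst_is_Cb c).

Lemma compact_is_Cb (f : T -> R[i]) :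
  compact [set: T] -> continuous f -> f \in is_Cb.
Proof.
move=> cT cf; rewrite inE; split => //.
have ch : continuous (fun x => complex.Re `|f x| : R).
  move=> x; apply/cvgrPdist_lt => e e0.
  have := cf x; rewrite /continuous_at => /cvgrPdist_lt/(_ e%:C).
  rewrite ltcR => /(_ e0); apply: filterS => y fxy.
  rewrite -ltcR; apply: le_lt_trans fxy; apply: le_trans (ler_dist_dist _ _).
  rewrite [in leRHS](normc_Re (f x)) [in leRHS](normc_Re (f y)) -rmorphB/=.
  by rewrite normc_def/= expr0n/= addr0 sqrtr_sqr.
have [M [Mr hM]] := compact_bounded (continuous_compact
  (continuous_subspaceT ch) cT).
exists (M + 1)%:C; split => [|N MN x _ /=]; first by rewrite complex_real.
rewrite normc_Re (le_trans _ (ltW MN))// lecR.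
by rewrite (le_trans (ler_norm _))// hM ?ltrDl//; exists x.
Qed.

End Cb.

Section amenability.
Variables (R : realType) (G : semitopologicalSemigroupType).

Lemma ltransl_is_Cb (g : G) (f : Cb R G) :
  (fun h : G => f (g * h)%g) \in @is_Cb R G.
Proof.
have [M fM] := Cb_bounded f; apply/is_CbP; split; last by exists M.
move=> h; apply: (@continuous_comp _ _ _ (fun h : G => (g * h)%g) f).
  exact: mulg_continuousl.
exact: Cb_continuous.
Qed.

Lemma rtransl_is_Cb (g : G) (f : Cb R G) :
  (fun h : G => f (h * g)%g) \in @is_Cb R G.
Proof.
have [M fM] := Cb_bounded f; apply/is_CbP; split; last by exists M.
move=> h; apply: (@continuous_comp _ _ _ (fun h : G => (h * g)%g) f).
  exact: mulg_continuousr.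
exact: Cb_continuous.
Qed.

Definition ltransl (g : G) (f : Cb R G) : Cb R G := MkCb (ltransl_is_Cb g f).
Definition rtransl (g : G) (f : Cb R G) : Cb R G := MkCb (rtransl_is_Cb g f).

End amenability.

Section operators.
Variables (R : realType) (X : normedModType R[i]).

Definition dual : set (X -> R[i]) := [set phi | linear phi /\ continuous phi].

Definition dual_norm (phi : X -> R[i]) : R :=
  sup [set complex.Re `|phi f| | f in [set f : X | `|f| <= 1]].

Definition bounded_operator : set (X -> X) :=
  [set T | linear T /\ continuous T].

Definition weak_cvg {I : Type} (F : set_system I) (u : I -> X) (x : X) :=
  forall phi, dual phi -> phi (u i) @[i --> F] --> phi x.

Definition separates (E : set X) (F : set (X -> R[i])) :=
  forall nu1 nu2, F nu1 -> F nu2 -> nu1 <> nu2 ->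
    exists2 f, E f & nu1 f <> nu2 f.

Definition lin_span (E : set X) : set X :=
  [set f | exists n (a : 'I_n -> R[i]) (e : 'I_n -> X),
     (forall i, E (e i)) /\ f = \sum_(i < n) a i *: e i].

Definition convex_combinations (V : set (X -> X)) : set (X -> X) :=
  [set T | exists n (t : 'I_n -> R[i]) (W : 'I_n -> X -> X),
     [/\ forall i, 0 <= t i, \sum_(i < n) t i = 1, forall i, V (W i) &
         T = fun f => \sum_(i < n) t i *: W i f]].

(* The strong operator topology on the bounded operators is the topology      *)
(* induced by pointwise convergence on X -> X.                                *)
Definition closed_convex_hull (V : set (X -> X)) : set (X -> X) :=
  bounded_operator `&`
  closure (convex_combinations V : set {ptws X -> X}).

(* For closed subspaces of a Banach space an algebraic direct sum is a        *)
(* topological one.                                                           *)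
Definition direct_sum (E F : set X) :=
  (forall f, exists u v, [/\ E u, F v & f = u + v]) /\ E `&` F = [set 0].

Definition projection_onto_along (P : X -> X) (E F : set X) :=
  [/\ P \o P = P, range P = E & [set f | P f = 0] = F].

End operators.
Arguments dual {R} X.

Definition is_mean (R : realType) (G : topologicalType) (m : Cb R G -> R[i]) :=
  [/\ dual (Cb R G) m, m (Cb_cst G 1) = 1 & dual_norm m = 1].

Definition right_amenable (R : realType) (G : semitopologicalSemigroupType) :=
  exists2 m : Cb R G -> R[i], is_mean m & forall g f, m (rtransl g f) = m f.

Definition amenable (R : realType) (G : semitopologicalSemigroupType) :=
  exists2 m : Cb R G -> R[i], is_mean m &
    forall g f, m (rtransl g f) = m f /\ m (ltransl g f) = m f.

(* A representation reverses products, V_g1 V_g2 = V_(g2 g1): the map         *)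
(* g |-> V_g is multiplicative on opposite G. A functional m with             *)
(* m (rtransl g f) = m f on G thus yields averages A with V_g A = A, while    *)
(* averages with A V_g = A, as for right ergodic nets, come from such a       *)
(* functional on opposite G.                                                  *)
Section representations.
Variables (R : realType) (G : semitopologicalSemigroupType).
Variable X : normedModType R[i].
Implicit Type V : G -> X -> X.

Definition bounded_representation V :=
  [/\ forall g, bounded_operator (V g),
      exists M : R[i], forall g f, `|V g f| <= M * `|f|,
      forall g1 g2, V g1 \o V g2 = V (g2 * g1)%g &
      forall f, continuous (fun g => V g f)].

Definition Fix V : set X := [set f | forall g, V g f = f].

Definition Fix_adjoint V : set (X -> R[i]) :=
  dual X `&` [set nu : X -> R[i] | forall g, nu \o V g = nu].

Definition lin_rg V : set X :=
  closure (lin_span [set f - V g f | f in [set: X] & g in [set: G]]).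

Definition clco V : set (X -> X) := closed_convex_hull (range V).

Definition mean_ergodic_projection V (P : X -> X) :=
  clco V P /\ forall T, clco V T -> P \o T = P /\ T \o P = P.

Definition mean_ergodic V := exists P, mean_ergodic_projection V P.

Definition twist (chi : G -> R[i]) V : G -> X -> X :=
  fun g f => chi g *: V g f.

End representations.

Definition is_unitary_character (R : realType) (G : semitopologicalSemigroupType)
    (chi : G -> R[i]) :=
  [/\ continuous chi, forall g h, chi (g * h)%g = chi g * chi h &
      forall g, `|chi g| = 1].

(* A net is a family indexed by a nonempty directed preorder D; it converges  *)
(* along the filter tails D of eventual subsets of D.                         *)
Record directed := Directed {
  dcarrier :> Type;
  dle : dcarrier -> dcarrier -> Prop;
  dle_refl : forall i, dle i i;
  dle_trans : forall i j k, dle i j -> dle j k -> dle i k;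
  dle_directed : forall i j, exists k, dle i k /\ dle j k;
  directed_inhabited : inhabited dcarrier
}.

Definition tails (D : directed) : set_system D :=
  [set A | exists i, [set j | dle i j] `<=` A].
Arguments tails D : clear implicits.

Global Instance tails_filter (D : directed) : ProperFilter (tails D).
Proof.
split; first by move=> [i /(_ i (dle_refl i))].
split.
- by case: (directed_inhabited D) => i0; exists i0.
- move=> A B [i iA] [j jB]; have [k [ik jk]] := dle_directed i j.
  exists k => l kl; split; first exact/iA/(dle_trans ik).
  exact/jB/(dle_trans jk).
- by move=> A B AB [i iA]; exists i; exact: subset_trans AB.
Qed.

Section nets.
Variables (R : realType) (G : semitopologicalSemigroupType).
Variables (X : normedModType R[i]) (V : G -> X -> X).

Definition net_property := forall D : directed, (D -> X -> X) -> Prop.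

Definition right_ergodic_net : net_property := fun D A =>
  (forall i, clco V (A i)) /\
  forall f g, A i f - A i (V g f) @[i --> tails D] --> (0 : X).

Definition ergodic_net : net_property := fun D A =>
  right_ergodic_net A /\
  forall f g, A i f - V g (A i f) @[i --> tails D] --> (0 : X).

Definition weakly_convergent_in (E : set X) : net_property := fun D A =>
  forall f, exists2 h, E h & weak_cvg (tails D) (A^~ f) h.

Definition norm_convergent_in (E : set X) : net_property := fun D A =>
  forall f, exists2 h, E h & A i f @[i --> tails D] --> h.

(* In weakly_convergent_in and norm_convergent_in, E constrains the limits:   *)
(* E = setT means convergence, E = Fix V convergence to fixed points.         *)
Definition some_net (N Q : net_property) := exists D A, N D A /\ Q D A.
Definition every_net (N Q : net_property) := forall D A, N D A -> Q D A.

Definition strong_limit (P : X -> X) : net_property := fun D A =>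
  forall f, A i f @[i --> tails D] --> P f.

Definition weak_limit (P : X -> X) : net_property := fun D A =>
  forall f, weak_cvg (tails D) (A^~ f) (P f).

End nets.

(* measurableType requires a pointed carrier, hence ptopologicalType below;   *)
(* a space carrying a probability measure is nonempty in any case.            *)
Notation borel K := (g_sigma_algebraType (@open K)).

Section uniquely_ergodic.
Variables (R : realType) (K : ptopologicalType).
Local Notation CK := (Cb R K).

Definition markov (S : CK -> CK) :=
  [/\ bounded_operator S,
      forall f : CK, (forall x, 0 <= f x) -> forall x, 0 <= S f x &
      S (Cb_cst K 1) = Cb_cst K 1].

Variable mu : probability (borel K) R.

Definition regular_measure :=
  forall A : set (borel K), measurable A ->
    mu A = ereal_inf [set mu U | U in [set U | @open K U /\ A `<=` U]] /\
    mu A = ereal_sup [set mu F | F in [set F | @compact K F /\ F `<=` A]].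

Definition integralC (f : K -> R[i]) : R[i] :=
  Complex (Rintegral mu setT (fun x => complex.Re (f x)))
          (Rintegral mu setT (fun x => complex.Im (f x))).

Definition L2norm (h : K -> R[i]) : \bar R :=
  Lnorm mu 2%:E (fun x => (complex.Re `|h x|)%:E).

Definition L2 : set (K -> R[i]) :=
  [set h | [/\ measurable_fun setT (fun x : borel K => complex.Re (h x) : R),
               measurable_fun setT (fun x : borel K => complex.Im (h x) : R) &
               (L2norm h < +oo)%E]].

(* Elements of L^2(K, mu) are represented by square integrable functions,     *)
(* equality being equality mu-almost everywhere; the continuous extension of  *)
(* S is determined up to this equality.                                       *)
Definition is_L2_extension (S : CK -> CK) (T : (K -> R[i]) -> (K -> R[i])) :=
  [/\ forall h, L2 h -> L2 (T h),
      forall a h k, L2 h -> L2 k ->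
        {ae mu, forall x, T (a *: h + k) x = a * T h x + T k x},
      exists M : R, forall h, L2 h -> (L2norm (T h) <= M%:E * L2norm h)%E &
      forall f : CK, {ae mu, forall x, T f x = S f x}].

Definition L2_extension (S : CK -> CK) : (K -> R[i]) -> (K -> R[i]) :=
  @xget ((K -> R[i]) -> K -> R[i]) id (is_L2_extension S).

Variables (G : semitopologicalSemigroupType) (S : G -> CK -> CK).

Definition markov_representation :=
  bounded_representation S /\ forall g, markov (S g).

(* The dual of C(K) is taken as a space of functionals; a measure mu is       *)
(* identified with f |-> \int f dmu.                                          *)
Definition uniquely_ergodic :=
  Fix_adjoint S = [set nu : CK -> R[i] | exists c, nu = fun f : CK => c * integralC f].

Definition Fix_L2 (chi : G -> R[i]) : set (K -> R[i]) :=
  [set h | L2 h /\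
     forall g, {ae mu, forall x, chi g * L2_extension (S g) h x = h x}].

End uniquely_ergodic.

(* Main.v *)
Require Import Defs.
From HB Require Import structures.
From mathcomp Require Import all_boot all_order all_algebra.
From mathcomp Require Import complex.
From mathcomp Require Import all_classical all_reals all_analysis.
From mathcomp Require Import measurable_realfun ring lra.
Set Implicit Arguments.
Unset Strict Implicit.
Unset Printing Implicit Defensive.
Import Order.TTheory GRing.Theory Num.Theory.
Import numFieldNormedType.Exports.
Local Open Scope classical_set_scope.
Local Open Scope ring_scope.

(** The abstract half of the theorem concerns a bounded representation V on a
    Banach space X. Day's convexity argument turns an invariant mean into an
    ergodic net: if no convex combination of the V h were almost invariant on
    given finitely many vectors, the Hahn-Banach theorem would give a functional
    bounded below by some e > 0 along orbit differences on which its invariant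
    mean is 0 ([mean_zero_small_combination]). For such a net A, the vectors f
    for which A f converges to a fixed point form a closed subspace, and a
    functional that vanishes on it is V-invariant and vanishes on Fix V. If
    Fix V separates Fix V', this subspace is X, and the limit of A is the mean
    ergodic projection ([separates_norm_convergent],
    [norm_convergent_mean_ergodic]). Conversely, an invariant functional takes
    the same value at f and at a weak limit of A f, so weak convergence to fixed
    points gives separation ([weakly_convergent_separates]). This accounts for
    all assertions but the first.

    The link with L^2 is an estimate for functionals nu invariant under chi S.
    Unique ergodicity and the abstract half make S itself mean ergodic, with
    projection f |-> int f dmu. Now nu u is the value of nu at any convex
    combination of the chi(g) S_g u, and this combination is dominated by the
    same combination of the S_g |u|, which can be taken uniformly close to
    int |u| dmu. Hence |nu u| <= ||nu|| int |u| dmu ([adjoint_fixed_L1_bound]):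
    the variation of nu is at most ||nu|| mu.

    Suppose that the elements of Fix chi S_2 have representatives in Fix chi S,
    and let nu <> 0 be invariant. Vectors u_n of the unit ball that almost
    attain ||nu|| are L^2 Cauchy, by the estimate and the parallelogram law.
    The vectors chi(g) S_g u_n are almost norming as well, so the limit h lies in
    Fix chi S_2, and nu f = ||nu|| for a continuous representative f of h
    ([Fix_L2_of_functional]). Thus Fix chi S separates Fix (chi S)'.

    Suppose instead that chi S is mean ergodic with projection P. For the
    functionals u |-> P u x the estimate says that the sup norm of P u is at
    most int |u| dmu. If h lies in Fix chi S_2 and continuous f_n tend to h in
    L^2, then the P f_n are uniformly Cauchy and tend to h in L^1, and their
    uniform limit is a representative of h in Fix chi S ([mean_ergodic_Fix_L2]).

    The operators S_(g,2) exist because the continuous functions are dense in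
    L^2 by regularity and Urysohn's lemma ([Cb_dense_L2]), L^2 is complete
    ([riesz_fischer]), and |S u|^2 <= S (|u|^2) makes S a contraction for the
    L^2 norm ([markov_L2_contractive]). *)

(** * Sublinear functionals and the separation of convex sets *)

Section sublinear.
Variables (R : realType) (E : lmodType R[i]).
Implicit Types (p q : E -> R) (x y : E).

Definition sublinear p :=
  (forall x y, p (x + y) <= p x + p y) /\
  (forall r x, 0 < r -> p (r%:C%C *: x) <= r * p x).

Definition real_linear p :=
  (forall x y, p (x + y) = p x + p y) /\
  (forall r x, p (r%:C%C *: x) = r * p x).

Lemma sublinear_ge0 p : sublinear p -> 0 <= p 0.
Proof. by move=> [pD _]; have := pD 0 0; rewrite addr0; lra. Qed.

(** Keeps the infima of sublinear functionals below p finite. *)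
Lemma sublinearN p x : sublinear p -> - p (- x) <= p x.
Proof.
move=> sp; have := sublinear_ge0 sp; case: sp => pD _.
by have := pD x (- x); rewrite subrr; lra.
Qed.

Lemma sublinear_homogeneous p t x : sublinear p -> 0 <= t ->
  t * p x <= p (t%:C%C *: x).
Proof.
move=> sp; rewrite le_eqVlt => /orP[/eqP <-|t0].
  by rewrite mul0r scale0r; exact: sublinear_ge0.
rewrite -ler_pdivlMl//; have ti : 0 < t^-1 by rewrite invr_gt0.
have := sp.2 t^-1 (t%:C%C *: x) ti.
by rewrite scalerA -rmorphM mulVf ?gt_eqF// scale1r.
Qed.

(** Chains of sublinear functionals have lower bounds; the subadditivity of
    the infimum rests on the comparability of any two members. *)
Lemma chain_inf_sublinear p (A : set (E -> R)) :
  A !=set0 -> (forall q, A q -> sublinear q /\ forall x, q x <= p x) ->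
  (forall q1 q2, A q1 -> A q2 ->
     (forall x, q1 x <= q2 x) \/ (forall x, q2 x <= q1 x)) ->
  exists q0, [/\ sublinear q0, forall x, q0 x <= p x &
    forall q, A q -> forall x, q0 x <= q x].
Proof.
move=> [q1 Aq1] Ap Atot.
pose q0 x := inf [set q x | q in A].
have lb q x : A q -> q0 x <= q x.
  move=> Aq; apply: ge_inf; last by exists q.
  exists (- p (- x)) => _ [q' Aq' <-].
  have [sq' /(_ (- x)) q'p] := Ap _ Aq'.
  by have := sublinearN x sq'; lra.
have gl x m : (forall q, A q -> m <= q x) -> m <= q0 x.
  move=> H; apply: lb_le_inf; first by exists (q1 x), q1.
  by move=> _ [q Aq <-]; exact: H.
exists q0; split=> [|x|q Aq x]; last exact: lb.
- split=> [x y|r x r0].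
    rewrite -lerBlDr; apply: (gl x) => q Aq; rewrite lerBlDr [leRHS]addrC -lerBlDr.
    apply: (gl y) => q' Aq'; rewrite lerBlDr.
    have [qq'|q'q] := Atot _ _ Aq Aq'.
      have [[qD _] _] := Ap _ Aq.
      by have := qq' y; have := qD x y; have := lb q (x + y) Aq; lra.
    have [[qD _] _] := Ap _ Aq'.
    by have := q'q x; have := qD x y; have := lb q' (x + y) Aq'; lra.
  rewrite -ler_pdivrMl//; apply: (gl) => q Aq; rewrite ler_pdivrMl//.
  by have [[_ qZ] _] := Ap _ Aq; exact: le_trans (lb _ _ Aq) (qZ _ _ r0).
- by apply: le_trans (lb _ _ Aq1) _; case: (Ap _ Aq1).
Qed.

(** The functional is q (x + t x0) - t q x0 minimised over t >= 0. When q is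
    minimal it equals q, so that q x + q x0 <= q (x + x0): minimal sublinear
    functionals are additive. *)
Lemma slide_sublinear q x0 : sublinear q ->
  exists q', [/\ sublinear q', forall x, q' x <= q x &
    forall x, q' x <= q (x + x0) - q x0].
Proof.
move=> sq; have [qD qZ] := sq.
pose q' x := inf [set q (x + t%:C%C *: x0) - t * q x0 | t in [set t | 0 <= t]].
have lb t x : 0 <= t -> q' x <= q (x + t%:C%C *: x0) - t * q x0.
  move=> t0; apply: ge_inf; last by exists t.
  exists (- q (- x)) => _ [s s0 <-].
  have := qD (x + s%:C%C *: x0) (- x); rewrite addrAC subrr add0r.
  by have := sublinear_homogeneous x0 sq s0; lra.
have gl x m : (forall t, 0 <= t -> m <= q (x + t%:C%C *: x0) - t * q x0) -> m <= q' x.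
  move=> H; apply: lb_le_inf; first by exists (q (x + 0%:C%C *: x0) - 0 * q x0), 0 => /=.
  by move=> _ [t t0 <-]; exact: H.
exists q'; split=> [|x|x].
- split=> [x y|r x r0].
    rewrite -lerBlDr; apply: (gl x) => s s0; rewrite lerBlDr [leRHS]addrC -lerBlDr.
    apply: (gl y) => t t0; rewrite lerBlDr.
    have := lb (s + t) (x + y) (addr_ge0 s0 t0).
    rewrite rmorphD scalerDl addrACA.
    have := qD (x + s%:C%C *: x0) (y + t%:C%C *: x0); lra.
  rewrite -ler_pdivrMl//; apply: (gl) => t t0; rewrite ler_pdivrMl//.
  have rt : 0 <= r * t by rewrite mulr_ge0// ltW.
  have := lb (r * t) (r%:C%C *: x) rt.
  rewrite rmorphM -scalerA -scalerDr mulrBr mulrA.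
  by have := qZ r (x + t%:C%C *: x0) r0; lra.
- by have := lb 0 x (lexx _); rewrite scale0r addr0 mul0r subr0.
- by have := lb 1 x ler01; rewrite scale1r mul1r.
Qed.

Lemma additive_sublinear_linear q : sublinear q ->
  (forall x y, q (x + y) = q x + q y) -> real_linear q.
Proof.
move=> sq qD; have [_ qZ] := sq; have q0 : q 0 = 0.
  by have := qD 0 0; rewrite addr0; lra.
have qN x : q (- x) = - q x.
  by have := qD x (- x); rewrite subrr q0; lra.
have qpZ r x : 0 < r -> q (r%:C%C *: x) = r * q x.
  by move=> r0; apply/le_anti; rewrite qZ// sublinear_homogeneous// ltW.
split=> // r x; have [r0|r0|->] := ltrgt0P r.
- exact: qpZ.
- have := qpZ (- r) x; rewrite oppr_gt0 => /(_ r0).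
  by rewrite rmorphN scaleNr qN; lra.
- by rewrite scale0r q0 mul0r.
Qed.

(** Zorn's lemma gives a minimal sublinear functional below p; it is additive
    by [slide_sublinear], and additive sublinear functionals are real-linear.
    *)
Theorem hahn_banach p : sublinear p ->
  exists phi, real_linear phi /\ forall x, phi x <= p x.
Proof.
move=> sp.
pose T := {q : E -> R | sublinear q /\ forall x, q x <= p x}.
(* the order is reversed: a maximal element is a minimal functional *)
pose r (s t : T) := `[< forall x, sval t x <= sval s x >].
have [||||[q [sq qp]] qmin] := @Zorn T r.
- by move=> t; apply/asboolP => x.
- move=> s t u /asboolP st /asboolP tu; apply/asboolP => x.
  exact: le_trans (tu x) (st x).
- move=> [s sP] [t tP] /asboolP/= st /asboolP/= ts; apply: eq_exist.
  by apply/funext => x; apply/le_anti; rewrite st ts.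
- move=> A Atot; have [[t0 At0]|/nonemptyPn A0] := pselect (A !=set0); last first.
    by exists (exist _ p (conj sp (fun=> lexx _))) => s; rewrite A0.
  have [|||q0 [sq0 q0p q0A]] := @chain_inf_sublinear p (sval @` A).
  + by exists (sval t0), t0.
  + by move=> _ [t At <-]; exact: (svalP t).
  + move=> _ _ [s As <-] [t At <-].
    by have [/asboolP|/asboolP] := Atot _ _ As At; [right|left].
  exists (exist _ q0 (conj sq0 q0p)) => s As; apply/asboolP => x /=.
  by apply: q0A; exists s.
exists q; split=> //; apply: additive_sublinear_linear => // x y.
have [qD _] := sq; apply/le_anti; rewrite qD/=.
have [q' [sq' q'q q'y]] := slide_sublinear y sq.
have q'p z : q' z <= p z by exact: le_trans (q'q z) (qp z).
have rqq' : r (exist _ q (conj sq qp)) (exist _ q' (conj sq' q'p)).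
  exact/asboolP.
have /(congr1 sval)/= q'E := qmin _ rqq'.
by have := q'y x; rewrite q'E; lra.
Qed.

Definition real_convex (C : set E) := forall c d (s t : R), C c -> C d ->
  0 <= s -> 0 <= t -> s + t = 1 -> C (s%:C%C *: c + t%:C%C *: d).

(** The functional comes from [hahn_banach] for the largest sublinear q with q
    <= N and q (- c) <= - e on C. The assumption e <= N c is what keeps the
    infimum defining q finite. *)
Theorem convex_separation (N : E -> R) (C : set E) (e : R) :
  sublinear N -> (forall x, N (- x) = N x) ->
  C !=set0 -> real_convex C -> (forall c, C c -> e <= N c) ->
  exists phi, [/\ real_linear phi, forall x, phi x <= N x &
    forall c, C c -> e <= phi c].
Proof.
move=> sN NN [c0 Cc0] cC eN; have [ND NZ] := sN.
pose q y := inf [set N (y + tc.1%:C%C *: tc.2) - tc.1 * e |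
  tc in [set tc : R * E | 0 <= tc.1 /\ C tc.2]].
have lb t c y : 0 <= t -> C c -> q y <= N (y + t%:C%C *: c) - t * e.
  move=> t0 Cc; apply: ge_inf; last by exists (t, c).
  exists (- N y) => _ [[s d]/= [s0 Cd] <-].
  have := ND (y + s%:C%C *: d) (- y); rewrite addrAC subrr add0r NN.
  by have := sublinear_homogeneous d sN s0; have := ler_wpM2l s0 (eN _ Cd); lra.
have gl y m : (forall t c, 0 <= t -> C c -> m <= N (y + t%:C%C *: c) - t * e) -> m <= q y.
  move=> H; apply: lb_le_inf.
    by exists (N (y + 0%:C%C *: c0) - 0 * e), (0, c0) => /=.
  by move=> _ [[t c]/= [t0 Cc] <-]; exact: H.
have sq : sublinear q.
  split=> [x y|r x r0].
    rewrite -lerBlDr; apply: (gl x) => s c s0 Cc; rewrite lerBlDr [leRHS]addrC -lerBlDr.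
    apply: (gl y) => t d t0 Cd; rewrite lerBlDr.
    have [st0|st0] := eqVneq (s + t) 0.
      have s0' : s = 0 by move: s0 t0 st0; lra.
      have t0' : t = 0 by move: s0 t0 st0; lra.
      have := lb 0 c (x + y) (lexx _) Cc.
      rewrite s0' t0' !scale0r !addr0 !mul0r !subr0.
      by have := ND x y; lra.
    have st : 0 < s + t by rewrite lt_def st0 addr_ge0.
    have Ccd : C ((s / (s + t))%:C%C *: c + (t / (s + t))%:C%C *: d).
      apply: cC => //; rewrite ?divr_ge0// ?ltW//.
      by rewrite -mulrDl divff.
    have := lb (s + t) _ (x + y) (ltW st) Ccd.
    rewrite scalerDr !scalerA -!rmorphM !(mulrC (s + t)) !mulfVK//.
    have := ND (x + s%:C%C *: c) (y + t%:C%C *: d).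
    by rewrite addrACA; lra.
  rewrite -ler_pdivrMl//; apply: (gl) => t c t0 Cc; rewrite ler_pdivrMl//.
  have rt : 0 <= r * t by rewrite mulr_ge0// ltW.
  have := lb (r * t) c (r%:C%C *: x) rt Cc.
  rewrite rmorphM -scalerA -scalerDr mulrBr mulrA.
  by have := NZ r (x + t%:C%C *: c) r0; lra.
have [phi [[phiD phiZ] phiq]] := hahn_banach sq.
exists phi; split=> [//|x|c Cc].
  apply: le_trans (phiq x) _.
  by have := lb 0 c0 x (lexx _) Cc0; rewrite scale0r addr0 mul0r subr0.
have := lb 1 c (- c) ler01 Cc; rewrite scale1r addNr.
have N0 : N 0 <= 0.
  by have := NZ (1 / 2) 0; rewrite scaler0; have := sublinear_ge0 sN; lra.
have := phiq (- c); have := phiZ (-1) c; rewrite rmorphN1 scaleN1r.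
by lra.
Qed.

End sublinear.

(** * Real-valued norms *)

Lemma ge0_complexE (R : realType) (z : R[i]) : 0 <= z -> z = (complex.Re z)%:C%C.
Proof. by case: z => a b; rewrite lecE /= => /andP[/eqP -> _]. Qed.

Section rnorm.
Variables (R : realType).
Implicit Types (X Y : normedModType R[i]).

(** Norms of complex normed modules take their values in R[i]; estimates are
    carried out in the ordered field R. *)
Definition rnorm X (x : X) : R := complex.Re `|x|.

Lemma rnormE X (x : X) : `|x| = (rnorm x)%:C%C.
Proof. exact: ge0_complexE. Qed.

Lemma rnorm_ge0 X (x : X) : 0 <= rnorm x.
Proof. by rewrite -lecR -rnormE; exact: normr_ge0. Qed.

Lemma rnorm0 X : rnorm (0 : X) = 0.
Proof. by rewrite /rnorm normr0 raddf0. Qed.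

Lemma rnormD X (x y : X) : rnorm (x + y) <= rnorm x + rnorm y.
Proof. by rewrite -lecR rmorphD/= -!rnormE; exact: ler_normD. Qed.

Lemma rnormN X (x : X) : rnorm (- x) = rnorm x.
Proof. by rewrite /rnorm normrN. Qed.

Lemma rnormB X (x y : X) : rnorm (x - y) = rnorm (y - x).
Proof. by rewrite -opprB rnormN. Qed.

Lemma rnormZ X (a : R[i]) (x : X) : rnorm (a *: x) = rnorm a * rnorm x.
Proof.
by rewrite {1}/rnorm normrZ [`|x|]rnormE normc_Re /= mulr0 subr0.
Qed.

Lemma rnormE_real (r : R) : rnorm (r%:C%C : R[i]) = `|r|.
Proof. by rewrite /rnorm normc_def /= expr0n /= addr0 sqrtr_sqr. Qed.

Lemma rnorm_i : rnorm ('i%C : R[i]) = 1.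
Proof. by rewrite /rnorm normc_def /= expr0n expr1n add0r sqrtr1. Qed.

Lemma rnorm_eq0 X (x : X) : rnorm x = 0 -> x = 0.
Proof. by move=> x0; apply: normr0_eq0; rewrite rnormE x0. Qed.

Lemma rnorm_sum X n (F : 'I_n -> X) :
  rnorm (\sum_i F i) <= \sum_i rnorm (F i).
Proof.
elim/big_ind2: _ => [|x a y b xa yb|//]; first by rewrite rnorm0.
exact: le_trans (rnormD _ _) (lerD xa yb).
Qed.

Lemma cvg_rnorm X I (F : set_system I) (FF : Filter F) (u : I -> X) (x : X) :
  (u i @[i --> F] --> x) <->
  (forall e : R, 0 < e -> \forall i \near F, rnorm (x - u i) < e).
Proof.
split=> [/cvgrPdist_lt ux e e0|ux].
  have := ux e%:C%C; rewrite ltcR => /(_ e0); apply: filterS => i.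
  by rewrite rnormE ltcR.
apply/cvgrPdist_lt => e e0.
have eE := ge0_complexE (ltW e0).
rewrite eE in e0 *; rewrite ltcR in e0.
by apply: filterS (ux _ e0) => i; rewrite rnormE ltcR.
Qed.

Lemma rnormZr X (t : R) (x : X) : 0 <= t -> rnorm (t%:C%C *: x) = t * rnorm x.
Proof.
by move=> t0; rewrite rnormZ rnormE_real ger0_norm.
Qed.

Lemma rnorm_le0 X (x : X) : rnorm x <= 0 -> x = 0.
Proof. by move=> x0; apply/rnorm_eq0/le_anti; rewrite x0 rnorm_ge0. Qed.

Lemma closure_rnormP X (E : set X) x : closure E x <->
  forall e : R, 0 < e -> exists2 y, E y & rnorm (x - y) < e.
Proof.
split=> [Ex e e0|H].
  have /cvg_rnorm/(_ e e0) : y @[y --> x] --> x by exact: cvg_id.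
  by move=> /Ex [y [Ey xy]]; exists y.
move=> A /nbhs_ballP[d /= d0 dA].
have dE := ge0_complexE (ltW d0).
have [|y Ey xy] := H (complex.Re d); first by rewrite -ltcR -dE.
exists y; split=> //; apply: dA.
by rewrite -ball_normE /= rnormE dE ltcR.
Qed.

End rnorm.

Section complex_rnorm.
Variable R : realType.
Implicit Type z : R[i].

Lemma rnormM (a b : R[i]) : rnorm (a * b) = rnorm a * rnorm b.
Proof. exact: (rnormZ a b). Qed.

Lemma rnormc_sqr (z : R[i]) : rnorm z ^+ 2 = complex.Re z ^+ 2 + complex.Im z ^+ 2.
Proof.
case: z => a b; rewrite /rnorm normc_def /= sqr_sqrtr//.
by rewrite addr_ge0 ?sqr_ge0.
Qed.

Lemma conjcM_rnorm (z : R[i]) : z^*%C * z = (rnorm z ^+ 2)%:C%C.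
Proof.
rewrite rnormc_sqr; case: z => a b.
by apply/eqP; rewrite eq_complex /=; apply/andP; split; apply/eqP; ring.
Qed.

(** Turns the modulus of a value of a functional into its value at a rotated
    vector. *)
Lemma rotation (z : R[i]) : exists2 l : R[i], rnorm l = 1 & l * z = (rnorm z)%:C%C.
Proof.
have [z0|z0] := eqVneq (rnorm z) 0.
  by exists 1; rewrite ?mul1r ?z0 ?(rnorm_eq0 z0)// /rnorm normr1.
have rn : rnorm (z^*%C) = rnorm z.
  apply/eqP; rewrite -(@eqrXn2 _ 2)// ?rnorm_ge0// !rnormc_sqr.
  by case: (z) => a b /=; rewrite sqrrN.
have z0' : (rnorm z)%:C%C != 0 :> R[i] by apply: contra z0 => /eqP[->].
exists (z^*%C / (rnorm z)%:C%C); last first.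
  by rewrite mulrAC conjcM_rnorm expr2 rmorphM /= mulfK.
have : rnorm (z^*%C / (rnorm z)%:C%C * (rnorm z)%:C%C) = rnorm z by rewrite divfK.
rewrite rnormM rnormE_real ger0_norm ?rnorm_ge0// => H.
by apply: (mulIf z0); rewrite mul1r.
Qed.

Lemma Re_le_rnorm (z : R[i]) : `|complex.Re z| <= rnorm z.
Proof.
rewrite -(ger0_norm (rnorm_ge0 z)) -[leRHS]sqrtr_sqr -[leLHS]sqrtr_sqr.
by apply: ler_wsqrtr; rewrite rnormc_sqr lerDl sqr_ge0.
Qed.

Lemma Im_le_rnorm (z : R[i]) : `|complex.Im z| <= rnorm z.
Proof.
rewrite -(ger0_norm (rnorm_ge0 z)) -[leRHS]sqrtr_sqr -[leLHS]sqrtr_sqr.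
by apply: ler_wsqrtr; rewrite rnormc_sqr lerDr sqr_ge0.
Qed.

Lemma rnorm_le_ReIm (z : R[i]) : rnorm z <= `|complex.Re z| + `|complex.Im z|.
Proof.
rewrite {1}(complexE z); apply: le_trans (rnormD _ _) _.
by rewrite rnormM rnorm_i mul1r !rnormE_real.
Qed.

Lemma rnorm_dist (a b : R[i]) : `|rnorm a - rnorm b| <= rnorm (a - b).
Proof.
rewrite ler_norml lerBrDr addrC lerBlDr; apply/andP; split; rewrite ?lerBlDr.
  have := rnormD (a - b) (- a); rewrite addrAC subrr add0r !rnormN; lra.
by have := rnormD (a - b) b; rewrite subrK.
Qed.

Lemma Re_realM (t : R) (z : R[i]) : complex.Re (t%:C%C * z) = t * complex.Re z.
Proof. by case: z => a b /=; rewrite mul0r subr0. Qed.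

End complex_rnorm.

(** * Bounded functionals on complex normed spaces *)

Section linear_maps.
Variables (R : realType) (X Y : normedModType R[i]) (T : X -> Y).
Hypothesis linT : linear T.

Lemma lin_map0 : T 0 = 0.
Proof. by have := linT (-1) 0 0; rewrite scaler0 addr0 scaleN1r addNr. Qed.

Lemma lin_mapZ a x : T (a *: x) = a *: T x.
Proof. by have := linT a x 0; rewrite !addr0 lin_map0 addr0. Qed.

Lemma lin_mapD x y : T (x + y) = T x + T y.
Proof. by have := linT 1 x y; rewrite !scale1r. Qed.

Lemma lin_mapN x : T (- x) = - T x.
Proof. by rewrite -scaleN1r lin_mapZ scaleN1r. Qed.

Lemma lin_mapB x y : T (x - y) = T x - T y.
Proof. by rewrite lin_mapD lin_mapN. Qed.

Lemma lin_map_sum n (F : 'I_n -> X) : T (\sum_i F i) = \sum_i T (F i).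
Proof.
elim/big_ind2: _ => [|x a y b <- <-|//]; first exact: lin_map0.
exact: lin_mapD.
Qed.

Lemma rnorm_bounded_continuous (M : R) :
  (forall x, rnorm (T x) <= M * rnorm x) -> continuous T.
Proof.
move=> TM x; apply/cvg_rnorm => e e0.
have M0 : 0 < `|M| + 1 by rewrite ltr_pwDr.
have /cvg_rnorm/(_ (e / (`|M| + 1))) : y @[y --> x] --> x by exact: cvg_id.
rewrite divr_gt0// => /(_ isT); apply: filterS => y xy.
rewrite -lin_mapB; apply: le_lt_trans (TM _) _.
have : M * rnorm (x - y) <= (`|M| + 1) * rnorm (x - y).
  by rewrite ler_wpM2r ?rnorm_ge0// (le_trans (ler_norm M))// lerDl.
by rewrite ltr_pdivlMr// in xy; rewrite mulrC in xy => /le_lt_trans; exact.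
Qed.

Lemma continuous_rnorm_bounded : continuous T ->
  exists2 M : R, 0 < M & forall x, rnorm (T x) <= M * rnorm x.
Proof.
move=> /(_ 0)/cvg_rnorm/(_ 1 ltr01); rewrite lin_map0 => T1.
have [d /= d0 dT] : exists2 d : R, 0 < d & forall x, rnorm x < d -> rnorm (T x) < 1.
  have /nbhs_ballP[d /= d0 dT] := T1.
  have dE := ge0_complexE (ltW d0).
  exists (complex.Re d); first by rewrite -ltcR -dE.
  move=> x xd; rewrite -[T x]opprK -(sub0r (T x)) rnormN; apply: dT.
  by rewrite -ball_normE /= sub0r normrN rnormE dE ltcR.
exists (2 / d) => [|x]; first by rewrite divr_gt0.
have [x0|x0] := eqVneq (rnorm x) 0.
  by rewrite (rnorm_eq0 x0) lin_map0 !rnorm0 mulr0.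
have xp : 0 < rnorm x by rewrite lt_def x0 rnorm_ge0.
have cp : 0 < d / 2 / rnorm x by rewrite !divr_gt0.
have := dT ((d / 2 / rnorm x)%:C%C *: x).
rewrite lin_mapZ !(rnormZr _ (ltW cp)) mulfVK// => /(_ _)/ltW.
have -> : d / 2 < d by lra.
move=> /(_ isT); rewrite -ler_pdivlMl// mulr1.
suff -> : (d / 2 / rnorm x)^-1 = 2 / d * rnorm x by [].
by field; rewrite x0 gt_eqF.
Qed.

End linear_maps.

Section dual_separation.
Variables (R : realType) (X : normedModType R[i]).

(** A complex-linear functional is recovered from its real part phi as phi x -
    i phi (i x). *)
Lemma complexify (phi : X -> R) (M : R) : real_linear phi ->
  (forall x, phi x <= M * rnorm x) ->
  exists2 psi : X -> R[i], dual X psi & forall x, complex.Re (psi x) = phi x.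
Proof.
move=> [phiD phiZ] phiM.
pose psi x : R[i] := Complex (phi x) (- phi ('i%C *: x)).
have phiN x : phi (- x) = - phi x.
  by have := phiZ (-1) x; rewrite rmorphN1 scaleN1r mulN1r.
have psiD x y : psi (x + y) = psi x + psi y.
  by rewrite /psi scalerDr !phiD opprD.
have psiZr (r : R) x : psi (r%:C%C *: x) = r%:C%C * psi x.
  rewrite /psi scalerA mulrC -scalerA !phiZ.
  by apply/eqP; rewrite eq_complex /= !mul0r subr0 addr0 mulrN !eqxx.
have psiZi x : psi ('i%C *: x) = 'i%C * psi x.
  rewrite /psi scalerA -expr2 sqr_i scaleN1r phiN opprK.
  by apply/eqP; rewrite eq_complex /= !mul0r !mul1r !add0r opprK !eqxx.
have psiL : linear psi.
  move=> a x y; rewrite psiD; congr (_ + _).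
  have -> : a = (complex.Re a)%:C%C + 'i%C * (complex.Im a)%:C%C by exact: complexE.
  by rewrite scalerDl psiD -scalerA psiZi !psiZr mulrA -mulrDl.
exists psi => //; split => //.
apply: (@rnorm_bounded_continuous _ _ _ _ psiL (2 * M)) => x.
have phia y : `|phi y| <= M * rnorm y.
  by rewrite ler_norml lerNl phiM -phiN -(rnormN y) phiM.
have -> : psi x = (phi x)%:C%C + 'i%C * (- phi ('i%C *: x))%:C%C by exact: complexE.
apply: le_trans (rnormD _ _) _; rewrite mulrDl mul1r mulrDl.
have -> : rnorm ('i%C * (- phi ('i%C *: x))%:C%C : R[i]) = `|phi ('i%C *: x)|.
  by rewrite rnormM rnorm_i mul1r rnormE_real normrN.
rewrite rnormE_real lerD//; apply: le_trans (phia _) _.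
by rewrite rnormZ rnorm_i mul1r.
Qed.

(** Stated on X^n because several vectors have to be controlled at a time; a
    real functional on X^n is the sum of its restrictions to the n factors. *)
Theorem dual_separation n (C : set ('I_n -> X)) (e : R) :
  C !=set0 -> real_convex C -> (forall c, C c -> e <= \sum_i rnorm (c i)) ->
  exists2 psi : 'I_n -> X -> R[i], forall i, dual X (psi i) &
    forall c, C c -> e <= complex.Re (\sum_i psi i (c i)).
Proof.
move=> C0 cC eC; pose N (c : 'I_n -> X) := \sum_i rnorm (c i).
have sN : sublinear N.
  split=> [c d|r c r0]; rewrite /N.
    by rewrite -big_split /=; apply: ler_sum => i _; exact: rnormD.
  by rewrite mulr_sumr; apply: ler_sum => i _; rewrite (rnormZr _ (ltW r0)).
have NN c : N (- c) = N c by apply: eq_bigr => i _; exact: rnormN.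
have [phi [[phiD phiZ] phiN phiC]] := convex_separation sN NN C0 cC eC.
pose inj i (x : X) : 'I_n -> X := fun j => if j == i then x else 0.
have injD i x y : inj i (x + y) = inj i x + inj i y.
  by apply/funext => j; rewrite /inj fctE; case: eqP; rewrite ?addr0.
have injZ i a x : inj i (a *: x) = a *: inj i x.
  by apply/funext => j; rewrite /inj; case: (eqVneq j i) => ji; rewrite fctE ?ji ?eqxx ?(negbTE ji) ?scaler0.
have injN i x : N (inj i x) = rnorm x.
  rewrite /N (bigD1 i)//= big1 => [|j /negbTE ji]; rewrite /inj ?eqxx ?addr0//.
  by rewrite ji rnorm0.
have H i : exists psi : X -> R[i], dual X psi /\
    forall x, complex.Re (psi x) = phi (inj i x).
  have [||psi ? ?] := @complexify (fun x => phi (inj i x)) 1; last by exists psi.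
    by split=> [x y|r x]; rewrite ?injD ?injZ.
  by move=> x; rewrite mul1r -(injN i); exact: phiN.
have [psi psiP] := choice H.
exists psi => [i|c Cc]; first by case: (psiP i).
have -> : complex.Re (\sum_i psi i (c i)) = \sum_i phi (inj i (c i)).
  by rewrite raddf_sum; apply: eq_bigr => i _; case: (psiP i) => _ <-.
suff <- : phi c = \sum_i phi (inj i (c i)) by exact: phiC.
have phi0 : phi 0 = 0 by have := phiZ 0 0; rewrite scaler0 mul0r.
have -> : \sum_i phi (inj i (c i)) = phi (\sum_i inj i (c i)).
  apply: (big_ind2 (fun (a : R) (b : 'I_n -> X) => a = phi b)) => //.
  by move=> a b a' b' -> ->.
congr phi; apply/funext => j; rewrite fct_sumE (bigD1 j)//= big1 => [|i /negbTE ij].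
  by rewrite /inj eqxx addr0.
by rewrite /inj eq_sym ij.
Qed.

End dual_separation.

(** * The strong closure of the convex hull of a representation *)

Section closure_ptws.
Variables (R : realType) (X : normedModType R[i]).

(** A basic neighbourhood in the strong operator topology constrains finitely
    many vectors. The converse builds the filter generated by the sets of
    approximants. *)
Lemma closure_ptwsP (C : set (X -> X)) (T : X -> X) :
  closure (C : set {ptws X -> X}) T <->
  forall (s : seq X) (e : R), 0 < e ->
    exists2 B, C B & forall x, x \in s -> rnorm (T x - B x) < e.
Proof.
split=> [CT s e e0|H].
  have nF : Filter (nbhs (T : {ptws X -> X})) by exact: nbhs_filter.
  have nT x : nbhs (T : {ptws X -> X}) [set B : X -> X | rnorm (T x - B x) < e].
    have nE : {ptws, nbhs (T : {ptws X -> X}) --> (T : {ptws X -> X})} by exact: cvg_id.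
    have := (pointwise_cvgP _ (nbhs_filter (T : {ptws X -> X}))).1 nE x.
    move/(cvg_rnorm (nbhs_filter (T : {ptws X -> X})) (fun g => g x) (T x)).1.
    exact.
  have : nbhs (T : {ptws X -> X})
      [set B : X -> X | forall x, x \in s -> rnorm (T x - B x) < e].
    elim: s => [|x s IH]; first by apply: (@filterS _ _ nF _ _ _ filterT) => B _ x; rewrite in_nil.
    apply: (@filterS _ _ nF _ _ _ (filterI (nT x) IH)) => B [/= Bx Bs] y.
    by rewrite inE => /orP[/eqP ->//|/Bs].
  by move=> /CT [B [CB Bs]]; exists B.
pose U (p : seq X * R) := [set B | C B /\ forall x, x \in p.1 -> rnorm (T x - B x) < p.2].
pose F : set_system (X -> X) := [set A | exists2 p, 0 < p.2 & U p `<=` A].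
have FF : Filter F.
  split; first by exists ([::], 1).
  - move=> A B [[s e] /= e0 sA] [[t d] /= d0 tB].
    exists (s ++ t, Num.min e d) => [|S [CS Sst]]; first by rewrite lt_min e0.
    split; [apply: sA|apply: tB]; split => // x xs.
    - by have := Sst x; rewrite mem_cat xs => /(_ isT); rewrite lt_min => /andP[].
    - by have := Sst x; rewrite mem_cat xs orbT => /(_ isT); rewrite lt_min => /andP[].
  - by move=> A B AB [p p0 pA]; exists p => //; exact: subset_trans AB.
rewrite closureEcvg; exists F.
  split=> //; move=> [[s e] /= e0 /= UA].
  by have [B CB Bs] := H s e e0; exact: (UA B).
split; last by move=> A CA; exists ([::], 1) => // B [/CA].
apply/pointwise_cvgP => x; apply/cvg_rnorm => e e0.
by exists ([:: x], e) => //= B [_ Bx]; apply: Bx; rewrite inE.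
Qed.

End closure_ptws.

Section convex_hull.
Variables (R : realType) (G : semitopologicalSemigroupType).
Variables (X : normedModType R[i]) (V : G -> X -> X).
Hypothesis repV : bounded_representation V.

Lemma repV_linear g : linear (V g).
Proof. by case: repV => H _ _ _; exact: (H g).1. Qed.

Lemma repV_continuous g : continuous (V g).
Proof. by case: repV => H _ _ _; exact: (H g).2. Qed.

Lemma repVM g h f : V g (V h f) = V (h * g)%g f.
Proof. by case: repV => _ _ /(_ g h) <-. Qed.

Lemma repV_bound : exists2 M : R, 0 < M & forall g f, rnorm (V g f) <= M * rnorm f.
Proof.
case: repV => _ [M VM] _ _; exists (complex.Re `|M| + 1).
  by apply: ltr_wpDl => //; exact: (rnorm_ge0 (M : R[i])).
move=> g f; rewrite -lecR -rnormE rmorphM/= -rnormE.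
apply: le_trans (VM g f) _.
have Mf : 0 <= M * `|f| by exact: le_trans (normr_ge0 _) (VM g f).
rewrite -(ger0_norm Mf) normrM normr_id ler_wpM2r//.
by rewrite rmorphD/= -normc_Re lerDl ler01.
Qed.

Local Notation co := (convex_combinations (range V)).

Lemma convex_combinationsP B : co B <-> exists n (t : 'I_n -> R) (h : 'I_n -> G),
  [/\ forall i, 0 <= t i, \sum_i t i = 1 &
      B = fun f => \sum_i (t i)%:C%C *: V (h i) f].
Proof.
split=> [[n [t [W [t0 t1 WV ->]]]]|[n [t [h [t0 t1 ->]]]]].
  have /choice[h hP] : forall i, exists g, V g = W i.
    by move=> i; have [g _ gW] := WV i; exists g.
  have tE i := ge0_complexE (t0 i).
  exists n, (fun i => complex.Re (t i)), h; split=> [i||].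
  - by rewrite -lecR -tE.
  - by rewrite -raddf_sum t1.
  - by apply/funext => f; apply: eq_bigr => i _; rewrite -tE hP.
exists n, (fun i => (t i)%:C%C), (fun i => V (h i)); split.
- by move=> i; rewrite lecR.
- by rewrite -[RHS]/(1%:C%C) -t1 rmorph_sum.
- by move=> i; exists (h i).
- by [].
Qed.

Lemma co_V g : co (V g).
Proof.
apply/convex_combinationsP; exists 1%N, (fun=> 1), (fun=> g); split=> //; first by rewrite big_ord1.
by apply/funext => f; rewrite big_ord1 scale1r.
Qed.

Lemma co_comp g B : co B -> co (V g \o B).
Proof.
move=> /convex_combinationsP[n [t [h [t0 t1 ->]]]]; apply/convex_combinationsP; exists n, t, (fun i => (h i * g)%g).
split=> //; apply/funext => f /=; rewrite (lin_map_sum (@repV_linear g)).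
by apply: eq_bigr => i _; rewrite (lin_mapZ (@repV_linear g)) repVM.
Qed.

Lemma co_linear B : co B -> linear B.
Proof.
move=> /convex_combinationsP[n [t [h [t0 t1 ->]]]] a x y /=.
rewrite scaler_sumr -big_split/=; apply: eq_bigr => i _.
by rewrite repV_linear scalerDr !scalerA mulrC.
Qed.

(** Convex inequalities pass from the generators V g to their convex
    combinations. *)
Lemma co_sublinear_le B (N : X -> R) (r : R) f : co B ->
  (forall x y, N (x + y) <= N x + N y) -> N 0 <= 0 ->
  (forall t x, 0 <= t -> N (t%:C%C *: x) <= t * N x) ->
  (forall g, N (V g f) <= r) -> N (B f) <= r.
Proof.
move=> /convex_combinationsP[n [t [h [t0 t1 ->]]]] ND N0 NZ NV.
rewrite -[leRHS]mul1r -t1 mulr_suml.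
apply: (@big_ind2 _ _ (fun x a => N x <= a)) => // [x a y b xa yb|i _].
  exact: le_trans (ND _ _) (lerD xa yb).
by apply: le_trans (NZ _ _ (t0 i)) _; rewrite ler_wpM2l.
Qed.

Lemma co_bound B (M : R) f : (forall g f, rnorm (V g f) <= M * rnorm f) ->
  co B -> rnorm (B f) <= M * rnorm f.
Proof.
move=> VM coB; apply: (@co_sublinear_le B (@rnorm _ X)) => //.
- exact: rnormD.
- by rewrite rnorm0.
- by move=> t x t0; rewrite rnormZr.
Qed.

Lemma co_continuous B : co B -> continuous B.
Proof.
move=> coB; have [M _ VM] := repV_bound.
apply: (rnorm_bounded_continuous (co_linear coB)) => x.
exact: co_bound VM coB.
Qed.

Lemma co_clco : co `<=` clco V.
Proof.
move=> B coB; split; last exact: subset_closure.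
by split; [exact: co_linear|exact: co_continuous].
Qed.

Lemma clco_V g : clco V (V g). Proof. exact: co_clco (co_V g). Qed.

Lemma clco_approx T (s : seq X) (e : R) : clco V T -> 0 < e ->
  exists2 B, co B & forall x, x \in s -> rnorm (T x - B x) < e.
Proof. by move=> [_ /closure_ptwsP]; exact. Qed.

Lemma clco_linear T : clco V T -> linear T. Proof. by case=> -[H _] _; exact: H. Qed.
Lemma clco_continuous T : clco V T -> continuous T. Proof. by case=> -[_ H] _; exact: H. Qed.

(** Balls are closed, so a distance estimate for the B f, B in the convex
    hull, passes to the strong closure. *)
Lemma clco_rnorm_le T f y (r : R) : clco V T ->
  (forall B, co B -> rnorm (y - B f) <= r) -> rnorm (y - T f) <= r.
Proof.
move=> cT H; apply/ler_addgt0Pr => e e0.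
have [B coB /(_ f)] := clco_approx [:: f] cT e0; rewrite inE => /(_ (eqxx _)) TB.
have -> : y - T f = y - B f + (B f - T f) by rewrite addrA subrK.
apply: le_trans (rnormD _ _) _; apply: lerD; first exact: H.
by rewrite rnormB ltW.
Qed.

Lemma clco_bound T (M : R) f : (forall g f, rnorm (V g f) <= M * rnorm f) ->
  clco V T -> rnorm (T f) <= M * rnorm f.
Proof.
move=> VM cT; rewrite -rnormN -sub0r; apply: clco_rnorm_le => // B coB.
by rewrite sub0r rnormN; exact: co_bound.
Qed.

Lemma clco_comp g T : clco V T -> clco V (V g \o T).
Proof.
move=> cT; split; [split|].
- by move=> a x y /=; rewrite (clco_linear cT) repV_linear.
- by move=> x; apply: continuous_comp; [exact: clco_continuous|exact: repV_continuous].
apply/closure_ptwsP => s e e0; have [M M0 VM] := repV_bound.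
have [B coB sB] := clco_approx s cT (divr_gt0 e0 M0).
exists (V g \o B) => [|x xs]; first exact: co_comp.
rewrite /= -(lin_mapB (@repV_linear g)); apply: le_lt_trans (VM _ _) _.
by rewrite mulrC -ltr_pdivlMr// sB.
Qed.

Lemma co_fix B f : co B -> Fix V f -> B f = f.
Proof.
move=> /convex_combinationsP[n [t [h [t0 t1 ->]]]] Vf.
under eq_bigr do rewrite Vf.
by rewrite -scaler_suml -rmorph_sum t1 scale1r.
Qed.

Lemma clco_fix T f : clco V T -> Fix V f -> T f = f.
Proof.
move=> cT Vf; apply/esym/eqP; rewrite -subr_eq0; apply/eqP/rnorm_le0.
by apply: clco_rnorm_le => // B coB; rewrite (co_fix coB Vf) subrr rnorm0.
Qed.

Lemma co_adjoint nu B f : Fix_adjoint V nu -> co B -> nu (B f) = nu f.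
Proof.
move=> [[nuL _] nuV] /convex_combinationsP[n [t [h [t0 t1 ->]]]].
rewrite (lin_map_sum nuL).
transitivity (\sum_i (t i)%:C%C *: nu f).
  apply: eq_bigr => i _; rewrite (lin_mapZ nuL); congr (_ *: _).
  by rewrite -[in RHS](nuV (h i)).
by rewrite -scaler_suml -rmorph_sum t1 scale1r.
Qed.

Lemma clco_adjoint nu T f : Fix_adjoint V nu -> clco V T -> nu (T f) = nu f.
Proof.
move=> Fnu cT; have [[nuL nuc] _] := Fnu.
have [N N0 nuN] := continuous_rnorm_bounded nuL nuc.
apply/eqP; rewrite -subr_eq0; apply/eqP/rnorm_le0/ler_addgt0Pr => e e0.
have [B coB /(_ f)] := clco_approx [:: f] cT (divr_gt0 e0 N0).
rewrite inE => /(_ (eqxx _)) TB.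
rewrite -(co_adjoint f Fnu coB) -(lin_mapB nuL) add0r.
apply: le_trans (nuN _) _.
by rewrite mulrC -ler_pdivlMr// ltW.
Qed.

Lemma co_lin_span B f : co B ->
  lin_span [set f - V g f | f in [set: X] & g in [set: G]] (f - B f).
Proof.
move=> /convex_combinationsP[n [t [h [t0 t1 ->]]]].
exists n, (fun i => (t i)%:C%C), (fun i => f - V (h i) f); split.
  by move=> i; exists f => //; exists (h i).
under [RHS]eq_bigr do rewrite scalerBr.
by rewrite sumrB -scaler_suml -rmorph_sum t1 scale1r.
Qed.

Lemma clco_lin_rg T f : clco V T -> lin_rg V (f - T f).
Proof.
move=> cT; apply/closure_rnormP => e e0.
have [B coB /(_ f)] := clco_approx [:: f] cT e0; rewrite inE => /(_ (eqxx _)) TB.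
exists (f - B f); first exact: co_lin_span.
by rewrite opprB addrC addrA subrK rnormB.
Qed.

End convex_hull.

(** * Means and convex combinations of orbits *)

Section Cb_norm.
Variables (R : realType) (T : topologicalType).

Lemma rnorm_Cb_le (f : Cb R T) (M : R) : 0 <= M ->
  (forall x, rnorm (f x) <= M) -> rnorm f <= M.
Proof.
move=> M0 fM; rewrite -lecR -rnormE; apply: sup_norm_le; first by rewrite lecR.
by move=> x; rewrite normc_Re lecR; exact: fM.
Qed.

Lemma rnorm_Cb_ge (f : Cb R T) x : rnorm (f x) <= rnorm f.
Proof. by rewrite -lecR -!rnormE; exact: ler_sup_norm. Qed.

End Cb_norm.

Section means.
Variables (R : realType) (G : semitopologicalSemigroupType).
Variable m : Cb R G -> R[i].
Hypothesis mean_m : is_mean m.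

Lemma mean_linear : linear m. Proof. by case: mean_m => -[H _] _ _; exact: H. Qed.

Lemma mean_norm F : rnorm (m F) <= rnorm F.
Proof.
case: mean_m => -[mL mc] _ m1.
have [M M0 mM] := continuous_rnorm_bounded mL mc.
have [F0|F0] := eqVneq (rnorm F) 0.
  by rewrite (rnorm_eq0 F0) (lin_map0 mL) !rnorm0.
have Fp : 0 < rnorm F by rewrite lt_def F0 rnorm_ge0.
have Fi : 0 <= (rnorm F)^-1 by rewrite invr_ge0 ltW.
have : rnorm (m ((rnorm F)^-1%:C%C *: F)) <= 1.
  rewrite -[leRHS]m1; apply: ub_le_sup; last first.
    exists ((rnorm F)^-1%:C%C *: F) => //=.
    by rewrite rnormE -[leRHS]/(1%:C%C) lecR rnormZr// mulVf.
  exists M => _ [f /= f1 <-]; apply: le_trans (mM f) _.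
  by rewrite ger_pMr// -lecR -rnormE.
by rewrite (lin_mapZ mL) rnormZr// ler_pdivrMl// mulr1.
Qed.

(** Means are positive. If m F = 0 then m (N - F) = N for every constant N,
    whereas for large N the norm of N - F is below N: its square is at most
    N^2 - 2 N e + |F|^2. *)
Lemma mean_neq0 (F : Cb R G) (e : R) : 0 < e -> (forall h, e <= complex.Re (F h)) -> m F <> 0.
Proof.
move=> e0 eF mF0; pose B := rnorm F; pose N := B ^+ 2 / e + 1.
have N0 : 0 < N by rewrite ltr_wpDl// divr_ge0 ?sqr_ge0// ltW.
have NeE : N * e = B ^+ 2 + e by rewrite /N; field; rewrite gt_eqF.
(* N is large enough for 2 N e > B^2 *)
pose C := Num.sqrt (N ^+ 2 - 2 * (N * e) + B ^+ 2).
have CN : C < N.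
  rewrite -[ltRHS](gtr0_norm N0) -[ltRHS]sqrtr_sqr ltr_sqrt ?exprn_gt0//.
  by rewrite NeE; have := sqr_ge0 B; lra.
have : rnorm (m (Cb_cst G N%:C%C - F)) <= C.
  apply: le_trans (mean_norm _) _; apply: rnorm_Cb_le => [|h]; first exact: sqrtr_ge0.
  rewrite -(ger0_norm (rnorm_ge0 _)) -sqrtr_sqr; apply: ler_wsqrtr.
  rewrite rnormc_sqr.
  have -> : (Cb_cst G N%:C%C - F) h = Complex (N - complex.Re (F h)) (- complex.Im (F h)).
    by rewrite -[LHS]/(N%:C%C - F h); case: (F h) => a b; apply/eqP; rewrite eq_complex /= sub0r !eqxx.
  have : rnorm (F h) ^+ 2 <= B ^+ 2.
    by rewrite lerXn2r ?nnegrE ?rnorm_ge0//; exact: rnorm_Cb_ge.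
  rewrite rnormc_sqr /= sqrrN sqrrB.
  have := ler_wpM2l (ltW N0) (eF h); lra.
have -> : Cb_cst G N%:C%C = N%:C%C *: Cb_cst G 1.
  by apply: CbP => x; rewrite -[RHS]/(N%:C%C * 1) mulr1.
case: mean_m => -[mL _] m1 _.
rewrite (lin_mapB mL) mF0 subr0 (lin_mapZ mL) m1 (rnormZr _ (ltW N0)).
have -> : rnorm (1 : R[i]) = 1 by rewrite /rnorm normr1.
by rewrite mulr1 leNgt CN.
Qed.

Lemma mean_inhabited : inhabited G.
Proof.
apply: contrapT => nG.
case: mean_m => -[mL _] m1 _.
have : m (Cb_cst G 1) = 0.
  rewrite -(lin_map0 mL); congr m; by apply: CbP => x; case: nG.
by rewrite m1 => /eqP; rewrite oner_eq0.
Qed.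

Definition weights k (t : 'I_k -> R) := (forall j, 0 <= t j) /\ \sum_j t j = 1.

(** Day's argument. Otherwise the convex combinations of the points of the
    family stay away from 0, and a separating functional has real part at
    least e along the family, so its mean cannot be 0. *)
Lemma mean_zero_small_combination (X : normedModType R[i]) n (a : 'I_n -> G -> X) :
  (forall i, continuous (a i)) -> (forall i, exists M, forall h, rnorm (a i h) <= M) ->
  (forall i psi (F : Cb R G), dual X psi -> (forall h, F h = psi (a i h)) -> m F = 0) ->
  forall e : R, 0 < e -> exists k (t : 'I_k -> R) (h : 'I_k -> G),
    weights t /\ forall i, rnorm (\sum_j (t j)%:C%C *: a i (h j)) < e.
Proof.
move=> ca ba ma e e0.
pose C : set ('I_n -> X) := [set c | exists k (t : 'I_k -> R) (h : 'I_k -> G),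
  weights t /\ c = fun i => \sum_j (t j)%:C%C *: a i (h j)].
have Ca h : C (fun i => a i h).
  exists 1%N, (fun=> 1), (fun=> h); split; first by split => //; rewrite big_ord1.
  by apply/funext => i; rewrite big_ord1 scale1r.
apply: contrapT => H.
have [g] := mean_inhabited.
have [|||psi psid psiC] := @dual_separation _ X n C e.
- by exists (fun i => a i g).
- move=> _ _ u v [k [s [x [[s0 s1] ->]]]] [l [t [y [[t0 t1] ->]]]] u0 v0 uv1.
  exists (k + l)%N, (fun j : 'I_(k + l) => match fintype.split j with inl j => u * s j | inr j => v * t j end),
    (fun j : 'I_(k + l) => match fintype.split j with inl j => x j | inr j => y j end).
  split; first split.
  + by move=> j; case: splitP => j' _; rewrite mulr_ge0.
  + rewrite big_split_ord /= -[RHS]uv1; congr (_ + _).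
      under eq_bigr do rewrite (unsplitK (inl _)).
      by rewrite -mulr_sumr s1 mulr1.
    under eq_bigr do rewrite (unsplitK (inr _)).
    by rewrite -mulr_sumr t1 mulr1.
  + apply/funext => i; rewrite big_split_ord; congr (_ + _).
      rewrite fctE scaler_sumr; apply: eq_bigr => j _.
      by rewrite (unsplitK (inl _)) scalerA rmorphM.
    rewrite fctE scaler_sumr; apply: eq_bigr => j _.
    by rewrite (unsplitK (inr _)) scalerA rmorphM.
- move=> _ [k [t [x [wt ->]]]]; rewrite leNgt; apply/negP => lte; apply: H.
  exists k, t, x; split => // i; apply: le_lt_trans lte.
  by rewrite (bigD1 i)//= lerDl sumr_ge0// => j _; exact: rnorm_ge0.
have FP i : exists F : Cb R G, forall h, F h = psi i (a i h).
  have [psiL psic] := psid i.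
  have [N N0 psiN] := continuous_rnorm_bounded psiL psic; have [M aM] := ba i.
  suff iC : (fun h => psi i (a i h)) \in @is_Cb R G by exists (MkCb iC).
  apply/is_CbP; split.
    move=> h; apply: (@continuous_comp _ _ _ (a i) (psi i)); first exact: ca.
    exact: psic.
  exists (N * M) => h; rewrite -[`|_|]/(`|psi i (a i h) : R[i]^o|) normc_Re lecR.
  by apply: le_trans (psiN _) _; rewrite ler_wpM2l// ltW.
have [F FE] := choice FP.
have : m (\sum_i F i) <> 0.
  apply: (mean_neq0 e0) => h.
  have -> : (\sum_i F i) h = \sum_i psi i (a i h).
    transitivity (\sum_i F i h); last by apply: eq_bigr => i _; exact: FE.
    exact: (big_morph (fun f : Cb R G => f h) (id1 := 0) (op1 := +%R)).
  by apply: psiC; exact: Ca.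
apply; rewrite (lin_map_sum mean_linear) big1// => i _.
exact: ma (psid i) (FE i).
Qed.

End means.

(** * Ergodic nets of an amenable semigroup *)

Lemma invS_small (R : realType) (e : R) : 0 < e ->
  exists N, forall n, (N <= n)%N -> n.+1%:R^-1 < e.
Proof.
move=> e0; exists (Num.truncn e^-1) => n Nn.
rewrite -[ltRHS]invrK ltf_pV2 ?posrE ?invr_gt0 ?ltr0n//=.
by apply/(lt_le_trans (truncnS_gt _)); rewrite ler_nat.
Qed.

Section ergodic_nets.
Variables (R : realType) (G : semitopologicalSemigroupType).
Variables (X : normedModType R[i]) (V : G -> X -> X).
Hypothesis repV : bounded_representation V.
Local Notation co := (convex_combinations (range V)).

(** The index set consists of finite lists of conditions together with a
    precision. *)
Lemma net_of_approximations (I : eqType) (dist : I -> (X -> X) -> R) :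
  (forall (s : seq I) (e : R), 0 < e ->
     exists2 B, co B & forall p, p \in s -> dist p B < e) ->
  exists (D : directed) (A : D -> X -> X), (forall i, co (A i)) /\
    forall p (e : R), 0 < e -> \forall i \near tails D, dist p (A i) < e.
Proof.
move=> H.
have H' (i : seq I * nat) : exists B, co B /\ forall p, p \in i.1 -> dist p B < i.2.+1%:R^-1.
  by have [|B] := H i.1 (i.2.+1%:R^-1); [rewrite invr_gt0 ltr0n|exists B].
have [A AP] := choice H'.
pose le (i j : seq I * nat) := {subset i.1 <= j.1} /\ (i.2 <= j.2)%N.
have le_refl i : le i i by split.
have le_trans i j k : le i j -> le j k -> le i k.
  move=> [ij ij'] [jk jk']; split; last exact: leq_trans jk'.
  by move=> x /ij/jk.
have le_dir i j : exists k, le i k /\ le j k.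
  exists (i.1 ++ j.1, maxn i.2 j.2); split; split; rewrite /= ?leq_maxl ?leq_maxr//.
    by move=> x xi; rewrite mem_cat xi.
  by move=> x xi; rewrite mem_cat xi orbT.
exists (Directed le_refl le_trans le_dir (inhabits ([::], 0%N))), A.
split=> [i|p e e0]; first by case: (AP i).
have [N NP] := invS_small e0; exists ([:: p], N) => -[s n] [/= ps Nn].
by have [_ As] := AP (s, n); apply: lt_trans (As p _) (NP n Nn); apply: ps; rewrite inE.
Qed.

(** For p = (f, g, b) this measures the failure of invariance of B at f under
    V g, on the right if b holds and on the left otherwise. *)
Definition defect (p : X * G * bool) (B : X -> X) : X :=
  B p.1.1 - (if p.2 then B (V p.1.2 p.1.1) else V p.1.2 (B p.1.1)).

(** The defects of a convex combination of the V h are the combinations of the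
    vectors V h f - V (h') f with h' a translate of h, and the invariant mean
    of a functional along these vectors is 0. *)
Lemma mean_almost_invariant (m : Cb R G -> R[i]) (s : seq (X * G * bool)) (e : R) :
  is_mean m ->
  (forall p (F : Cb R G), p \in s ->
     m (if p.2 then ltransl p.1.2 F else rtransl p.1.2 F) = m F) ->
  0 < e -> exists2 B, co B & forall p, p \in s -> rnorm (defect p B) < e.
Proof.
move=> mm ms e0; have [M M0 VM] := repV_bound repV.
have Vc f : continuous (fun g => V g f) by case: repV.
pose mulb (p : X * G * bool) h := if p.2 then (p.1.2 * h)%g else (h * p.1.2)%g.
have mulbc p : continuous (mulb p).
  by case: p => -[f g] [] /=; [exact: mulg_continuousl|exact: mulg_continuousr].
pose a (i : 'I_(size s)) h : X :=
  let p := tnth (in_tuple s) i in V h p.1.1 - V (mulb p h) p.1.1.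
have defectE p h : defect p (V h) = V h p.1.1 - V (mulb p h) p.1.1.
  by case: p => -[f g] [] /=; rewrite /defect/= (repVM repV).
have [||| k [t [h [[t0 t1] th]]]] := @mean_zero_small_combination _ _ m mm X _ a _ _ _ e e0.
- move=> i h; apply: cvgB; first exact: Vc.
  exact: (@continuous_comp _ _ _ (mulb (tnth (in_tuple s) i)) (fun g => V g _)
    h (mulbc _ h) (Vc _ _)).
- move=> i; exists (M * rnorm (tnth (in_tuple s) i).1.1 + M * rnorm (tnth (in_tuple s) i).1.1) => h.
  by apply: le_trans (rnormD _ _) _; rewrite rnormN lerD.
- move=> i psi F [psiL psic] FE.
  set p := tnth (in_tuple s) i in FE.
  have [N N0 psiN] := continuous_rnorm_bounded psiL psic.
  have F1C : (fun h => psi (V h p.1.1)) \in @is_Cb R G.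
    apply/is_CbP; split.
      move=> h; apply: (@continuous_comp _ _ _ (fun g => V g p.1.1) psi); first exact: Vc.
      exact: psic.
    exists (N * (M * rnorm p.1.1)) => h.
    rewrite -[`|_|]/(`|psi (V h p.1.1) : R[i]^o|) normc_Re lecR.
    by apply: le_trans (psiN _) _; rewrite ler_wpM2l// ltW.
  pose F1 := MkCb F1C.
  have -> : F = F1 - (if p.2 then ltransl p.1.2 F1 else rtransl p.1.2 F1).
    apply: CbP => h; rewrite FE /a (lin_mapB psiL) -/p.
    rewrite -[RHS]/(F1 h - (if p.2 then ltransl p.1.2 F1 else rtransl p.1.2 F1) h).
    by rewrite /mulb; case: p.2.
  rewrite (lin_mapB (mean_linear mm)) ms ?subrr//.
  exact: mem_tnth.
pose B f := \sum_j (t j)%:C%C *: V (h j) f.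
have coB : co B by apply/convex_combinationsP; exists k, t, h.
exists B => // p ps.
have /tnthP[i pE] : p \in in_tuple s by [].
have <- : \sum_j (t j)%:C%C *: a i (h j) = defect p B; last exact: th.
rewrite /a -pE.
under eq_bigr do rewrite -defectE /defect scalerBr.
rewrite sumrB; congr (_ - _).
case: p.2 => //.
rewrite /B (lin_map_sum (repV_linear repV p.1.2)).
by apply: eq_bigr => j _; rewrite (lin_mapZ (repV_linear repV p.1.2)).
Qed.

Lemma right_ergodic_net_exists (m : Cb R G -> R[i]) : is_mean m ->
  (forall g F, m (ltransl g F) = m F) ->
  exists (D : directed) (A : D -> X -> X), right_ergodic_net V A.
Proof.
move=> mm ml.
have [s e e0|D [A [coA Anear]]] :=
    @net_of_approximations _ (fun (p : X * G) B => rnorm (defect (p, true) B)).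
  have [p F /mapP[q _ ->]|B coB sB] := @mean_almost_invariant m [seq (p, true) | p <- s] e mm _ e0.
    exact: ml.
  by exists B => // p ps; apply: sB; apply/mapP; exists p.
exists D, A; split=> [i|f g]; first exact: (co_clco repV).
apply/cvg_rnorm => e e0; apply: filterS (Anear (f, g) e e0) => i.
by rewrite sub0r rnormN.
Qed.

Lemma ergodic_net_exists (m : Cb R G -> R[i]) : is_mean m ->
  (forall g F, m (rtransl g F) = m F /\ m (ltransl g F) = m F) ->
  exists (D : directed) (A : D -> X -> X), ergodic_net V A.
Proof.
move=> mm ml.
have [s e e0|D [A [coA Anear]]] :=
    @net_of_approximations _ (fun (p : X * G * bool) B => rnorm (defect p B)).
  by apply: mean_almost_invariant mm _ e0 => p F _; case: p.2; case: (ml p.1.2 F).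
exists D, A; split; [split=> [i|f g]|move=> f g].
- exact: (co_clco repV).
- apply/cvg_rnorm => e e0; apply: filterS (Anear (f, g, true) e e0) => i.
  by rewrite sub0r rnormN.
- apply/cvg_rnorm => e e0; apply: filterS (Anear (f, g, false) e e0) => i.
  by rewrite sub0r rnormN.
Qed.

End ergodic_nets.

(** * The mean ergodic theorem for bounded representations *)

Section mean_ergodicity.
Variables (R : realType) (G : semitopologicalSemigroupType).
Variables (X : normedModType R[i]) (V : G -> X -> X).
Hypothesis repV : bounded_representation V.
Local Notation co := (convex_combinations (range V)).

Definition sequentially_complete := forall u : nat -> X,
  (forall e : R, 0 < e -> exists N, forall n m, (N <= n)%N -> (N <= m)%N -> rnorm (u n - u m) < e) ->
  exists l, forall e : R, 0 < e -> exists N, forall n, (N <= n)%N -> rnorm (l - u n) < e.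

(** A singleton that misses 0 is separated from 0. *)
Lemma dual_separates x y : (forall phi, dual X phi -> phi x = phi y) -> x = y.
Proof.
move=> H; apply/eqP; rewrite -subr_eq0; apply/eqP/rnorm_eq0.
apply: contrapT => /eqP xy; have xy0 : 0 < rnorm (x - y) by rewrite lt_def xy rnorm_ge0.
have [|||psi /(_ ord0) psid psiC] := @dual_separation _ X 1 [set fun=> x - y] (rnorm (x - y)).
- by exists (fun=> x - y).
- move=> _ _ s t -> -> _ _ st; apply/funext => i /=.
  by rewrite fctE -scalerDl -rmorphD st scale1r.
- by move=> _ ->; rewrite big_ord1.
have := psiC _ erefl; rewrite big_ord1 (lin_mapB psid.1) (H _ psid) subrr /=.
by rewrite leNgt xy0.
Qed.

Lemma weak_cvg_unique (D : directed) (u : D -> X) x y :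
  weak_cvg (tails D) u x -> weak_cvg (tails D) u y -> x = y.
Proof.
move=> ux uy; apply: dual_separates => phi phid.
exact: (cvg_unique (@norm_hausdorff _ _) (ux _ phid) (uy _ phid)).
Qed.

Lemma strong_weak_cvg (D : directed) (u : D -> X) x :
  u i @[i --> tails D] --> x -> weak_cvg (tails D) u x.
Proof. by move=> ux phi [_ phic]; apply: (continuous_cvg _ (phic x)). Qed.

Lemma clco_equibounded : exists2 M : R, 0 < M &
  forall T f, clco V T -> rnorm (T f) <= M * rnorm f.
Proof.
have [M M0 VM] := repV_bound repV; exists M => // T f.
exact: clco_bound.
Qed.

Section net.
Variables (D : directed) (A : D -> X -> X).
Hypothesis netA : right_ergodic_net V A.

(** Each A i (h - V g h) tends to 0 by definition; equicontinuity extends this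
    to the closed span. *)
Lemma right_ergodic_net_lin_rg f : lin_rg V f -> A i f @[i --> tails D] --> (0 : X).
Proof.
move=> Vf; have [cA rA] := netA; have [M M0 AM] := clco_equibounded.
apply/cvg_rnorm => e e0.
have [u [n [a [w [wV ->]]]] fu] := (closure_rnormP _ _).1 Vf _ (divr_gt0 (divr_gt0 e0 M0) (ltr0Sn R 1)).
set v := \sum_i _ in fu.
have /cvg_rnorm/(_ (e / 2)) Av : A i v @[i --> tails D] --> (0 : X).
  apply: (big_ind (fun v => A i v @[i --> tails D] --> (0 : X))) => [|x y Ax Ay|k _].
  - by under eq_fun do rewrite (lin_map0 (clco_linear (cA _))); exact: cvg_cst.
  - under eq_fun do rewrite (lin_mapD (clco_linear (cA _))).
    by have := cvgD Ax Ay; rewrite addr0; exact.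
  - have [h _ [g _ <-]] := wV k.
    under eq_fun do rewrite (lin_mapZ (clco_linear (cA _))) (lin_mapB (clco_linear (cA _))).
    have := cvgZ (cvg_cst (a k)) (rA h g).
    by rewrite scaler0; exact.
apply: filterS (Av _) => [i|]; last by rewrite divr_gt0.
rewrite !sub0r !rnormN => Aiv.
have -> : f = (f - v) + v by rewrite subrK.
rewrite (lin_mapD (clco_linear (cA i))); apply: le_lt_trans (rnormD _ _) _.
rewrite (splitr e) ler_ltD//; apply: le_trans (AM _ _ (cA i)) _.
by rewrite -ler_pdivlMl// mulrC mulrAC ltW.
Qed.

Lemma right_ergodic_net_fix f i : Fix V f -> A i f = f.
Proof. by move=> Vf; apply: clco_fix Vf; exact: netA.1. Qed.

End net.

Lemma projection_of_mean_ergodic P : mean_ergodic_projection V P ->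
  projection_onto_along P (Fix V) (lin_rg V).
Proof.
move=> [cP PT]; have PV g f : P (V g f) = P f.
  by have [/(congr1 (@^~ f))] := PT _ (clco_V repV g).
have VP g f : V g (P f) = P f.
  by have [_ /(congr1 (@^~ f))] := PT _ (clco_V repV g).
have PF f : Fix V (P f) by move=> g; exact: VP.
have Pfix f : Fix V f -> P f = f by exact: clco_fix.
split.
- by apply/funext => f /=; exact: Pfix.
- by apply/seteqP; split=> [_ [f _ <-]//|f Vf]; exists f => //; exact: Pfix.
- apply/seteqP; split=> f /=.
    move=> Pf; have : lin_rg V (f - P f) by exact: clco_lin_rg.
    by rewrite Pf subr0.
  move=> Vf; have [M M0 PM] := clco_equibounded.
  apply/rnorm_le0/ler_addgt0Pr => e e0; rewrite add0r.
  have [u [n [a [w [wV ->]]]] fu] := (closure_rnormP _ _).1 Vf _ (divr_gt0 e0 M0).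
  set v := \sum_i _ in fu.
  have Pv : P v = 0.
    rewrite (lin_map_sum (clco_linear cP)) big1// => k _.
    have [h _ [g _ <-]] := wV k.
    by rewrite (lin_mapZ (clco_linear cP)) (lin_mapB (clco_linear cP)) PV subrr scaler0.
  rewrite -[P f]subr0 -Pv -(lin_mapB (clco_linear cP)).
  by apply: le_trans (PM _ _ cP) _; rewrite -ler_pdivlMl// mulrC ltW.
Qed.

Lemma mean_ergodic_strong_limit P : mean_ergodic_projection V P ->
  every_net (right_ergodic_net V) (strong_limit P).
Proof.
move=> meP D A netA f; have [PP Prg Pker] := projection_of_mean_ergodic meP.
have PF : Fix V (P f) by rewrite -Prg; exists f.
have : lin_rg V (f - P f).
  rewrite -Pker /= (lin_mapB (clco_linear meP.1)).
  by rewrite -[P (P f)]/((P \o P) f) PP subrr.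
move=> /(right_ergodic_net_lin_rg netA)/cvg_rnorm Af; apply/cvg_rnorm => e e0.
apply: filterS (Af e e0) => i; rewrite (lin_mapB (clco_linear (netA.1 i))) (right_ergodic_net_fix netA _ PF).
by rewrite sub0r rnormN rnormB.
Qed.

Lemma mean_ergodic_norm_convergent : mean_ergodic V ->
  every_net (right_ergodic_net V) (norm_convergent_in (Fix V)).
Proof.
move=> [P meP] D A netA f; exists (P f); last exact: mean_ergodic_strong_limit.
by have [_ <- _] := projection_of_mean_ergodic meP; exists f.
Qed.

Lemma mean_ergodic_direct_sum : mean_ergodic V -> direct_sum (Fix V) (lin_rg V).
Proof.
move=> [P meP]; have [PP Prg Pker] := projection_of_mean_ergodic meP.
have Plin := clco_linear meP.1.
split=> [f|].
  exists (P f), (f - P f); split; last by rewrite addrC subrK.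
    by rewrite -Prg; exists f.
  by rewrite -Pker /= (lin_mapB Plin) -[P (P f)]/((P \o P) f) PP subrr.
apply/seteqP; split=> f /=; last first.
  by move=> ->; split; [rewrite -Prg; exists 0|rewrite -Pker/=]; rewrite ?(lin_map0 Plin).
by move=> [Vf]; rewrite -Pker /= => <-; rewrite (clco_fix meP.1 Vf).
Qed.

Lemma direct_sum_norm_convergent : direct_sum (Fix V) (lin_rg V) ->
  every_net (right_ergodic_net V) (norm_convergent_in (Fix V)).
Proof.
move=> [dV _] D A netA f; have [u [v [Vu Vv ->]]] := dV f; exists u => //.
have /cvg_rnorm Av := right_ergodic_net_lin_rg netA Vv.
apply/cvg_rnorm => e e0; apply: filterS (Av e e0) => i.
rewrite (lin_mapD (clco_linear (netA.1 i))) (right_ergodic_net_fix netA _ Vu).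
by rewrite opprD addrA subrr.
Qed.

(** The pointwise limit P lies in the strong closure of the hull, maps into
    Fix V and vanishes on the vectors f - T f, since these lie in the closed
    range of I - V. *)
Lemma norm_convergent_mean_ergodic (D : directed) (A : D -> X -> X) :
  right_ergodic_net V A -> norm_convergent_in (Fix V) A -> mean_ergodic V.
Proof.
move=> netA AF; have [cA rA] := netA; have [M M0 AM] := clco_equibounded.
have /choice[P PP] : forall f, exists h, Fix V h /\ A i f @[i --> tails D] --> h.
  by move=> f; have [h] := AF f; exists h.
have limP f h : A i f @[i --> tails D] --> h -> P f = h.
  exact: (cvg_unique (@norm_hausdorff _ _) (PP f).2).
have Plin : linear P.
  move=> a x y; apply: limP.
  under eq_fun do rewrite (clco_linear (cA _)).
  by apply: cvgD (PP y).2; apply: cvgZ (PP x).2; exact: cvg_cst.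
have PM f : rnorm (P f) <= M * rnorm f.
  apply/ler_addgt0Pr => e e0.
  have /cvg_rnorm/(_ e e0)/filter_ex[i Ai] := (PP f).2.
  have -> : P f = (P f - A i f) + A i f by rewrite subrK.
  rewrite [leRHS]addrC; apply: le_trans (rnormD _ _) _; apply: lerD; first exact: ltW.
  exact: AM.
have cP : clco V P.
  split; first by split; [exact: Plin|exact: (rnorm_bounded_continuous Plin PM)].
  apply/closure_ptwsP => s e e0; have e2 : 0 < e / 2 by rewrite divr_gt0.
  have /filter_ex[i Ai] : \forall i \near tails D, forall x, x \in s -> rnorm (P x - A i x) < e / 2.
    elim: s => [|x s IH]; first by apply: filterS filterT.
    have /cvg_rnorm/(_ _ e2) Ax := (PP x).2.
    apply: filterS (filterI Ax IH) => i [/= ix is'] y.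
    by rewrite inE => /orP[/eqP ->//|/is'].
  have [B coB AB] := clco_approx s (cA i) e2; exists B => // x xs.
  have -> : P x - B x = (P x - A i x) + (A i x - B x) by rewrite addrA subrK.
  by rewrite (splitr e); apply: le_lt_trans (rnormD _ _) _; rewrite ltrD ?Ai ?AB.
exists P; split=> // T cT; split; apply/funext => f /=.
  apply/esym/eqP; rewrite -subr_eq0 -(lin_mapB Plin); apply/eqP/limP.
  exact: right_ergodic_net_lin_rg (clco_lin_rg cT).
exact: clco_fix cT (PP f).1.
Qed.

(** The vectors f for which A f converges to a fixed point form a closed
    subspace W that contains Fix V and all f - V g f. A functional that
    vanishes on W is therefore V-invariant and vanishes on Fix V, hence is 0
    by separation; so W is the whole space. *)
Lemma separates_norm_convergent : sequentially_complete ->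
  separates (Fix V) (Fix_adjoint V) ->
  every_net (right_ergodic_net V) (norm_convergent_in (Fix V)).
Proof.
move=> complX sep D A netA; have [cA rA] := netA; have [M M0 AM] := clco_equibounded.
pose W : set X := [set f | exists2 h, Fix V h & A i f @[i --> tails D] --> h].
have W0 : W 0.
  exists 0; first by move=> g; rewrite (lin_map0 (repV_linear repV g)).
  by under eq_fun do rewrite (lin_map0 (clco_linear (cA _))); exact: cvg_cst.
have WL a x y : W x -> W y -> W (a *: x + y).
  move=> [h Vh Ah] [k Vk Ak]; exists (a *: h + k).
    by move=> g; rewrite repV_linear// Vh Vk.
  under eq_fun do rewrite (clco_linear (cA _)).
  by apply: cvgD Ak; apply: cvgZ Ah; exact: cvg_cst.
have WB x y : W x -> W y -> W (x - y).
  by move=> Wx Wy; rewrite -scaleN1r addrC; exact: WL.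
have Wlim x y h k : Fix V h -> A i x @[i --> tails D] --> h ->
    A i y @[i --> tails D] --> k -> rnorm (h - k) <= M * rnorm (x - y).
  move=> _ Ah Ak; apply/ler_addgt0Pr => e e0.
  have /cvg_rnorm/(_ e e0)/filter_ex[i Ai] : A i x - A i y @[i --> tails D] --> h - k.
    exact: cvgB.
  rewrite /= -(lin_mapB (clco_linear (cA i))) in Ai.
  have -> : h - k = (h - k - A i (x - y)) + A i (x - y) by rewrite subrK.
  rewrite [leRHS]addrC; apply: le_trans (rnormD _ _) _; apply: lerD; first exact: ltW.
  exact: AM.
have Wcl f : (forall e : R, 0 < e -> exists2 d, W d & rnorm (f - d) < e) -> W f.
  move=> Wf; have /choice[d dP] : forall n : nat, exists d, W d /\ rnorm (f - d) < n.+1%:R^-1.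
    by move=> n; have [|d] := Wf n.+1%:R^-1; [rewrite invr_gt0|exists d].
  have dW n : exists h, Fix V h /\ A i (d n) @[i --> tails D] --> h.
    by have [[h]] := dP n; exists h.
  have [u uP] := choice dW.
  have small (e : R) : 0 < e -> exists N, forall n, (N <= n)%N -> rnorm (f - d n) < e.
    move=> /invS_small[N NP]; exists N => n /NP; exact: lt_trans (dP n).2.
  have [|l lP] := complX u.
    move=> e e0; have [N NP] := small (e / M / 2) (divr_gt0 (divr_gt0 e0 M0) (ltr0Sn _ 1)).
    exists N => n m Nn Nm; apply: le_lt_trans (Wlim _ _ _ _ (uP n).1 (uP n).2 (uP m).2) _.
    rewrite -ltr_pdivlMl// mulrC (splitr (e / M)).
    have -> : d n - d m = (d n - f) + (f - d m) by rewrite addrA subrK.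
    by apply: le_lt_trans (rnormD _ _) _; rewrite rnormB ltrD// NP.
  have Vl : Fix V l.
    move=> g; have [C C0 VC] := repV_bound repV.
    apply/eqP; rewrite -subr_eq0; apply/eqP/rnorm_le0/ler_addgt0Pr => e e0; rewrite add0r.
    have C1 : 0 < C + 1 by rewrite addr_gt0.
    have [N /(_ N (leqnn N)) lN] := lP _ (divr_gt0 e0 C1).
    have -> : V g l - l = V g (l - u N) + (u N - l).
      by rewrite (lin_mapB (repV_linear repV g)) (uP N).1 addrA subrK.
    apply: le_trans (rnormD _ _) _; rewrite (rnormB (u N)).
    apply: (@le_trans _ _ ((C + 1) * rnorm (l - u N))); last first.
      by rewrite -ler_pdivlMl// mulrC ltW.
    by rewrite mulrDl mul1r lerD.
  exists l => //; apply/cvg_rnorm => e e0.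
  have e3 : 0 < e / 3 by rewrite divr_gt0.
  have [N1 N1P] := lP _ e3; have [N2 N2P] := small _ (divr_gt0 e3 M0).
  pose N := maxn N1 N2.
  have /cvg_rnorm/(_ _ e3) := (uP N).2; apply: filterS => i Ai.
  have -> : l - A i f = (l - u N) + (u N - A i (d N)) + A i (d N - f).
    by rewrite (lin_mapB (clco_linear (cA i))) !addrA !subrK.
  have H1 : rnorm (l - u N) < e / 3 by rewrite N1P ?leq_maxl.
  have H2 : rnorm (A i (d N - f)) <= e / 3.
    apply: le_trans (AM _ _ (cA i)) _; rewrite -ler_pdivlMl// mulrC rnormB ltW//.
    by rewrite N2P ?leq_maxr.
  apply: le_lt_trans (rnormD _ _) _; have := rnormD (l - u N) (u N - A i (d N)); lra.
move=> x; apply: contrapT => Wx.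
have [e e0 eW] : exists2 e : R, 0 < e & forall d, W d -> e <= rnorm (x - d).
  apply: contrapT => H; apply: Wx; apply: Wcl => e e0.
  apply: contrapT => H'; apply: H; exists e => // d Wd; rewrite leNgt.
  by apply/negP => xd; apply: H'; exists d.
have [|||psi /(_ ord0) psid psiC] := @dual_separation _ X 1 [set c | W (x - c ord0)] e.
- by exists (fun=> x); rewrite /= subrr.
- move=> c d s t Wc Wd s0 t0 st /=.
  have -> : x - (s%:C%C *: c + t%:C%C *: d) ord0 =
      s%:C%C *: (x - c ord0) + (t%:C%C *: (x - d ord0) + 0).
    rewrite !scalerBr addr0 addrACA -scalerDl -rmorphD st scale1r -opprD.
    by [].
  by apply: (WL) => //; exact: (WL).
- by move=> c Wc; rewrite big_ord1; have := eW _ Wc; rewrite subKr.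
have psiW d : W d -> psi ord0 d = 0.
  move=> Wd; apply/eqP/negPn/negP => psid0.
  have n0 : 0 < rnorm (psi ord0 d).
    by rewrite lt_def rnorm_ge0 andbT; apply/eqP => /rnorm_eq0/eqP; exact/negP.
  (* with z conjugate to psi d, the value of psi at x - r z d has real part 0 *)
  pose r := (complex.Re (psi ord0 x) / rnorm (psi ord0 d) ^+ 2).
  have := psiC (fun=> x - (r%:C%C * (psi ord0 d)^*%C) *: d).
  rewrite /= big_ord1 subKr (lin_mapB psid.1) (lin_mapZ psid.1).
  have -> : (r%:C%C * (psi ord0 d)^*%C) *: psi ord0 d = (complex.Re (psi ord0 x))%:C%C.
    rewrite -[LHS]mulrA conjcM_rnorm -rmorphM /r divfK// expf_neq0//.
    by rewrite gt_eqF.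
  rewrite raddfB /= subrr leNgt e0 => /(_ _)/notF; apply.
  by rewrite -[_ *: d]addr0; exact: WL.
have psiF : Fix_adjoint V (psi ord0).
  split=> // g; apply/funext => f /=; apply/esym/eqP; rewrite -subr_eq0 -(lin_mapB psid.1).
  apply/eqP/psiW; exists 0; first by move=> k; rewrite (lin_map0 (repV_linear repV k)).
  by under eq_fun do rewrite (lin_mapB (clco_linear (cA _))); exact: rA.
have F0 : Fix_adjoint V (cst 0 : X -> R[i]).
  split; last by move=> g; apply/funext.
  by split=> [a u v|]; [rewrite /cst scaler0 addr0|move=> ?; exact: cvg_cst].
have [|f Vf] := sep _ _ psiF F0.
  move=> psi0; have := psiC (fun=> x); rewrite /= subrr big_ord1 psi0 => /(_ W0).
  by rewrite /cst raddf0 leNgt e0.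
apply; rewrite psiW//; exists f => //.
under eq_fun do rewrite (clco_fix (cA _) Vf); exact: cvg_cst.
Qed.

(** An invariant functional takes the same value at f and at A i f, hence at
    the weak limit of A f, which is a fixed point. *)
Lemma weakly_convergent_separates (D : directed) (A : D -> X -> X) :
  (forall i, clco V (A i)) -> weakly_convergent_in (Fix V) A ->
  separates (Fix V) (Fix_adjoint V).
Proof.
move=> cA wA nu1 nu2 F1 F2 nu12.
have [f nuf] : exists f, nu1 f <> nu2 f.
  by apply/existsNP => H; apply: nu12; exact/funext.
have [h Vh Ah] := wA f; exists h => // nuh; apply: nuf.
have nuE nu : Fix_adjoint V nu -> nu f = nu h.
  move=> Fnu; apply: (cvg_unique (@norm_hausdorff _ _) _ (Ah nu Fnu.1)).
  rewrite (_ : (fun i => nu ((A^~ f) i)) = cst (nu f)); first exact: cvg_cst.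
  by apply/funext => i; exact: clco_adjoint Fnu (cA i).
by rewrite !nuE.
Qed.

Lemma strong_weakly_convergent (E : set X) (D : directed) (A : D -> X -> X) :
  norm_convergent_in E A -> weakly_convergent_in E A.
Proof.
by move=> nA f; have [h Eh Ah] := nA f; exists h => //; exact: strong_weak_cvg.
Qed.

Lemma ergodic_weak_limit_fix (D : directed) (A : D -> X -> X) f h :
  ergodic_net V A -> weak_cvg (tails D) (A^~ f) h -> Fix V h.
Proof.
move=> [_ lA] Ah g; apply/esym/dual_separates => phi phid.
have phiVd : dual X (phi \o V g).
  split=> [a x y /=|x]; first by rewrite (repV_linear repV) phid.1.
  by apply: continuous_comp; [exact: repV_continuous|exact: phid.2].
apply/eqP; rewrite -subr_eq0; apply/eqP.
apply: (cvg_unique (@norm_hausdorff _ _) (cvgB (Ah phi phid) (Ah _ phiVd))).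
have /(strong_weak_cvg)/(_ phi phid) := lA f g.
rewrite (lin_map0 phid.1).
by under eq_fun do rewrite (lin_mapB phid.1).
Qed.

(** With A also the composites of V g and A i form a right ergodic net, and so
    does the net that runs through both families. The latter has a single weak
    limit, which is thus the limit h of A f and equal to V g h. *)
Lemma right_weak_limit_fix : every_net (right_ergodic_net V) (weakly_convergent_in setT) ->
  every_net (right_ergodic_net V) (weakly_convergent_in (Fix V)).
Proof.
move=> wV D A netA f; have [h _ Ah] := wV D A netA f; exists h => // g.
have [cA rA] := netA.
pose le (i j : D * bool) := dle i.1 j.1.
have le_refl i : le i i by exact: dle_refl.
have le_trans i j k : le i j -> le j k -> le i k by exact: dle_trans.
have le_dir i j : exists k, le i k /\ le j k.
  by have [k [ik jk]] := dle_directed i.1 j.1; exists (k, true).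
have D2i : inhabited (D * bool) by case: (directed_inhabited D) => i; exact: (inhabits (i, true)).
pose D2 := Directed le_refl le_trans le_dir D2i.
pose B (i : D2) := if i.2 then A i.1 else V g \o A i.1.
have FD2 : Filter (tails D2) by exact: tails_filter.
have netB : right_ergodic_net V B.
  split=> [[i []]|f' g']; rewrite /B//=; first exact: clco_comp.
  have [M M0 VM] := repV_bound repV.
  have /cvg_rnorm Af := rA f' g'.
  apply/cvg_rnorm => e e0.
  have e1 : 0 < Num.min e (e / M) by rewrite lt_min e0 divr_gt0.
  have [i0 i0P] := Af _ e1; exists (i0, true) => -[i b] /= /i0P /=.
  rewrite !sub0r !rnormN lt_min => /andP[Ae AeM]; case: b => //=.
  rewrite -(lin_mapB (repV_linear repV g)); apply: le_lt_trans (VM _ _) _.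
  by rewrite mulrC -ltr_pdivlMr.
have [h' _ Bh'] := wV D2 B netB f.
have sub (b : bool) : weak_cvg (tails D) (fun i => B (i, b) f) h'.
  move=> phi phid S /(Bh' phi phid)[[i0 b0] i0P]; exists i0 => i i0i.
  exact: (i0P (i, b)).
have hE : h' = h by exact: weak_cvg_unique (sub true) Ah.
rewrite -{2}hE; apply: weak_cvg_unique (sub false) => phi phid.
apply: (Ah (phi \o V g)); split=> [a x y /=|x]; first by rewrite (repV_linear repV) phid.1.
by apply: continuous_comp; [exact: repV_continuous|exact: phid.2].
Qed.

Lemma separates_mean_ergodic : sequentially_complete -> some_net (right_ergodic_net V) (fun _ _ => True) ->
  separates (Fix V) (Fix_adjoint V) -> mean_ergodic V.
Proof.
move=> complX [D [A [netA _]]] sep; apply: (norm_convergent_mean_ergodic netA).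
exact: separates_norm_convergent.
Qed.

Lemma strong_or_weak_limit (D : directed) (A : D -> X -> X) (P : X -> X) :
  strong_limit P A \/ weak_limit P A -> weak_limit P A.
Proof. by case=> // sP f; exact: strong_weak_cvg. Qed.

Lemma mean_ergodic_limit P : mean_ergodic_projection V P ->
  forall (D : directed) (A : D -> X -> X) (Q : X -> X), right_ergodic_net V A ->
  strong_limit Q A \/ weak_limit Q A ->
  mean_ergodic_projection V Q /\ projection_onto_along Q (Fix V) (lin_rg V).
Proof.
move=> meP D A Q netA /strong_or_weak_limit wQ.
have <- : P = Q; last by split=> //; exact: projection_of_mean_ergodic.
apply/funext => f; apply: (weak_cvg_unique _ (wQ f)).
by apply: strong_weak_cvg; exact: (mean_ergodic_strong_limit meP netA).
Qed.

Lemma mean_ergodic_projection_limits P : mean_ergodic_projection V P ->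
  [/\ projection_onto_along P (Fix V) (lin_rg V),
    every_net (right_ergodic_net V) (strong_limit P) &
    every_net (right_ergodic_net V) (weak_limit P)].
Proof.
move=> meP; split; first exact: projection_of_mean_ergodic.
  exact: mean_ergodic_strong_limit.
by move=> D A netA f; apply: strong_weak_cvg; exact: (mean_ergodic_strong_limit meP netA).
Qed.

Lemma weakly_convergentW (E : set X) (D : directed) (A : D -> X -> X) :
  weakly_convergent_in E A -> weakly_convergent_in setT A.
Proof. by move=> wA f; have [h _ Ah] := wA f; exists h. Qed.

Lemma norm_convergentW (E : set X) (D : directed) (A : D -> X -> X) :
  norm_convergent_in E A -> norm_convergent_in setT A.
Proof. by move=> wA f; have [h _ Ah] := wA f; exists h. Qed.

End mean_ergodicity.

(** * Continuous functions and Markov operators *)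

Section Cb_theory.
Variables (R : realType) (T : topologicalType).
Implicit Types (u v : Cb R T).

Lemma Cb_sumE n (F : 'I_n -> Cb R T) x : (\sum_i F i) x = \sum_i F i x.
Proof. exact: (big_morph (fun f : Cb R T => f x) (id1 := 0) (op1 := +%R)). Qed.

Lemma Cb_scaleE (a : R[i]) (f : Cb R T) x : (a *: f) x = a * f x. Proof. by []. Qed.

Lemma Cb_cvg_rnorm u x (e : R) : 0 < e -> \forall y \near x, rnorm (u x - u y) < e.
Proof. by move=> e0; have /cvg_rnorm/(_ e e0) : u y @[y --> x] --> u x by exact: Cb_continuous. Qed.

Lemma rnorm_is_Cb (f : T -> R[i]) (M : R) :
  (forall x (e : R), 0 < e -> \forall y \near x, rnorm (f x - f y) < e) ->
  (forall x, rnorm (f x) <= M) -> f \in @is_Cb R T.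
Proof.
move=> cf fM; apply/is_CbP; split; last first.
  by exists M => x; rewrite -[`|_|]/(`|f x : R[i]^o|) normc_Re lecR; exact: fM.
by move=> x; apply/cvg_rnorm => e; exact: cf.
Qed.

Lemma cabs_subproof u : (fun x => (rnorm (u x))%:C%C) \in @is_Cb R T.
Proof.
apply: (@rnorm_is_Cb _ (rnorm u)) => x; last first.
  by rewrite rnormE_real ger0_norm ?rnorm_ge0// rnorm_Cb_ge.
move=> e e0; apply: filterS (Cb_cvg_rnorm u x e0) => y.
by rewrite -rmorphB rnormE_real; apply: le_lt_trans; exact: rnorm_dist.
Qed.
Definition cabs u : Cb R T := MkCb (cabs_subproof u).

Lemma cre_subproof u : (fun x => (complex.Re (u x))%:C%C) \in @is_Cb R T.
Proof.
apply: (@rnorm_is_Cb _ (rnorm u)) => x; last first.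
  by rewrite rnormE_real; apply: le_trans (Re_le_rnorm _) _; exact: rnorm_Cb_ge.
move=> e e0; apply: filterS (Cb_cvg_rnorm u x e0) => y.
rewrite -rmorphB rnormE_real; apply: le_lt_trans.
by rewrite -raddfB; exact: Re_le_rnorm.
Qed.
Definition cre u : Cb R T := MkCb (cre_subproof u).

Lemma cmul_subproof u v : (fun x => u x * v x) \in @is_Cb R T.
Proof.
apply/is_CbP; split.
  by move=> x; apply: (cvgZ (s := u) (f := v : T -> R[i])); exact: Cb_continuous.
exists (rnorm u * rnorm v) => x.
rewrite -[`|_|]/(`|u x * v x : R[i]^o|) normc_Re lecR.
rewrite -[leLHS]/(rnorm (u x * v x)) rnormM.
by apply: ler_pM; rewrite ?rnorm_ge0// rnorm_Cb_ge.
Qed.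
Definition cmul u v : Cb R T := MkCb (cmul_subproof u v).

Lemma real_cauchy_cvg (a : nat -> R) :
  (forall e : R, 0 < e -> exists N, forall n m, (N <= n)%N -> (N <= m)%N -> `|a n - a m| < e) ->
  cvgn a.
Proof.
move=> ca; apply/cauchy_cvgP/cauchy_exP => e e0; have [N NP] := ca e e0.
by exists (a N), N => // n Nn; rewrite -ball_normE /=; exact: NP.
Qed.

(** The limit is the uniform limit of the functions. *)
Lemma Cb_complete : sequentially_complete (Cb R T).
Proof.
move=> u cu.
have ux_dist n m x : rnorm (u n x - u m x) <= rnorm (u n - u m).
  exact: (rnorm_Cb_ge (u n - u m) x).
have cre_cvg x : cvgn (fun n => complex.Re (u n x)).
  apply: real_cauchy_cvg => e e0; have [N NP] := cu e e0; exists N => n m Nn Nm.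
  rewrite -raddfB; apply: le_lt_trans (Re_le_rnorm _) _.
  exact: le_lt_trans (ux_dist _ _ _) (NP _ _ Nn Nm).
have cim_cvg x : cvgn (fun n => complex.Im (u n x)).
  apply: real_cauchy_cvg => e e0; have [N NP] := cu e e0; exists N => n m Nn Nm.
  rewrite -raddfB; apply: le_lt_trans (Im_le_rnorm _) _.
  exact: le_lt_trans (ux_dist _ _ _) (NP _ _ Nn Nm).
pose L x := Complex (limn (fun n => complex.Re (u n x))) (limn (fun n => complex.Im (u n x))).
have Lx x (d : R) N : 0 < d -> exists2 n, (N <= n)%N & rnorm (L x - u n x) < d.
  move=> d0; have d2 : 0 < d / 2 by rewrite divr_gt0.
  have /cvgrPdist_lt/(_ _ d2) A1 := cre_cvg x.
  have /cvgrPdist_lt/(_ _ d2) A2 := cim_cvg x.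
  have A3 : \forall n \near \oo, (N <= n)%N by exact: nbhs_infty_ge.
  have [n [[A1n A2n] A3n]] := filter_ex (filterI (filterI A1 A2) A3).
  exists n => //; apply: le_lt_trans (rnorm_le_ReIm _) _.
  by rewrite !raddfB (splitr d) ltrD.
have Lu (e : R) : 0 < e -> exists N, forall n x, (N <= n)%N -> rnorm (L x - u n x) <= e.
  move=> e0; have [N NP] := cu e e0; exists N => n x Nn; apply/ler_addgt0Pr => d d0.
  have [m Nm Lm] := Lx x d N d0.
  have -> : L x - u n x = (L x - u m x) + (u m x - u n x) by rewrite addrA subrK.
  rewrite [leRHS]addrC; apply: le_trans (rnormD _ _) _; apply: lerD; first exact: ltW.
  exact/ltW/(le_lt_trans (ux_dist _ _ _))/NP.
have LC : L \in @is_Cb R T.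
  have [N1 N1P] := Lu 1 ltr01.
  apply: (@rnorm_is_Cb _ (1 + rnorm (u N1))) => x; last first.
    have -> : L x = (L x - u N1 x) + u N1 x by rewrite subrK.
    by apply: le_trans (rnormD _ _) _; rewrite lerD ?N1P// rnorm_Cb_ge.
  move=> e e0; have e3 : 0 < e / 4 by rewrite divr_gt0.
  have [N NP] := Lu _ e3; apply: filterS (Cb_cvg_rnorm (u N) x e3) => y uxy.
  have -> : L x - L y = (L x - u N x) + (u N x - u N y) + (u N y - L y).
    by rewrite !addrA !subrK.
  have := NP N x (leqnn N); have := NP N y (leqnn N); rewrite (rnormB (L y)).
  have := rnormD (L x - u N x + (u N x - u N y)) (u N y - L y).
  have := rnormD (L x - u N x) (u N x - u N y); lra.
exists (MkCb LC) => e e0; have e2 : 0 < e / 2 by rewrite divr_gt0.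
have [N NP] := Lu _ e2; exists N => n Nn.
apply: (@le_lt_trans _ _ (e / 2)); last by rewrite ltr_pdivrMr// ltr_pMr// ltr1n.
by apply: rnorm_Cb_le => [|x]; [exact: ltW|exact: NP].
Qed.

End Cb_theory.

Section markov_operators.
Variables (R : realType) (K : ptopologicalType) (S : Cb R K -> Cb R K).
Hypothesis markovS : Defs.markov S.
Implicit Types (u v : Cb R K).

Lemma markov_linear : linear S. Proof. by case: markovS => -[H _] _ _; exact: H. Qed.

Lemma markov_pos u : (forall x, 0 <= u x) -> forall x, 0 <= S u x.
Proof. by case: markovS => _ H _; exact: H. Qed.

Lemma markov1 : S (Cb_cst K 1) = Cb_cst K 1. Proof. by case: markovS. Qed.

Lemma markov_le u v : (forall x, u x <= v x) -> forall x, S u x <= S v x.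
Proof.
move=> uv x; rewrite -subr_ge0 -[_ - _]/((S v - S u) x) -(lin_mapB markov_linear).
by apply: markov_pos => y; rewrite -[_ y]/(v y - u y) subr_ge0.
Qed.

Lemma markov_cabs_ge0 u x : 0 <= S (cabs u) x.
Proof. by apply: markov_pos => y; rewrite /= lecR rnorm_ge0. Qed.

Lemma cre_le_cabs u x : cre u x <= cabs u x.
Proof. by rewrite /= lecR; apply: le_trans (ler_norm _) (Re_le_rnorm _). Qed.

(** Both |u| and |u| - Re u are nonnegative, hence so are their images. *)
Lemma markov_cre_real u x : complex.Im (S (cre u) x) = 0.
Proof.
have := markov_le (cre_le_cabs u) x; have := markov_cabs_ge0 u x.
rewrite !lecE /= => /andP[/eqP H1 _] /andP[/eqP H2 _].
by rewrite -H2 H1.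
Qed.

Lemma cre_decomp u : u = cre u + 'i%C *: cre (- 'i%C *: u).
Proof.
apply: CbP => x; rewrite -[RHS]/((complex.Re (u x))%:C%C + 'i%C * (complex.Re (- 'i%C * u x))%:C%C).
rewrite [LHS]complexE; congr (_ + _ * _%:C%C).
by case: (u x) => a b /=; ring.
Qed.

Lemma markov_Re u x : complex.Re (S u x) = complex.Re (S (cre u) x).
Proof.
rewrite {1}(cre_decomp u) addrC markov_linear.
set w := cre (_ *: _).
rewrite -[LHS]/(complex.Re ('i%C * S w x + S (cre u) x)) raddfD /=.
rewrite -[RHS]add0r; congr (_ + _).
have := markov_cre_real (- 'i%C *: u) x; rewrite -/w.
by case: (S w x) => a b /= ->; ring.
Qed.

(** Rotate u so that S u is real and nonnegative at x, and compare Re u with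
    |u|. *)
Lemma markov_abs u x : rnorm (S u x) <= complex.Re (S (cabs u) x).
Proof.
have [l l1 lSu] := rotation (S u x).
have lS : S (l *: u) x = (rnorm (S u x))%:C%C by rewrite (lin_mapZ markov_linear).
have -> : cabs u = cabs (l *: u).
  by apply: CbP => y /=; rewrite -[X in _ = (rnorm X)%:C%C]/(l * u y) rnormM l1 mul1r.
have -> : rnorm (S u x) = complex.Re (S (l *: u) x) by rewrite lS.
rewrite markov_Re; have := markov_le (cre_le_cabs (l *: u)) x.
by rewrite lecE => /andP[].
Qed.

Lemma markov_contractive u : rnorm (S u) <= rnorm u.
Proof.
apply: rnorm_Cb_le => [|x]; first exact: rnorm_ge0.
apply: le_trans (markov_abs u x) _.
have : S (cabs u) x <= S ((rnorm u)%:C%C *: Cb_cst K 1) x.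
  apply: markov_le => y; rewrite -[leRHS]/((rnorm u)%:C%C * 1) mulr1 lecR.
  exact: rnorm_Cb_ge.
rewrite (lin_mapZ markov_linear) markov1 -[leRHS]/((rnorm u)%:C%C * 1) mulr1.
by rewrite lecE => /andP[].
Qed.

(** With a = S |u| x this is the inequality 0 <= S ((|u| - a)^2) at x. *)
Lemma markov_sqr u x :
  complex.Re (S (cabs u) x) ^+ 2 <= complex.Re (S (cmul (cabs u) (cabs u)) x).
Proof.
pose a := complex.Re (S (cabs u) x).
have aE : S (cabs u) x = a%:C%C by exact: ge0_complexE (markov_cabs_ge0 u x).
have : 0 <= S ((- (2 * a))%:C%C *: cabs u + (cmul (cabs u) (cabs u) + (a ^+ 2)%:C%C *: Cb_cst K 1)) x.
  apply: markov_pos => y.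
  rewrite -[leRHS]/((- (2 * a))%:C%C * (rnorm (u y))%:C%C +
    ((rnorm (u y))%:C%C * (rnorm (u y))%:C%C + (a ^+ 2)%:C%C * 1)).
  rewrite mulr1 -!rmorphM -!rmorphD lecR.
  by have := sqr_ge0 (rnorm (u y) - a); rewrite expr2; lra.
rewrite markov_linear (lin_mapD markov_linear) (lin_mapZ markov_linear) markov1.
rewrite -[leRHS]/((- (2 * a))%:C%C * S (cabs u) x +
    (S (cmul (cabs u) (cabs u)) x + (a ^+ 2)%:C%C * 1)) mulr1 aE -rmorphM.
rewrite lecE => /andP[_]; rewrite !raddfD /=; rewrite -/a; lra.
Qed.

End markov_operators.

(** * Invariant functionals of a uniquely ergodic representation *)

Section unique_ergodicity.
Variables (R : realType) (K : ptopologicalType).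
Variables (G : semitopologicalSemigroupType) (S : G -> Cb R K -> Cb R K).
Hypothesis repS : markov_representation S.
Variable mu : probability (borel K) R.
Hypothesis ueS : uniquely_ergodic mu S.

Let rS : bounded_representation S. Proof. by case: repS. Qed.
Let mS g : Defs.markov (S g). Proof. by case: repS => _; exact. Qed.

Lemma integralC_adjoint : Fix_adjoint S (fun f : Cb R K => integralC mu f).
Proof. by rewrite ueS; exists 1; apply/funext => f; rewrite mul1r. Qed.

Lemma integralC_cst1 : integralC mu (Cb_cst K (1 : R[i])) = 1.
Proof.
rewrite /integralC /=; apply/eqP; rewrite eq_complex /=.
rewrite !Rintegral_cst//; set a := fine _.
have -> : a = 1 by exact: (congr1 fine (probability_setT mu)).
by rewrite mulr1 mul0r !eqxx.
Qed.

Lemma Fix_cst1 : Fix S (Cb_cst K 1). Proof. by move=> g; exact: markov1. Qed.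

Lemma Fix_separates : separates (Fix S) (Fix_adjoint S).
Proof.
move=> nu1 nu2; rewrite ueS => -[c ->] [d ->] cd.
exists (Cb_cst K 1); first exact: Fix_cst1.
rewrite integralC_cst1 !mulr1 => cdE; apply: cd; by rewrite cdE.
Qed.

Lemma evaluation_dual x : dual (Cb R K) (fun f : Cb R K => f x).
Proof.
have evL : linear (fun f : Cb R K => f x) by [].
split=> //; apply: (rnorm_bounded_continuous evL (M := 1)) => f.
by rewrite mul1r; exact: rnorm_Cb_ge.
Qed.

Hypothesis netS : exists (D : directed) (A : D -> Cb R K -> Cb R K), right_ergodic_net S A.

(** Fix S' consists of the multiples of mu, which the constant 1 separates, so
    S is mean ergodic. Each functional f |-> P f x is invariant, hence a
    multiple of mu, and P 1 = 1 determines the multiple. *)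
Lemma uniquely_mean_ergodic : exists2 P, clco S P & forall f x, P f x = integralC mu f.
Proof.
have [D [A netA]] := netS.
have [P meP] : mean_ergodic S.
  apply: (norm_convergent_mean_ergodic rS netA).
  exact: (separates_norm_convergent rS (@Cb_complete _ _) Fix_separates).
exists P; first exact: meP.1.
move=> f x; pose nu (f : Cb R K) := P f x.
have : Fix_adjoint S nu.
  split; last first.
    move=> g; apply/funext => h; rewrite /nu /=.
    by have [/(congr1 (@^~ h))/= ->] := meP.2 _ (clco_V rS g).
  split=> [a u v|u]; first by rewrite /nu (clco_linear meP.1).
  apply: (@continuous_comp _ _ _ P (fun f : Cb R K => f x)); first exact: (clco_continuous meP.1).
  exact: (evaluation_dual x).2.
rewrite ueS => -[c nuE].
have nu1 : nu (Cb_cst K 1) = 1 by rewrite /nu (clco_fix meP.1 Fix_cst1).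
have c1 : c = 1 by rewrite -nu1 nuE integralC_cst1 mulr1.
by rewrite -[LHS]/(nu f) nuE c1 mul1r.
Qed.

Variable chi : G -> R[i].
Hypothesis chiP : is_unitary_character chi.
Local Notation chiS := (twist chi S).

Lemma rnorm_chi g : rnorm (chi g) = 1.
Proof. by case: chiP => _ _ /(_ g) H; rewrite /rnorm -[`|_|]/(`|chi g|) H. Qed.

Lemma twist_markov_abs g u x : rnorm (chiS g u x) <= complex.Re (S g (cabs u) x).
Proof.
rewrite /twist -[X in rnorm X]/(chi g * S g u x) rnormM rnorm_chi mul1r.
exact: markov_abs.
Qed.

Lemma twist_contractive g u : rnorm (chiS g u) <= rnorm u.
Proof.
rewrite /twist rnormZ rnorm_chi mul1r.
exact: markov_contractive.
Qed.

Lemma twist_representation : bounded_representation chiS.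
Proof.
have linT g : linear (chiS g).
  by move=> a u v; rewrite /twist (markov_linear (mS g)) scalerDr !scalerA mulrC.
have [chic chiM chi1] := chiP; split.
- move=> g; split; first exact: linT.
  by apply: (rnorm_bounded_continuous (linT g) (M := 1)) => u; rewrite mul1r twist_contractive.
- by exists 1 => g u; rewrite mul1r !rnormE lecR; exact: twist_contractive.
- move=> g h; apply/funext => u; rewrite /twist /= (lin_mapZ (markov_linear (mS g))).
  by rewrite (repVM rS) scalerA chiM mulrC.
- move=> u g; apply: (cvgZ (s := chi) (f := fun g => S g u)); first exact: chic.
  by case: rS => _ _ _ H; exact: H.
Qed.

(** Invariance allows u to be replaced by a convex combination of the chi(g)
    S_g u. It is dominated pointwise by the same combination of the S_g |u|,
    and by [uniquely_mean_ergodic] the combination can be chosen so that this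
    bound is uniformly close to the integral of |u|. *)
Lemma adjoint_fixed_L1_bound (nu : Cb R K -> R[i]) (N : R) :
  Fix_adjoint chiS nu -> 0 < N -> (forall u, rnorm (nu u) <= N * rnorm u) ->
  forall u, rnorm (nu u) <= N * complex.Re (integralC mu (cabs u)).
Proof.
move=> Fnu N0 nuN u; have [P cP PE] := uniquely_mean_ergodic.
apply/ler_addgt0Pr => e e0.
have [B coB /(_ (cabs u))] := clco_approx [:: cabs u] cP (divr_gt0 e0 N0).
rewrite inE eqxx => /(_ isT) PB.
have [n [t [h [t0 t1 BE]]]] := (convex_combinationsP _ _).1 coB.
pose B' (f : Cb R K) := \sum_i (t i)%:C%C *: chiS (h i) f.
have coB' : convex_combinations (range chiS) B' by apply/convex_combinationsP; exists n, t, h.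
rewrite -(co_adjoint u Fnu coB'); apply: le_trans (nuN _) _.
rewrite -ler_pdivlMl// mulrDr mulKf ?gt_eqF//.
have ReS (F : 'I_n -> R[i]) : complex.Re (\sum_i F i) = \sum_i complex.Re (F i).
  exact: raddf_sum.
have key y : rnorm (B' u y) <= complex.Re (integralC mu (cabs u)) + e / N.
  apply: (@le_trans _ _ (complex.Re (B (cabs u) y))).
    rewrite /B' BE !Cb_sumE ReS; apply: le_trans (rnorm_sum _) _.
    apply: ler_sum => i _.
    rewrite !Cb_scaleE rnormM rnormE_real ger0_norm//.
    rewrite Re_realM ler_wpM2l//; exact: twist_markov_abs.
  rewrite -(PE _ y) -lerBlDl -raddfB /=.
  apply: le_trans (ler_norm _) _; apply: le_trans (Re_le_rnorm _) _.
  rewrite rnormB; apply: ltW; apply: le_lt_trans PB.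
  exact: (rnorm_Cb_ge (P (cabs u) - B (cabs u)) y).
rewrite [_ * e]mulrC; apply: rnorm_Cb_le => [|y]; last exact: key.
exact: le_trans (rnorm_ge0 _) (key point).
Qed.

End unique_ergodicity.

(** * Square integrable complex functions *)

Section complex_L2.
Variables (d : measure_display) (T : measurableType d) (R : realType).
Variable mu : probability T R.
Implicit Types (h k : T -> R[i]).

Definition cmeasurable h :=
  measurable_fun setT (fun x => complex.Re (h x) : R) /\
  measurable_fun setT (fun x => complex.Im (h x) : R).

Definition L1int h : \bar R := \int[mu]_x (rnorm (h x))%:E.
(** The square of the L^2 norm, which spares the roots in the estimates. *)
Definition L2int h : \bar R := \int[mu]_x (rnorm (h x) ^+ 2)%:E.

Lemma integral_cst_probability (c : R) : (\int[mu]_x c%:E = c%:E)%E.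
Proof.
rewrite [LHS](integral_cst mu measurableT c%:E) [X in (_ * X)%E](_ : _ = 1%E) ?mule1//.
exact: (probability_setT mu).
Qed.

Lemma cmeasurableD h k : cmeasurable h -> cmeasurable k ->
  cmeasurable (fun x => h x + k x).
Proof.
move=> [h1 h2] [k1 k2]; split.
- rewrite (_ : (fun x => _) = (fun x => complex.Re (h x) + complex.Re (k x))).
    exact: measurable_funD.
  by apply/funext => x; rewrite raddfD.
- rewrite (_ : (fun x => _) = (fun x => complex.Im (h x) + complex.Im (k x))).
    exact: measurable_funD.
  by apply/funext => x; rewrite raddfD.
Qed.

Lemma cmeasurableZ a h : cmeasurable h -> cmeasurable (fun x => a * h x).
Proof.
move=> [h1 h2]; split.
- rewrite (_ : (fun x => _) = (fun x => complex.Re a * complex.Re (h x) - complex.Im a * complex.Im (h x))).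
    by apply: measurable_funB; exact: measurable_funM.
  by apply/funext => x; case: a (h x) => a b [].
- rewrite (_ : (fun x => _) = (fun x => complex.Re a * complex.Im (h x) + complex.Im a * complex.Re (h x))).
    by apply: measurable_funD; exact: measurable_funM.
  by apply/funext => x; case: a (h x) => a b [].
Qed.

Lemma cmeasurableB h k : cmeasurable h -> cmeasurable k ->
  cmeasurable (fun x => h x - k x).
Proof.
move=> mh mk; rewrite (_ : (fun x => _) = (fun x => h x + (-1) * k x)).
  by apply: cmeasurableD => //; exact: cmeasurableZ.
by apply/funext => x; rewrite mulN1r.
Qed.

Lemma measurable_rnorm_sqr h : cmeasurable h ->
  measurable_fun setT (fun x => rnorm (h x) ^+ 2).
Proof.
move=> [h1 h2]; under eq_fun do rewrite rnormc_sqr.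
by apply: measurable_funD; exact: measurable_funX.
Qed.

Lemma measurable_rnorm h : cmeasurable h -> measurable_fun setT (fun x => rnorm (h x)).
Proof.
move=> mh; rewrite (_ : (fun x => _) = Num.sqrt \o (fun x => rnorm (h x) ^+ 2)).
  apply: measurableT_comp; last exact: measurable_rnorm_sqr.
  by apply: continuous_measurable_fun; exact: sqrt_continuous.
by apply/funext => x /=; rewrite sqrtr_sqr ger0_norm ?rnorm_ge0.
Qed.

Let mE1 h : cmeasurable h -> measurable_fun setT (fun x => (rnorm (h x))%:E).
Proof. by move=> mh; apply/measurable_EFinP; exact: measurable_rnorm. Qed.

Let mE2 h : cmeasurable h -> measurable_fun setT (fun x => (rnorm (h x) ^+ 2)%:E).
Proof. by move=> mh; apply/measurable_EFinP; exact: measurable_rnorm_sqr. Qed.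

Lemma L1int_ge0 h : (0 <= L1int h)%E.
Proof. by apply: integral_ge0 => x _; rewrite lee_fin rnorm_ge0. Qed.

Lemma L2int_ge0 h : (0 <= L2int h)%E.
Proof. by apply: integral_ge0 => x _; rewrite lee_fin sqr_ge0. Qed.

Lemma L1int_triangle h k : cmeasurable h -> cmeasurable k ->
  (L1int (fun x => (h x + k x)%R) <= L1int h + L1int k)%E.
Proof.
move=> mh mk; rewrite /L1int -ge0_integralD//; last 4 first.
- by move=> x _; rewrite lee_fin rnorm_ge0.
- exact: mE1.
- by move=> x _; rewrite lee_fin rnorm_ge0.
- exact: mE1.
apply: ge0_le_integral => //.
- by move=> x _; rewrite lee_fin rnorm_ge0.
- by apply: mE1; exact: cmeasurableD.
- by apply: emeasurable_funD; exact: mE1.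
- by move=> x _; rewrite -EFinD lee_fin rnormD.
Qed.

(** Pointwise |a + b|^2 <= (1 + t) |a|^2 + (1 + 1/t) |b|^2; small t replaces
    the triangle inequality of the L^2 norm. *)
Lemma L2int_split h k (t : R) : 0 < t -> cmeasurable h -> cmeasurable k ->
  (L2int (fun x => (h x + k x)%R) <= (1 + t)%:E * L2int h + (1 + t^-1)%:E * L2int k)%E.
Proof.
move=> t0 mh mk; have t1 : 0 <= 1 + t by rewrite addr_ge0// ltW.
have t2 : 0 <= 1 + t^-1 by rewrite addr_ge0// invr_ge0 ltW.
have i1 x : setT x -> (0 <= (rnorm (h x) ^+ 2)%:E)%E by rewrite lee_fin sqr_ge0.
have i2 x : setT x -> (0 <= (rnorm (k x) ^+ 2)%:E)%E by rewrite lee_fin sqr_ge0.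
rewrite /L2int -!ge0_integralZl_EFin//; try exact: mE2.
rewrite -ge0_integralD//; last 4 first.
- by move=> x _; rewrite -EFinM lee_fin mulr_ge0 ?sqr_ge0.
- by apply: measurable_funeM; exact: mE2.
- by move=> x _; rewrite -EFinM lee_fin mulr_ge0 ?sqr_ge0.
- by apply: measurable_funeM; exact: mE2.
apply: ge0_le_integral => //.
- by move=> x _; rewrite lee_fin sqr_ge0.
- by apply: mE2; exact: cmeasurableD.
- by apply: emeasurable_funD; apply: measurable_funeM; exact: mE2.
move=> x _; rewrite -!EFinM -EFinD lee_fin.
apply: (@le_trans _ _ ((rnorm (h x) + rnorm (k x)) ^+ 2)).
  by rewrite lerXn2r ?nnegrE ?addr_ge0 ?rnorm_ge0// rnormD.
set a := rnorm (h x); set b := rnorm (k x); rewrite -subr_ge0.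
have -> : (1 + t) * a ^+ 2 + (1 + t^-1) * b ^+ 2 - (a + b) ^+ 2 = t^-1 * (t * a - b) ^+ 2.
  by field; rewrite gt_eqF.
by rewrite mulr_ge0 ?sqr_ge0// invr_ge0 ltW.
Qed.

Lemma L2intZ a h : cmeasurable h ->
  L2int (fun x => a * h x) = ((rnorm a ^+ 2)%:E * L2int h)%E.
Proof.
move=> mh; rewrite /L2int -ge0_integralZl_EFin ?sqr_ge0//; last 2 first.
- by move=> x _; rewrite lee_fin sqr_ge0.
- exact: mE2.
by apply: eq_integral => x _; rewrite rnormM exprMn.
Qed.

(** Pointwise 2 a <= s + a^2 / s, and mu has mass 1. *)
Lemma L1int_le_L2int h (s : R) : 0 < s -> cmeasurable h ->
  (L1int h <= (s / 2)%:E + ((2 * s)^-1)%:E * L2int h)%E.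
Proof.
move=> s0 mh; have s2 : 0 <= (2 * s)^-1 by rewrite invr_ge0 mulr_ge0// ltW.
rewrite -[(s / 2)%:E]integral_cst_probability.
rewrite /L2int -ge0_integralZl_EFin//; last 2 first.
- by move=> x _; rewrite lee_fin sqr_ge0.
- exact: mE2.
have s20 : 0 <= s / 2 by rewrite divr_ge0// ltW.
rewrite -ge0_integralD//; last 2 first.
- by move=> x _; rewrite -EFinM lee_fin mulr_ge0 ?sqr_ge0.
- by apply: measurable_funeM; exact: mE2.
apply: ge0_le_integral => //.
- by move=> x _; rewrite lee_fin rnorm_ge0.
- exact: mE1.
- by apply: emeasurable_funD => //; apply: measurable_funeM; exact: mE2.
move=> x _ /=; rewrite -EFinM -EFinD lee_fin -subr_ge0.
set a := rnorm (h x).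
have -> : s / 2 + (2 * s)^-1 * a ^+ 2 - a = (2 * s)^-1 * (a - s) ^+ 2.
  by field; rewrite gt_eqF.
by rewrite mulr_ge0 ?sqr_ge0.
Qed.

Lemma L1int_eq0 h : cmeasurable h -> L1int h = 0%E -> {ae mu, forall x, h x = 0}.
Proof.
move=> mh h0.
have [H _] := ae_eq_integral_abs mu measurableT (mE1 mh).
have /H : (\int[mu]_x `|(rnorm (h x))%:E| = 0)%E.
  by rewrite -[RHS]h0; apply: eq_integral => x _; rewrite gee0_abs// lee_fin rnorm_ge0.
by apply: filterS => x /(_ I)[/rnorm_eq0].
Qed.

Lemma L2int_eq h k : cmeasurable h -> cmeasurable k ->
  {ae mu, forall x, h x = k x} -> L2int h = L2int k.
Proof.
move=> mh mk hk; apply: ge0_ae_eq_integral => //; try exact: mE2.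
- by move=> x _; rewrite lee_fin sqr_ge0.
- by move=> x _; rewrite lee_fin sqr_ge0.
- by apply: filterS hk => x ->.
Qed.

Lemma L2int_small_L1 h : cmeasurable h -> (forall e : R, 0 < e -> (L2int h <= e%:E)%E) ->
  L1int h = 0%E.
Proof.
move=> mh H; apply/eqP; rewrite eq_le L1int_ge0 andbT; apply/lee_addgt0Pr => e e0.
have e2 : 0 < e ^+ 2 by rewrite exprn_gt0.
have := L1int_le_L2int e0 mh; move/le_trans; apply; rewrite add0e.
apply: (@le_trans _ _ ((e / 2)%:E + ((2 * e)^-1)%:E * (e ^+ 2)%:E)%E).
  rewrite leeD2l// lee_wpmul2l//; last exact: H.
  by rewrite lee_fin invr_ge0 mulr_ge0// ltW.
rewrite -EFinM -EFinD lee_fin.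
have -> : e / 2 + (2 * e)^-1 * e ^+ 2 = e by field; rewrite gt_eqF.
exact: lexx.
Qed.

Lemma L1int_le_of_L2int h (s : R) : 0 < s -> cmeasurable h -> (L2int h <= (s ^+ 2)%:E)%E -> (L1int h <= s%:E)%E.
Proof.
move=> s0 mh hs; apply: le_trans (L1int_le_L2int s0 mh) _.
apply: (@le_trans _ _ ((s / 2)%:E + ((2 * s)^-1)%:E * (s ^+ 2)%:E)%E).
  by rewrite leeD2l// lee_wpmul2l// lee_fin invr_ge0 mulr_ge0// ltW.
rewrite -EFinM -EFinD lee_fin le_eqVlt; apply/orP; left; apply/eqP.
by field; rewrite gt_eqF.
Qed.

End complex_L2.

Lemma geometric_small (R : realType) (c q e : R) : 0 <= q < 1 -> 0 < e ->
  exists N, forall n, (N <= n)%N -> c * q ^+ n < e.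
Proof.
move=> /andP[q0 q1] e0; have : c * q ^+ n @[n --> \oo] --> c * 0.
  by apply: cvgM; [exact: cvg_cst|apply: cvg_expr; rewrite ger0_norm].
rewrite mulr0 => /cvgrPdist_lt/(_ e e0)[N _ NP]; exists N => n /NP.
by rewrite /= sub0r normrN; apply: le_lt_trans; exact: ler_norm.
Qed.

Section riesz_fischer.
Variables (d : measure_display) (T : measurableType d) (R : realType).
Variable mu : probability T R.
Variable u : nat -> T -> R[i].
Hypothesis mu_ : forall n, cmeasurable (u n).
Hypothesis u_fast : forall n,
  (L2int mu (fun x => (u n.+1 x - u n x)%R) <= (4^-1 ^+ n)%:E)%E.

Let du n x := rnorm (u n.+1 x - u n x).

Let mdu n : measurable_fun setT (fun x => (du n x)%:E).
Proof. by apply/measurable_EFinP/measurable_rnorm/cmeasurableB. Qed.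

Let g x : \bar R := (\sum_(n <oo) (du n x)%:E)%E.

Let mg : measurable_fun setT g.
Proof. by apply: ge0_emeasurable_sum => // n x _ _; rewrite lee_fin rnorm_ge0. Qed.

Let int_g : (\int[mu]_x g x <= 2%:E)%E.
Proof.
rewrite /g integral_nneseries//; last by move=> n x _; rewrite lee_fin rnorm_ge0.
apply: le_trans (epsilon_trick0 (fun=> true) _) => //.
apply: lee_nneseries => n _; first by move=> _; apply: integral_ge0 => x _; rewrite lee_fin rnorm_ge0.
have s0 : 0 < (2^-1 ^+ n : R) by rewrite exprn_gt0.
apply: le_trans (L1int_le_L2int mu s0 (cmeasurableB (mu_ n.+1) (mu_ n))) _.
apply: (@le_trans _ _ ((2^-1 ^+ n / 2)%:E + ((2 * 2^-1 ^+ n)^-1)%:E * (4^-1 ^+ n)%:E)%E).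
  rewrite leeD2l// lee_wpmul2l// lee_fin invr_ge0 mulr_ge0// ltW//.
rewrite -EFinM -EFinD lee_fin natrX exprS.
have -> : (4^-1 ^+ n : R) = 2^-1 ^+ n * 2^-1 ^+ n.
  by rewrite -exprMn; congr (_ ^+ _); field.
rewrite exprVn; set p : R := 2 ^+ n.
have p0 : p != 0 by rewrite expf_neq0.
rewrite le_eqVlt; apply/orP; left; apply/eqP.
by field; rewrite p0.
Qed.

Let E := [set x | g x \is a fin_num].

Let mE : measurable E.
Proof. by rewrite -[E]setTI; exact: emeasurable_fin_num. Qed.

Let ae_E : {ae mu, forall x, E x}.
Proof.
have ig : mu.-integrable setT g.
  apply/integrableP; split => //.
  apply: (@le_lt_trans _ _ (\int[mu]_x g x)%E); last first.
    by apply: le_lt_trans int_g _; rewrite ltry.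
  rewrite le_eqVlt; apply/orP; left; apply/eqP; apply: eq_integral => x _.
  by rewrite gee0_abs// nneseries_ge0// => n _ _; rewrite lee_fin rnorm_ge0.
by apply: filterS (integrable_ae measurableT ig) => x /(_ I).
Qed.

Let cvg_part (p : R[i] -> R) x : (forall a b, p (a - b) = p a - p b) ->
  (forall z, `|p z| <= rnorm z) -> E x -> cvgn (fun n => p (u n x)).
Proof.
move=> pB pn Ex; pose a n := p (u n x).
have -> : (fun n => p (u n x)) = (fun n => a 0%N + series (telescope a) n).
  by apply/funext => n; rewrite -eq_sum_telescope.
apply: is_cvgD; first exact: is_cvg_cst.
apply: normed_cvg.
apply: (@series_le_cvg _ _ (fun n => du n x)) => [n|n|n|].
- exact: normr_ge0.
- exact: rnorm_ge0.
- by have := pn (u n.+1 x - u n x); rewrite pB; exact.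
apply: nondecreasing_is_cvgn.
  by apply: nondecreasing_series => n _ _; exact: rnorm_ge0.
exists (fine (g x)) => _ [n _ <-]; rewrite -lee_fin fineK// /series/= -sumEFin.
by apply: nneseries_lim_ge => k _ _; rewrite lee_fin rnorm_ge0.
Qed.

(* set to 0 off the convergence set E, so that the limit is measurable *)
Let v n x := if x \in E then u n x else 0.

Let h x := Complex (limn (fun n => complex.Re (v n x))) (limn (fun n => complex.Im (v n x))).

Let cvg_v_part (p : R[i] -> R) x : (forall a b, p (a - b) = p a - p b) ->
  (forall z, `|p z| <= rnorm z) -> cvgn (fun n => p (v n x)).
Proof.
move=> pB pn; rewrite /v; case: (boolP (x \in E)) => [/set_mem Ex|_].
  exact: cvg_part.
exact: is_cvg_cst.
Qed.

Let cvg_vRe x : (fun n => complex.Re (v n x)) @ \oo --> complex.Re (h x).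
Proof. by apply: cvg_v_part => [a b|z]; [rewrite raddfB|exact: Re_le_rnorm]. Qed.

Let cvg_vIm x : (fun n => complex.Im (v n x)) @ \oo --> complex.Im (h x).
Proof. by apply: cvg_v_part => [a b|z]; [rewrite raddfB|exact: Im_le_rnorm]. Qed.

Let mv n : cmeasurable (v n).
Proof.
have [m1 m2] := mu_ n; split.
- rewrite (_ : (fun x => _) = (fun x => if x \in E then complex.Re (u n x) else 0)).
    apply: measurable_fun_if => //.
    + by apply: (@measurable_fun_bool _ _ _ _ true); rewrite setTI preimage_mem_true.
    + exact: measurable_funTS.
  by apply/funext => x; rewrite /v; case: ifP.
- rewrite (_ : (fun x => _) = (fun x => if x \in E then complex.Im (u n x) else 0)).
    apply: measurable_fun_if => //.
    + by apply: (@measurable_fun_bool _ _ _ _ true); rewrite setTI preimage_mem_true.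
    + exact: measurable_funTS.
  by apply/funext => x; rewrite /v; case: ifP.
Qed.

Let mh : cmeasurable h.
Proof.
split.
- by apply: (measurable_fun_cvg (fun n => (mv n).1)) => x _; exact: cvg_vRe.
- by apply: (measurable_fun_cvg (fun n => (mv n).2)) => x _; exact: cvg_vIm.
Qed.

Let tail_dist k n : (L2int mu (fun x => (u (n + k)%N x - u n x)%R) <= (4 * 4^-1 ^+ n)%:E)%E.
Proof.
elim: k n => [|k IH] n.
  rewrite addn0 (_ : (fun x => _) = fun x => 0 * u n x); last first.
    by apply/funext => x; rewrite subrr mul0r.
  by rewrite (L2intZ mu 0 (mu_ n)) rnorm0 expr0n /= mul0e lee_fin mulr_ge0// exprn_ge0.
rewrite (_ : (fun x => _) = fun x => (u (n.+1 + k)%N x - u n.+1 x) + (u n.+1 x - u n x)).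
  apply: le_trans (L2int_split mu ltr01 (cmeasurableB (mu_ _) (mu_ _)) (cmeasurableB (mu_ _) (mu_ _))) _.
  apply: (@le_trans _ _ ((1 + 1)%:E * (4 * 4^-1 ^+ n.+1)%:E + (1 + 1^-1)%:E * (4^-1 ^+ n)%:E)%E).
    apply: leeD.
      by apply: lee_wpmul2l; [rewrite lee_fin addr_ge0|exact: IH].
    by apply: lee_wpmul2l; [rewrite lee_fin invr1 addr_ge0|exact: u_fast].
  rewrite -!EFinM -EFinD lee_fin invr1 exprS; set p := 4^-1 ^+ n; lra.
by apply/funext => x; rewrite addrA subrK addSnnS.
Qed.

(** The sum of the |u (n+1) - u n| is integrable because the L^1 norms are at
    most 2^-n, so u converges almost everywhere; Fatou's lemma then bounds the
    L^2 distance to the limit. *)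
Lemma riesz_fischer : exists h, cmeasurable h /\
  forall n, (L2int mu (fun x => (h x - u n x)%R) <= (4 * 4^-1 ^+ n)%:E)%E.
Proof.
exists h; split=> [|n]; first exact: mh.
pose f m x := (rnorm (v m x - u n x) ^+ 2)%:E.
have mf m : measurable_fun setT (f m).
  by apply/measurable_EFinP/measurable_rnorm_sqr/cmeasurableB.
have f0 m x : setT x -> (0 <= f m x)%E by rewrite lee_fin sqr_ge0.
have := fatou mu measurableT mf f0.
have -> : (\int[mu]_x limn_einf (f^~ x) = L2int mu (fun x => (h x - u n x)%R))%E.
  apply: eq_integral => x _; apply: (cvg_limn_einf_sup _).1.
  apply: cvg_EFin; first by apply: nearW.
  rewrite (_ : fine \o _ = (fun m => (complex.Re (v m x) - complex.Re (u n x)) ^+ 2 +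
      (complex.Im (v m x) - complex.Im (u n x)) ^+ 2)); last first.
    by apply/funext => m; rewrite /= rnormc_sqr !raddfB.
  rewrite rnormc_sqr !raddfB; apply: cvgD.
    by rewrite expr2; apply: cvgM; apply: cvgB; (exact: cvg_vRe || exact: cvg_cst).
  by rewrite expr2; apply: cvgM; apply: cvgB; (exact: cvg_vIm || exact: cvg_cst).
move/le_trans; apply; rewrite limn_einf_lim.
apply: lime_le; first exact: is_cvg_einfs.
apply: nearW => m; apply: le_trans (tail_dist m n).
apply: ereal_inf_lbound; exists (n + m)%N => /=; first by rewrite leq_addl.
apply: L2int_eq; [exact: cmeasurableB|exact: cmeasurableB|].
by apply: filterS ae_E => x Ex; rewrite /v mem_set.
Qed.

End riesz_fischer.

Section L2_continuity.
Variables (d : measure_display) (T : measurableType d) (R : realType).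
Variable mu : probability T R.
Local Notation Q h := (L2int mu h).

Lemma L2int_sub_sym (h k : T -> R[i]) : Q (fun x => h x - k x) = Q (fun x => k x - h x).
Proof. by apply: eq_integral => x _; rewrite rnormB. Qed.

Lemma L2int_chain (h k l : T -> R[i]) (a b : R) : cmeasurable h -> cmeasurable k -> cmeasurable l ->
  (Q (fun x => (h x - k x)%R) <= a%:E)%E -> (Q (fun x => (k x - l x)%R) <= b%:E)%E ->
  (Q (fun x => (h x - l x)%R) <= (2 * a + 2 * b)%:E)%E.
Proof.
move=> mh mk ml ha kb.
rewrite [X in L2int _ X](_ : _ = fun x => (h x - k x) + (k x - l x)); last first.
  by apply/funext => x; rewrite addrA subrK.
apply: le_trans (L2int_split mu ltr01 (cmeasurableB mh mk) (cmeasurableB mk ml)) _.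
apply: (@le_trans _ _ ((1 + 1)%:E * a%:E + (1 + 1^-1)%:E * b%:E)%E).
  by apply: leeD; apply: lee_wpmul2l => //; rewrite lee_fin ?invr1 addr_ge0.
by rewrite -!EFinM -EFinD lee_fin invr1; lra.
Qed.

(** Continuity of the squared norm, uniform over the ball of squared radius q.
    *)
Lemma L2int_upper_cont (q e : R) : 0 <= q -> 0 < e -> exists2 eta : R, 0 < eta &
  forall h k : T -> R[i], cmeasurable h -> cmeasurable k ->
    (Q h <= q%:E)%E -> (Q (fun x => (k x - h x)%R) <= eta%:E)%E -> (Q k <= (q + e)%:E)%E.
Proof.
move=> q0 e0; have q1 : 0 < q + 1 by rewrite ltr_wpDl.
pose t := e / 2 / (q + 1).
have t0 : 0 < t by rewrite !divr_gt0.
have t1 : 0 < 1 + t^-1 by rewrite addr_gt0// invr_gt0.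
exists (e / 2 / (1 + t^-1)); first by rewrite !divr_gt0.
move=> h k mh mk hq kh.
rewrite [X in L2int _ X](_ : _ = fun x => h x + (k x - h x)); last first.
  by apply/funext => x; rewrite addrC subrK.
apply: le_trans (L2int_split mu t0 mh (cmeasurableB mk mh)) _.
apply: (@le_trans _ _ ((1 + t)%:E * q%:E + (1 + t^-1)%:E * (e / 2 / (1 + t^-1))%:E)%E).
  by apply: leeD; apply: lee_wpmul2l => //; rewrite lee_fin addr_ge0// ?invr_ge0 ltW.
rewrite -!EFinM -EFinD lee_fin.
have -> : (1 + t^-1) * (e / 2 / (1 + t^-1)) = e / 2 by rewrite mulrC divfK// gt_eqF.
have : t * q <= e / 2.
  rewrite /t mulrAC ler_pdivrMr//; apply: ler_wpM2l; first by rewrite divr_ge0// ltW.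
  by rewrite lerDl.
lra.
Qed.

End L2_continuity.

(** * Density of the continuous functions *)

Section continuous_L2.
Variables (R : realType) (K : ptopologicalType).
Variable mu : probability (borel K) R.
Implicit Types (u v : Cb R K) (h k : K -> R[i]).
Local Notation L1 h := (@L1int _ (borel K) R mu h).
Local Notation Q h := (@L2int _ (borel K) R mu h).

Lemma continuous_borel_measurable (f : K -> R) : continuous f ->
  measurable_fun setT (f : borel K -> R).
Proof.
move=> cf; apply: (measurability _ (RGenOInfty.measurableE R)) => _ [_ [a ->] <-].
by rewrite setTI; apply: sub_sigma_algebra; apply: open_comp => // x _; exact: cf.
Qed.

Lemma Re_continuous u : continuous (fun x => complex.Re (u x)).
Proof.
move=> x; apply/cvgrPdist_lt => e e0; apply: filterS (Cb_cvg_rnorm u x e0) => y.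
by rewrite -raddfB; apply: le_lt_trans; exact: Re_le_rnorm.
Qed.

Lemma Im_continuous u : continuous (fun x => complex.Im (u x)).
Proof.
move=> x; apply/cvgrPdist_lt => e e0; apply: filterS (Cb_cvg_rnorm u x e0) => y.
by rewrite -raddfB; apply: le_lt_trans; exact: Im_le_rnorm.
Qed.

Lemma Cb_cmeasurable u : @cmeasurable _ (borel K) R u.
Proof.
split; apply: continuous_borel_measurable; [exact: Re_continuous|exact: Im_continuous].
Qed.

Lemma mu_setT : mu [set: borel K] = 1%E. Proof. exact: probability_setT. Qed.

Lemma Cb_Re_integrable u : mu.-integrable setT (fun x => (complex.Re (u x))%:E).
Proof.
apply: measurable_bounded_integrable => //.
- by rewrite [X in (X < _)%E](_ : _ = 1%E) ?ltry//; exact: mu_setT.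
- exact: (Cb_cmeasurable u).1.
exists (rnorm u); split; first exact: num_real.
move=> M uM x _ /=; apply: le_trans (Re_le_rnorm _) _.
by apply: le_trans (rnorm_Cb_ge _ _) _; exact: ltW.
Qed.

Lemma Re_integralC u :
  ((complex.Re (integralC mu u))%:E = \int[mu]_x (complex.Re (u x))%:E)%E.
Proof. by rewrite /integralC /= /Rintegral fineK// integrable_fin_num// Cb_Re_integrable. Qed.

Lemma integralC_cabs u : ((complex.Re (integralC mu (cabs u)))%:E = L1 u)%E.
Proof. exact: Re_integralC. Qed.

Lemma Re_cmul_cabs u x : complex.Re (cmul (cabs u) (cabs u) x) = rnorm (u x) ^+ 2.
Proof. by rewrite /= mulr0 subr0 expr2. Qed.

Lemma integralC_sqr u : ((complex.Re (integralC mu (cmul (cabs u) (cabs u))))%:E = Q u)%E.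
Proof. by rewrite Re_integralC; apply: eq_integral => x _; rewrite Re_cmul_cabs. Qed.

Lemma Cb_L2int_fin u : (Q u < +oo)%E.
Proof. by rewrite -integralC_sqr ltry. Qed.

(** Combine |S u|^2 <= (S |u|)^2 <= S (|u|^2) with the invariance of the
    integral. *)
Lemma markov_L2_contractive (S : Cb R K -> Cb R K) : Defs.markov S ->
  (forall f : Cb R K, integralC mu (S f) = integralC mu f) ->
  forall u, (Q (S u) <= Q u)%E.
Proof.
move=> mS iS u; rewrite -[leRHS]integralC_sqr -iS Re_integralC.
apply: ge0_le_integral => //.
- by move=> x _; rewrite lee_fin sqr_ge0.
- apply/measurable_EFinP; exact: (measurable_rnorm_sqr (Cb_cmeasurable (S u))).
- apply/measurable_EFinP; exact: (Cb_cmeasurable (S (cmul (cabs u) (cabs u)))).1.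
move=> x _; rewrite lee_fin; apply: le_trans (markov_sqr mS u x).
rewrite lerXn2r ?nnegrE ?rnorm_ge0 ?markov_abs//.
exact: le_trans (rnorm_ge0 _) (markov_abs mS u x).
Qed.

Lemma L2norm_sqr h : (L2norm mu h `^ 2 = Q h)%E.
Proof.
rewrite /L2norm poweR_Lnorm//; apply: eq_integral => x _.
by rewrite gee0_abs ?lee_fin ?(rnorm_ge0 (h x : R[i]))// poweR_EFin powR_mulrn ?(rnorm_ge0 (h x : R[i])).
Qed.

Lemma L2E h : L2 mu h <-> @cmeasurable _ (borel K) R h /\ (Q h < +oo)%E.
Proof.
split=> [[h1 h2 h3]|[[h1 h2] h3]]; split => //.
  by rewrite -L2norm_sqr poweR_lty.
by apply: (@lty_poweRy _ _ 2) => //; rewrite L2norm_sqr.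
Qed.

Lemma L2norm_le h k (M : R) : 0 <= M -> (L2norm mu h <= M%:E * L2norm mu k)%E ->
  (Q h <= (M ^+ 2)%:E * Q k)%E.
Proof.
move=> M0 hk; rewrite -!L2norm_sqr.
have -> : ((M ^+ 2)%:E = M%:E `^ 2)%E by rewrite poweR_EFin powR_mulrn.
rewrite -poweRM ?lee_fin// ?Lnorm_ge0//.
apply: gt0_ler_poweR => //; rewrite in_itv /= leey andbT ?Lnorm_ge0//.
by rewrite mule_ge0 ?lee_fin// Lnorm_ge0.
Qed.

Lemma le_L2norm h k : (Q h <= Q k)%E -> (L2norm mu h <= L2norm mu k)%E.
Proof.
move=> hk; have H f : L2norm mu f = (Q f `^ 2^-1)%E.
  by rewrite -L2norm_sqr -poweRrM mulfV// poweRe1// Lnorm_ge0.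
rewrite !H; apply: gt0_ler_poweR => //; rewrite in_itv /= leey andbT.
  exact: L2int_ge0.
exact: L2int_ge0.
Qed.

End continuous_L2.

Section density.
Import HBNNSimple.
Variables (R : realType) (K : ptopologicalType).
Hypotheses (compK : compact [set: K]) (hausK : hausdorff_space K).
Variable mu : probability (borel K) R.
Hypothesis regmu : regular_measure mu.
Implicit Types (u v : Cb R K) (h k : K -> R[i]).
Local Notation Q h := (@L2int _ (borel K) R mu h).
Local Notation cmeas h := (@cmeasurable _ (borel K) R h).

Definition Cb_approximable h :=
  forall e : R, 0 < e -> exists u : Cb R K, (Q (fun x => (h x - u x)%R) <= e%:E)%E.

Let cmB h u : cmeas h -> cmeas (fun x => h x - u x).
Proof. by move=> mh; apply: cmeasurableB => //; exact: Cb_cmeasurable. Qed.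

Lemma approximable_comb a h k : cmeas h -> cmeas k ->
  Cb_approximable h -> Cb_approximable k -> Cb_approximable (fun x => a * h x + k x).
Proof.
move=> mh mk ah ak e e0; pose b := rnorm a ^+ 2.
have b0 : 0 <= b by rewrite sqr_ge0.
have b1 : 0 < b + 1 by rewrite ltr_wpDl.
have e1 : 0 < e / 4 / (b + 1) by rewrite !divr_gt0.
have e2 : 0 < e / 4 by rewrite divr_gt0.
have [u hu] := ah _ e1; have [v kv] := ak _ e2.
exists (a *: u + v).
rewrite [X in L2int _ X](_ : _ = fun x => a * (h x - u x) + (k x - v x)); last first.
  apply/funext => x; rewrite -[(a *: u + v) x]/(a * u x + v x).
  by rewrite mulrBr opprD addrACA.
apply: le_trans (L2int_split mu ltr01 (cmeasurableZ a (cmB u mh)) (cmB v mk)) _.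
rewrite (L2intZ mu a (cmB u mh)) -/b.
apply: (@le_trans _ _ ((1 + 1)%:E * (b%:E * (e / 4 / (b + 1))%:E) + (1 + 1^-1)%:E * (e / 4)%:E)%E).
  apply: leeD; apply: lee_wpmul2l => //; rewrite ?lee_fin ?invr1 ?addr_ge0//.
  by apply: lee_wpmul2l => //; rewrite lee_fin.
rewrite -!EFinM -EFinD lee_fin invr1.
have : b * (e / 4 / (b + 1)) <= e / 4.
  by rewrite mulrCA ger_pMr// ler_pdivrMr// mul1r lerDl.
lra.
Qed.

Lemma approximable_lim h : cmeas h ->
  (forall e : R, 0 < e -> exists k, [/\ cmeas k, Cb_approximable k &
    (Q (fun x => (h x - k x)%R) <= e%:E)%E]) -> Cb_approximable h.
Proof.
move=> mh H e e0; have e2 : 0 < e / 4 by rewrite divr_gt0.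
have [k [mk ak hk]] := H _ e2; have [u ku] := ak _ e2; exists u.
rewrite [X in L2int _ X](_ : _ = fun x => (h x - k x) + (k x - u x)); last first.
  by apply/funext => x; rewrite addrA subrK.
apply: le_trans (L2int_split mu ltr01 (cmeasurableB mh mk) (cmB u mk)) _.
apply: (@le_trans _ _ ((1 + 1)%:E * (e / 4)%:E + (1 + 1^-1)%:E * (e / 4)%:E)%E).
  by apply: leeD; apply: lee_wpmul2l => //; rewrite lee_fin ?invr1 addr_ge0.
by rewrite -!EFinM -EFinD lee_fin invr1; lra.
Qed.

Lemma cmeas_real (r : K -> R) : measurable_fun setT (r : borel K -> R) ->
  cmeas (fun x => (r x)%:C%C).
Proof. by move=> mr; split => //=; exact: measurable_cst. Qed.

Lemma open_borel (U : set K) : open U -> measurable (U : set (borel K)).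
Proof. by move=> oU; exact: sub_sigma_algebra. Qed.

Lemma closed_borel (F : set K) : closed F -> measurable (F : set (borel K)).
Proof. by move=> cF; rewrite -[F]setCK; apply: measurableC; apply: open_borel; exact: closed_openC. Qed.

Lemma real_Cb (r : K -> R) : continuous r -> exists u : Cb R K, forall x, u x = (r x)%:C%C.
Proof.
move=> cr; suff rC : (fun x => (r x)%:C%C) \in @is_Cb R K by exists (MkCb rC).
apply: compact_is_Cb => // x; apply/cvg_rnorm => e e0.
have /cvgrPdist_lt/(_ e e0) := cr x.
by apply: filterS => y; rewrite -rmorphB rnormE_real.
Qed.

(** By regularity A lies between a compact F and an open U with mu (U \ F)
    small, and a Urysohn function for F and the complement of U differs from
    the indicator of A only on U \ F. *)
Lemma approximable_indic (A : set (borel K)) : measurable A ->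
  Cb_approximable (fun x => (\1_A x)%:C%C).
Proof.
move=> mA e e0; have e2 : 0 < e / 2 by rewrite divr_gt0.
have [muU muF] := regmu mA.
have Afin : mu A \is a fin_num by exact: fin_num_measure.
have [_ [U [oU AU] <-] Ue] : exists2 x, [set mu U | U in [set U | @open K U /\ A `<=` U]] x &
    (x < mu A + (e / 2)%:E)%E.
  by rewrite muU; apply: lb_ereal_inf_adherent => //; rewrite -muU.
have [_ [F [cF FA] <-] Fe] : exists2 x, [set mu F | F in [set F | @compact K F /\ F `<=` A]] x &
    (mu A - (e / 2)%:E < x)%E.
  by rewrite muF; apply: ub_ereal_sup_adherent => //; rewrite -muF.
have clF : @closed K F by exact: compact_closed.
have mU := open_borel oU; have mF := closed_borel clF.
have FU : F `<=` U by exact: subset_trans AU.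
have UFe : (mu (U `\` F) <= e%:E)%E.
  rewrite measureD//; last by rewrite -ge0_fin_numE// fin_num_measure.
  rewrite (setIidr FU) leeBlDr; last exact: fin_num_measure.
  apply: le_trans (ltW Ue) _.
  have := ltW Fe; rewrite leeBlDr// => AF.
  rewrite (le_trans (leeD AF (lexx _)))// -addeA -EFinD -splitr addeC.
  exact: lexx.
have nK : normal_space K.
  exact: compact_normal.
have /uniform_separatorP : uniform_separator (~` U : set K) F.
  apply: ((@normal_separatorP R K).1 nK) => //; first exact: open_closedC.
  by apply/disjoints_subset => x Ux /FU.
move=> /(_ R)[r [cr r01 r0 r1]].
have [u uE] := real_Cb cr; exists u.
apply: le_trans UFe.
have -> : (mu (U `\` F) = \int[mu]_x (\1_(U `\` F) x)%:E)%E.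
  by rewrite integral_indic// ?setIT//; exact: measurableD.
apply: ge0_le_integral => //.
- by move=> x _; rewrite lee_fin sqr_ge0.
- apply/measurable_EFinP/measurable_rnorm_sqr/cmB; apply: cmeas_real.
  exact: measurable_indic.
- by apply/measurable_EFinP/measurable_indic/measurableD.
move=> x _; rewrite lee_fin uE -rmorphB rnormE_real real_normK ?num_real//.
have := r01 (r x); rewrite /= in_itv /= => /(_ (ex_intro2 _ _ x I erefl))/andP[rx0 rx1].
have [Fx|Fx] := pselect (F x).
  have -> : r x = 1 by apply: r1; exists x.
  by rewrite [X in X - _]indicE (mem_set (FA _ Fx)) subrr expr0n /= indicE ler0n.
have [Ux|Ux] := pselect (U x).
  rewrite [leRHS]indicE mem_set//; rewrite indicE; case: (x \in A) => /=.
    by rewrite exprn_ile1 ?subr_ge0// gerBl.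
  by rewrite sub0r sqrrN exprn_ile1.
have -> : r x = 0 by apply: r0; exists x.
rewrite indicE memNset; last by move=> /AU.
by rewrite subrr expr0n /= ler0n.
Qed.

Lemma approximable_simple m (c : 'I_m -> R[i]) (A : 'I_m -> set (borel K)) :
  (forall i, measurable (A i)) ->
  let k x := \sum_i c i * (\1_(A i) x)%:C%C in cmeas k /\ Cb_approximable k.
Proof.
elim: m c A => [|m IH] c A mA /=.
  have -> : (fun x => \sum_(i < 0) c i * (\1_(A i) x)%:C%C) = (fun x => (0 : Cb R K) x).
    by apply/funext => x; rewrite big_ord0.
  split; first exact: Cb_cmeasurable.
  move=> e e0; exists 0; rewrite [X in L2int _ X](_ : _ = fun x => 0 * (0 : Cb R K) x).
    by rewrite (L2intZ mu 0 (Cb_cmeasurable 0)) rnorm0 expr0n /= mul0e lee_fin ltW.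
  by apply/funext => x; rewrite subrr mul0r.
have [mk ak] := IH (fun i => c (lift ord0 i)) (fun i => A (lift ord0 i)) (fun i => mA _).
have m1 : cmeas (fun x => (\1_(A ord0) x)%:C%C) by apply: cmeas_real; exact: measurable_indic.
under eq_fun do rewrite big_ord_recl.
split; first by apply: cmeasurableD mk; exact: cmeasurableZ.
by apply: approximable_comb ak => //; exact: approximable_indic.
Qed.

(** Simple functions increasing to r converge to r in L^2 by dominated
    convergence. *)
Lemma approximable_nneg (r : K -> R) : measurable_fun setT (r : borel K -> R) ->
  (forall x, 0 <= r x) -> (\int[mu]_x (r x ^+ 2)%:E < +oo)%E ->
  Cb_approximable (fun x => (r x)%:C%C).
Proof.
move=> mr r0 rfin.
have mrE : measurable_fun setT (EFin \o (r : borel K -> R)) by exact/measurable_EFinP.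
have r0E (x : borel K) : setT x -> (0 <= (EFin \o r) x)%E by rewrite /= lee_fin.
pose s := nnsfun_approx measurableT mrE.
have s_r x : s ^~ x @ \oo --> r x.
  have sE : (EFin \o (s ^~ x)) @ \oo --> (r x)%:E.
    exact: (cvg_nnsfun_approx measurableT mrE r0E).
  by have /fine_cvgP[_] := sE.
have s_le n x : s n x <= r x.
  have nds m l : (m <= l)%N -> s m x <= s l x.
    by move=> ml; have /lefP := nd_nnsfun_approx measurableT mrE ml; exact.
  rewrite -(cvg_lim (@Rhausdorff R) (s_r x)).
  by apply: nondecreasing_cvgn_le; [move=> m l /nds|apply/cvg_ex; exists (r x)].
have ms n : measurable_fun setT (s n : borel K -> R) by exact: measurable_funPT.
have H n : Cb_approximable (fun x => (s n x)%:C%C).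
  pose t := finmap.enum_fset (fset_set (range (s n))).
  have -> : (fun x => (s n x)%:C%C) = (fun x => \sum_(i < size t)
      (nth 0 t i)%:C%C * (\1_(s n @^-1` [set nth 0 t i]) x)%:C%C) :> (K -> R[i]).
    apply/funext => x; rewrite fimfunEord rmorph_sum; apply: eq_bigr => i _.
    by rewrite rmorphM.
  by apply: (approximable_simple _ _).2 => i; exact: measurable_funPTI.
apply: approximable_lim; first exact: cmeas_real.
move=> e e0.
have [|||||_ _ int_cvg] := @dominated_convergence _ _ _ mu setT measurableT
    (fun n x => ((r x - s n x) ^+ 2)%:E) (cst 0%E) (fun x => (r x ^+ 2)%:E).
- by move=> n; apply/measurable_EFinP/measurable_funX/measurable_funB.
- exact: measurable_cst.
- apply: aeW => x _; apply: cvg_EFin; first by apply: nearW.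
  have : (r x - s n x) * (r x - s n x) @[n --> \oo] --> (r x - r x) * (r x - r x).
    by apply: cvgM; apply: cvgB => //; exact: cvg_cst.
  by rewrite subrr mul0r; exact.
- apply/integrableP; split; first exact/measurable_EFinP/measurable_funX.
  under eq_integral do rewrite gee0_abs ?lee_fin ?sqr_ge0//.
  exact: rfin.
- apply: aeW => x n _; rewrite gee0_abs ?lee_fin ?sqr_ge0//.
  have s0 : 0 <= s n x by [].
  by rewrite lerXn2r ?nnegrE ?subr_ge0 ?s_le// gerBl.
rewrite integral0 in int_cvg.
have /fine_cvgP[fin_near /cvgrPdist_lt/(_ e e0) small_near] := int_cvg.
have [n [nfin /=]] := filter_ex (filterI fin_near small_near).
rewrite sub0r normrN => nsmall.
exists (fun x => (s n x)%:C%C); split; [exact: cmeas_real|exact: H|].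
rewrite /L2int.
have -> : (\int[mu]_x (rnorm ((r x)%:C%C - (s n x)%:C%C : R[i]) ^+ 2)%:E =
    \int[mu]_x ((r x - s n x) ^+ 2)%:E)%E.
  by apply: eq_integral => x _; rewrite -rmorphB rnormE_real real_normK ?num_real.
move: nfin nsmall => /=; case: (\int[mu]_x ((r x - s n x) ^+ 2)%:E)%E => // z _ zs.
by rewrite lee_fin; exact: le_trans (ler_norm _) (ltW zs).
Qed.

Theorem Cb_dense_L2 h : L2 mu h -> Cb_approximable h.
Proof.
move=> /L2E[mh hfin]; have [mRe mIm] := mh.
have Q_part (p : K -> R) : measurable_fun setT (p : borel K -> R) ->
    (forall x, 0 <= p x <= rnorm (h x)) -> Cb_approximable (fun x => (p x)%:C%C).
  move=> mp ph; apply: approximable_nneg => // [x|]; first by case/andP: (ph x).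
  apply: le_lt_trans hfin; apply: ge0_le_integral => //.
  - by move=> x _; rewrite lee_fin sqr_ge0.
  - exact/measurable_EFinP/measurable_funX.
  - exact/measurable_EFinP/measurable_rnorm_sqr.
  - move=> x _; rewrite lee_fin; have /andP[p0 p1] := ph x.
    by rewrite lerXn2r ?nnegrE ?rnorm_ge0.
pose pos (p : K -> R) x := Num.max (p x) 0.
have pos_ok (p : K -> R) : measurable_fun setT (p : borel K -> R) ->
    (forall x, `|p x| <= rnorm (h x)) ->
    cmeas (fun x => (pos p x)%:C%C) /\ Cb_approximable (fun x => (pos p x)%:C%C).
  move=> mp ph; have mpos : measurable_fun setT (pos p : borel K -> R).
    by apply: measurable_maxr => //; exact: measurable_cst.
  split; first exact: cmeas_real.
  apply: Q_part => // x; rewrite /pos le_max lexx orbT ge_max rnorm_ge0 andbT.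
  exact: le_trans (ler_norm _) (ph x).
have real_ok (p : K -> R) : measurable_fun setT (p : borel K -> R) ->
    (forall x, `|p x| <= rnorm (h x)) ->
    cmeas (fun x => (p x)%:C%C) /\ Cb_approximable (fun x => (p x)%:C%C).
  move=> mp ph; have [m1 a1] := pos_ok p mp ph.
  have [||m2 a2] := pos_ok (fun x => - p x).
  - exact: measurableT_comp.
  - by move=> x; rewrite normrN.
  split; first exact: cmeas_real.
  have -> : (fun x => (p x)%:C%C) = (fun x => (-1) * (pos (fun x => - p x) x)%:C%C + (pos p x)%:C%C).
    apply/funext => x; rewrite mulN1r -rmorphN -rmorphD; congr (_%:C%C).
    by rewrite /pos; case: (leP (p x) 0) => px; case: (leP (- p x) 0) => px'; move: px px'; lra.
  exact: approximable_comb.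
have [m1 a1] := real_ok (fun x => complex.Re (h x)) mRe (fun x => Re_le_rnorm (h x)).
have [m2 a2] := real_ok (fun x => complex.Im (h x)) mIm (fun x => Im_le_rnorm (h x)).
have -> : h = (fun x => 'i%C * (complex.Im (h x))%:C%C + (complex.Re (h x))%:C%C).
  by apply/funext => x; rewrite addrC -complexE.
exact: approximable_comb.
Qed.

End density.

(** * The extension of a Markov operator to square integrable functions *)

Section L2_extension.
Variables (R : realType) (K : ptopologicalType).
Hypotheses (compK : compact [set: K]) (hausK : hausdorff_space K).
Variable mu : probability (borel K) R.
Hypothesis regmu : regular_measure mu.
Variable S : Cb R K -> Cb R K.
Hypothesis linS : linear S.
Local Notation Q h := (@L2int _ (borel K) R mu h).
Local Notation cmeas h := (@cmeasurable _ (borel K) R h).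
Hypothesis S_L2 : forall u, (Q (S u) <= Q u)%E.
Implicit Types (h k : K -> R[i]) (f : Cb R K).

Let cC f : cmeas f. Proof. exact: Cb_cmeasurable. Qed.

Let SB f g : (Q (fun x => (S f x - S g x)%R) <= Q (fun x => (f x - g x)%R))%E.
Proof.
have := S_L2 (f - g); rewrite (lin_mapB linS); exact.
Qed.

Lemma L2int_B_fin h f : L2 mu h -> (Q (fun x => (h x - f x)%R) < +oo)%E.
Proof.
move=> /L2E[mh hfin].
have mN : cmeas (fun x => -1 * f x) by exact: cmeasurableZ.
rewrite [X in L2int _ X](_ : _ = fun x => h x + -1 * f x); last first.
  by apply/funext => x; rewrite mulN1r.
apply: le_lt_trans (L2int_split mu ltr01 mh mN) _.
rewrite (L2intZ mu (-1) (cC f)); apply: lte_add_pinfty.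
  exact: lte_mul_pinfty.
apply: lte_mul_pinfty => //.
by apply: lte_mul_pinfty => //; [rewrite lee_fin sqr_ge0|exact: Cb_L2int_fin].
Qed.

(** Where h is close to a continuous f', the function k is close to S f', and
    S contracts the distance from f' to f; so k is as close to S f as h is to
    f. *)
Lemma close_contraction h k : L2 mu h -> cmeas k ->
  (forall e : R, 0 < e -> exists f', (Q (fun x => (h x - f' x)%R) <= e%:E)%E /\
                                     (Q (fun x => (k x - S f' x)%R) <= e%:E)%E) ->
  forall f, (Q (fun x => (k x - S f x)%R) <= Q (fun x => (h x - f x)%R))%E.
Proof.
move=> Lh mk H f; have mh := ((L2E mu h).1 Lh).1.
have hf := L2int_B_fin f Lh; have hf0 := L2int_ge0 mu (fun x : borel K => h x - f x).
move: hf hf0; case E : (Q (fun x => h x - f x)) => [q||]// _; rewrite lee_fin => q0.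
apply/lee_addgt0Pr => e e0; have e2 : 0 < e / 2 by rewrite divr_gt0.
have qe : 0 <= q + e / 2 by rewrite addr_ge0// ltW.
have [n1 n10 H1] := @L2int_upper_cont _ _ _ mu q (e / 2) q0 e2.
have [n2 n20 H2] := @L2int_upper_cont _ _ _ mu (q + e / 2) (e / 2) qe e2.
have [|f' [hf' kf']] := H (Num.min n1 n2); first by rewrite lt_min n10.
rewrite -EFinD (splitr e) addrA.
apply: (H2 (fun x => S f' x - S f x)); try exact: cmeasurableB.
  apply: le_trans (SB f' f) _; apply: (H1 (fun x => h x - f x)); try exact: cmeasurableB.
    by rewrite E.
  rewrite [X in L2int _ X](_ : _ = fun x => f' x - h x); last first.
    by apply/funext => x; rewrite opprB addrA subrK.
  rewrite L2int_sub_sym; apply: le_trans hf' _.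
  by rewrite lee_fin ge_min lexx.
rewrite [X in L2int _ X](_ : _ = fun x => k x - S f' x); last first.
  by apply/funext => x; rewrite opprB addrA subrK.
by apply: le_trans kf' _; rewrite lee_fin ge_min lexx orbT.
Qed.

(** The limit in L^2 of S f_n for continuous f_n that tend to h. *)
Lemma extension_value h : L2 mu h -> exists k, cmeas k /\
  forall f, (Q (fun x => (k x - S f x)%R) <= Q (fun x => (h x - f x)%R))%E.
Proof.
move=> Lh; have mh := ((L2E mu h).1 Lh).1.
have p0 n : 0 < (4^-1 ^+ n : R) by rewrite exprn_gt0// invr_gt0.
have /choice[f fP] : forall n : nat, exists f, (Q (fun x => (h x - f x)%R) <= (4^-1 ^+ n.+1)%:E)%E.
  by move=> n; exact: (Cb_dense_L2 compK hausK regmu Lh (p0 n.+1)).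
have [||k [mk kP]] := @riesz_fischer _ (borel K) R mu (fun n => S (f n)).
- by move=> n; exact: cC.
- move=> n; apply: le_trans (SB _ _) _.
  have fn1 := fP n.+1; rewrite L2int_sub_sym in fn1.
  apply: le_trans (L2int_chain (cC _) mh (cC _) fn1 (fP n)) _.
  by rewrite lee_fin !exprS; have := p0 n; set p := 4^-1 ^+ n; lra.
exists k; split=> //; apply: close_contraction => // e e0.
have q4 : 0 <= (4^-1 : R) < 1 by rewrite invr_ge0 ler0n invf_lt1// ltr1n.
have [n /(_ n (leqnn n)) ne] := geometric_small 4 q4 e0; exists (f n); split.
  apply: le_trans (fP n) _; rewrite lee_fin exprS.
  by have := p0 n; move: ne; set p := 4^-1 ^+ n; lra.
by apply: le_trans (kP n) _; rewrite lee_fin ltW.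
Qed.

Lemma small_ae_eq h k : cmeas h -> cmeas k ->
  (forall e : R, 0 < e -> (Q (fun x => (h x - k x)%R) <= e%:E)%E) ->
  {ae mu, forall x, h x = k x}.
Proof.
move=> mh mk H; have mB := cmeasurableB mh mk.
have := L1int_eq0 mB (L2int_small_L1 mB H).
by apply: filterS => x /eqP; rewrite subr_eq0 => /eqP.
Qed.

(** The condition that T h be as close to S f as h is to f, for all continuous
    f, determines T h up to null sets, whence linearity. *)
Lemma L2_extension_exists : exists T, is_L2_extension mu S T.
Proof.
have /choice[T TP] : forall h, exists k, L2 mu h -> cmeas k /\
    forall f, (Q (fun x => (k x - S f x)%R) <= Q (fun x => (h x - f x)%R))%E.
  move=> h; have [Lh|nLh] := pselect (L2 mu h); last by exists h.
  by have [k kP] := extension_value Lh; exists k.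
have T_le h : L2 mu h -> (Q (T h) <= Q h)%E.
  move=> Lh; have := (TP h Lh).2 0; rewrite (lin_map0 linS).
  rewrite [X in (L2int _ X <= _)%E -> _](_ : _ = T h); last first.
    by apply/funext => x; rewrite subr0.
  rewrite [X in (_ <= L2int _ X)%E -> _](_ : _ = h); last first.
    by apply/funext => x; rewrite subr0.
  exact.
have LE h : L2 mu h -> cmeas h by move=> /L2E[].
have dens h e := fun Lh => @Cb_dense_L2 _ _ compK hausK _ regmu h Lh e.
exists T; split.
- move=> h Lh; apply/L2E; split; first by case: (TP h Lh).
  by apply: le_lt_trans (T_le h Lh) _; case/L2E: Lh.
- move=> a h k Lh Lk; pose b := rnorm a ^+ 2.
  have [mh mk] := (LE h Lh, LE k Lk).
  have Lahk : L2 mu (a *: h + k).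
    apply/L2E; split; first by apply: cmeasurableD => //; exact: cmeasurableZ.
    apply: le_lt_trans (L2int_split mu ltr01 (cmeasurableZ a mh) mk) _.
    rewrite (L2intZ mu a mh); apply: lte_add_pinfty.
      apply: lte_mul_pinfty => //.
      by apply: lte_mul_pinfty => //; [rewrite lee_fin sqr_ge0|case/L2E: Lh].
    by apply: lte_mul_pinfty => //; case/L2E: Lk.
  have [[mTh ThP] [mTk TkP] [mT TP']] := And3 (TP h Lh) (TP k Lk) (TP _ Lahk).
  have mR : cmeas (fun x => a * T h x + T k x).
    by apply: cmeasurableD => //; exact: cmeasurableZ.
  apply: small_ae_eq => // e e0.
  have b0 : 0 <= b by rewrite sqr_ge0.
  pose e' := e / (8 * (b + 1)).
  have b1 : 0 < 8 * (b + 1) by rewrite mulr_gt0// ltr_wpDl.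
  have e'0 : 0 < e' by rewrite divr_gt0.
  have [f hf] := dens h e' Lh e'0; have [g kg] := dens k e' Lk e'0.
  have Sfg x : S (a *: f + g) x = a * S f x + S g x by rewrite linS.
  have comb (h1 k1 h2 k2 : K -> R[i]) : cmeas h1 -> cmeas k1 -> cmeas h2 -> cmeas k2 ->
      (Q (fun x => (h1 x - h2 x)%R) <= e'%:E)%E -> (Q (fun x => (k1 x - k2 x)%R) <= e'%:E)%E ->
      (Q (fun x => (a * h1 x + k1 x - (a * h2 x + k2 x))%R) <= (2 * (b + 1) * e')%:E)%E.
    move=> m1 m2 m3 m4 H1 H2.
    rewrite [X in L2int _ X](_ : _ = fun x => a * (h1 x - h2 x) + (k1 x - k2 x)); last first.
      by apply/funext => x; rewrite mulrBr opprD addrACA.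
    apply: le_trans (L2int_split mu ltr01 (cmeasurableZ a (cmeasurableB m1 m3)) (cmeasurableB m2 m4)) _.
    rewrite (L2intZ mu a (cmeasurableB m1 m3)) -/b.
    apply: (@le_trans _ _ ((1 + 1)%:E * (b%:E * e'%:E) + (1 + 1^-1)%:E * e'%:E)%E).
      apply: leeD; apply: lee_wpmul2l => //; rewrite ?lee_fin ?invr1 ?addr_ge0//.
      by apply: lee_wpmul2l => //; rewrite lee_fin.
    by rewrite -!EFinM -EFinD lee_fin invr1; lra.
  have A1 : (Q (fun x => (T (a *: h + k) x - S (a *: f + g)%R x)%R) <= (2 * (b + 1) * e')%:E)%E.
    apply: le_trans (TP' (a *: f + g)) _.
    exact: (comb h k f g mh mk (cC f) (cC g) hf kg).
  have A2 : (Q (fun x => (S (a *: f + g)%R x - (a * T h x + T k x))%R) <= (2 * (b + 1) * e')%:E)%E.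
    rewrite L2int_sub_sym.
    rewrite [X in L2int _ X](_ : _ = fun x => a * T h x + T k x - (a * S f x + S g x)); last first.
      by apply/funext => x; rewrite Sfg.
    apply: comb => //; first exact: le_trans (ThP f) hf.
    exact: le_trans (TkP g) kg.
  apply: le_trans (L2int_chain mT (cC _) mR A1 A2) _.
  rewrite lee_fin le_eqVlt; apply/orP; left; apply/eqP; rewrite /e'.
  by field; rewrite gt_eqF// ltr_wpDl.
- by exists 1 => h Lh; rewrite mul1e; apply: le_L2norm; exact: T_le.
- move=> f; have Lf : L2 mu f by apply/L2E; split; [exact: cC|exact: Cb_L2int_fin].
  have [mTf TfP] := TP f Lf.
  apply: small_ae_eq => // e e0; apply: le_trans (TfP f) _.
  rewrite [X in L2int _ X](_ : _ = fun x => 0 * f x); last first.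
    by apply/funext => x; rewrite subrr mul0r.
  by rewrite (L2intZ mu 0 (cC f)) rnorm0 expr0n /= mul0e lee_fin ltW.
Qed.

Lemma L2_extensionP : is_L2_extension mu S (L2_extension mu S).
Proof. by apply: xgetPex; exact: L2_extension_exists. Qed.

(** An L^2 extension of S is a priori bounded by an arbitrary constant; that
    it extends the contraction S forces it to be a contraction. *)
Lemma L2_extension_close h f : L2 mu h ->
  (Q (fun x => (L2_extension mu S h x - S f x)%R) <= Q (fun x => (h x - f x)%R))%E.
Proof.
move=> Lh; have [T2 Tlin [M TM] TC] := L2_extensionP.
set T := L2_extension mu S in T2 Tlin TM TC *.
have mh := ((L2E mu h).1 Lh).1; have mTh := ((L2E mu _).1 (T2 h Lh)).1.
apply: close_contraction => // e e0.
pose N := `|M| ^+ 2 + 1.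
have N0 : 0 < N by rewrite ltr_wpDl// sqr_ge0.
have eN0 : 0 < e / N by rewrite divr_gt0.
have [g hg] := Cb_dense_L2 compK hausK regmu Lh eN0; exists g.
have N1 : 1 <= N by rewrite lerDr sqr_ge0.
split; first by apply: le_trans hg _; rewrite lee_fin ler_pdivrMr// ler_peMr// ltW.
have Lhg : L2 mu (h - (g : K -> R[i])).
  by apply/L2E; split; [exact: (cmeasurableB mh (cC g))|exact: L2int_B_fin].
have Lg : L2 mu g by apply/L2E; split; [exact: cC|exact: Cb_L2int_fin].
have mThg := ((L2E mu _).1 (T2 _ Lhg)).1.
have -> : Q (fun x => T h x - S g x) = Q (T (h - (g : K -> R[i]))).
  apply: L2int_eq => //; first exact: cmeasurableB.
  have := Tlin 1 _ _ Lhg Lg; rewrite scale1r subrK => Thg.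
  have aeF : Filter (nbhs (almost_everywhere mu)) by exact: ae_filter_ringOfSetsType.
  by move: Thg (TC g); apply: filterS2 => x -> ->; rewrite mul1r addrK.
have TM' : (L2norm mu (T (h - (g : K -> R[i]))%R) <= `|M|%:E * L2norm mu (h - (g : K -> R[i]))%R)%E.
  apply: le_trans (TM _ Lhg) _.
  by apply: lee_wpmul2r; [exact: Lnorm_ge0|rewrite lee_fin ler_norm].
apply: le_trans (L2norm_le (normr_ge0 M) TM') _.
apply: (@le_trans _ _ ((`|M| ^+ 2)%:E * (e / N)%:E)%E).
  by apply: lee_wpmul2l => //; rewrite lee_fin sqr_ge0.
rewrite -EFinM lee_fin mulrA ler_pdivrMr// mulrC ler_pM2l//.
by rewrite lerDl.
Qed.

End L2_extension.

(** * Continuous representatives of fixed square integrable functions *)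

Section fixed_functions.
Variables (R : realType) (K : ptopologicalType).
Hypotheses (compK : compact [set: K]) (hausK : hausdorff_space K).
Variables (G : semitopologicalSemigroupType) (S : G -> Cb R K -> Cb R K).
Hypothesis repS : markov_representation S.
Variable mu : probability (borel K) R.
Hypothesis regmu : regular_measure mu.
Hypothesis ueS : uniquely_ergodic mu S.
Hypothesis netS : exists (D : directed) (A : D -> Cb R K -> Cb R K), right_ergodic_net S A.
Variable chi : G -> R[i].
Hypothesis chiP : is_unitary_character chi.
Local Notation chiS := (twist chi S).
Local Notation L1 h := (@L1int _ (borel K) R mu h).
Local Notation Q h := (@L2int _ (borel K) R mu h).
Local Notation cmeas h := (@cmeasurable _ (borel K) R h).
Local Notation T g := (L2_extension mu (S g)).

Let cC (u : Cb R K) : cmeas u. Proof. exact: Cb_cmeasurable. Qed.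
Let mS g : Defs.markov (S g). Proof. by case: repS => _; exact. Qed.
Let chi_rep : bounded_representation chiS. Proof. exact: twist_representation. Qed.

Lemma S_L2_contractive g u : (Q (S g u) <= Q u)%E.
Proof.
apply: markov_L2_contractive => // f.
by have [_ /(_ g)/(congr1 (@^~ f))] := integralC_adjoint ueS.
Qed.

Lemma L1_Cb (u : Cb R K) : (L1 u <= (rnorm u)%:E)%E.
Proof.
rewrite -[leRHS](@integral_cst_probability _ (borel K) R mu).
apply: ge0_le_integral => //.
- by move=> x _; rewrite lee_fin rnorm_ge0.
- by apply/measurable_EFinP; exact: measurable_rnorm.
- by move=> x _; rewrite lee_fin rnorm_Cb_ge.
Qed.

Lemma twist_L2_close h g (f : Cb R K) : L2 mu h ->
  (Q (fun x => (chi g * T g h x - chiS g f x)%R) <= Q (fun x => (h x - f x)%R))%E.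
Proof.
move=> Lh; have := L2_extension_close compK hausK regmu (markov_linear (mS g)) (S_L2_contractive g) f Lh.
apply: le_trans; rewrite le_eqVlt; apply/orP; left; apply/eqP.
apply: eq_integral => x _; rewrite -[chiS g f x]/(chi g * S g f x) -mulrBr rnormM.
by rewrite (rnorm_chi chiP) mul1r.
Qed.

Lemma L2_extension_measurable h g : L2 mu h -> cmeas (T g h).
Proof.
have [H _ _ _] := L2_extensionP compK hausK regmu (markov_linear (mS g)) (S_L2_contractive g).
by move=> /H/L2E[].
Qed.

(** As h is fixed, no chi(g) S_g increases the distance from f to h; by
    convexity the same holds for the hull and its closure. *)
Lemma Fix_L2_hull_close h (f : Cb R K) (P : Cb R K -> Cb R K) (s : R) : Fix_L2 mu S chi h -> clco chiS P ->
  0 < s -> (Q (fun x => (h x - f x)%R) <= (s ^+ 2)%:E)%E ->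
  (L1 (fun x => (h x - P f x)%R) <= s%:E)%E.
Proof.
move=> [Lh hfix] cP s0 hf; have mh := ((L2E mu h).1 Lh).1.
apply/lee_addgt0Pr => e e0.
have [B coB /(_ f)] := clco_approx [:: f] cP e0; rewrite inE eqxx => /(_ isT) PB.
rewrite [X in L1int _ X](_ : _ = fun x => (h x - B f x) + (B f x - P f x)); last first.
  by apply/funext => x; rewrite addrA subrK.
apply: le_trans (L1int_triangle mu (cmeasurableB mh (cC _)) (cmeasurableB (cC (B f)) (cC (P f)))) _.
apply: leeD; last first.
  apply: le_trans (L1_Cb (B f - P f)) _.
  by rewrite rnormB lee_fin ltW.
have [n [t [w [t0 t1 BE]]]] := (convex_combinationsP _ _).1 coB.
have term i : (L1 (fun x => (h x - chiS (w i) f x)%R) <= s%:E)%E.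
  apply: L1int_le_of_L2int => //; first exact: cmeasurableB.
  apply: le_trans hf; apply: le_trans (twist_L2_close (w i) f Lh).
  rewrite le_eqVlt; apply/orP; left; apply/eqP; apply: L2int_eq.
  - exact: cmeasurableB.
  - by apply: cmeasurableB => //; apply: cmeasurableZ; exact: L2_extension_measurable.
  - have aeF : Filter (nbhs (almost_everywhere mu)) by exact: ae_filter_ringOfSetsType.
    by apply: filterS (hfix (w i)) => x ->.
apply: (@le_trans _ _ (\int[mu]_x (\sum_(i < n) (t i * rnorm (h x - chiS (w i) f x)%R)%:E))%E).
  apply: ge0_le_integral => //.
  - by move=> x _; rewrite lee_fin rnorm_ge0.
  - by apply/measurable_EFinP; apply: measurable_rnorm; exact: cmeasurableB.
  - apply: emeasurable_sum => i; apply/measurable_EFinP; apply: measurable_funM => //.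
    by apply: measurable_rnorm; exact: cmeasurableB.
  move=> x _; rewrite sumEFin lee_fin.
  have -> : h x - B f x = \sum_(i < n) (t i)%:C%C *: (h x - chiS (w i) f x).
    under eq_bigr do rewrite scalerBr.
    by rewrite sumrB -scaler_suml -rmorph_sum t1 scale1r BE Cb_sumE.
  apply: le_trans (rnorm_sum _) _; apply: ler_sum => i _.
  by rewrite rnormZr.
rewrite ge0_integral_sum//; last 2 first.
- move=> i; apply/measurable_EFinP; apply: measurable_funM => //.
  by apply: measurable_rnorm; exact: cmeasurableB.
- by move=> i x _; rewrite lee_fin mulr_ge0 ?rnorm_ge0.
have -> : (s%:E = \sum_(i < n) (t i)%:E * s%:E)%E.
  under eq_bigr do rewrite -EFinM.
  by rewrite sumEFin -mulr_suml t1 mul1r.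
apply: lee_sum => i _; under eq_integral do rewrite EFinM.
rewrite ge0_integralZl_EFin//.
- by apply: lee_wpmul2l; [rewrite lee_fin|exact: term].
- by move=> x _; rewrite lee_fin rnorm_ge0.
- by apply/measurable_EFinP; apply: measurable_rnorm; exact: cmeasurableB.
Qed.

(** The functionals u |-> P u x are invariant and of norm at most 1, so
    [adjoint_fixed_L1_bound] applies to them. *)
Lemma projection_L1_bound (P : Cb R K -> Cb R K) : mean_ergodic_projection chiS P ->
  forall u, ((rnorm (P u))%:E <= L1 u)%E.
Proof.
move=> [cP PT] u; rewrite -integralC_cabs lee_fin.
have bound x : rnorm (P u x) <= complex.Re (integralC mu (cabs u)).
  have Pd : Fix_adjoint chiS (fun f => P f x).
    split; last first.
      move=> g; apply/funext => f /=.
      by have [/(congr1 (@^~ f))/= ->] := PT _ (clco_V chi_rep g).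
    split=> [a f k|f]; first by rewrite (clco_linear cP).
    apply: (@continuous_comp _ _ _ P (fun f : Cb R K => f x)); first exact: (clco_continuous cP).
    exact: (evaluation_dual R x).2.
  rewrite -[leRHS]mul1r; apply: (adjoint_fixed_L1_bound repS ueS netS chiP Pd ltr01) => f.
  rewrite mul1r; apply: le_trans (rnorm_Cb_ge _ _) _; rewrite -[leRHS]mul1r.
  by apply: clco_bound cP => g k; rewrite mul1r; exact: twist_contractive.
apply: rnorm_Cb_le => //; exact: le_trans (rnorm_ge0 _) (bound point).
Qed.

(** For continuous f_n that tend to h in L^2, the P f_n are uniformly Cauchy
    by [projection_L1_bound] and tend to h in L^1 by [Fix_L2_hull_close];
    their uniform limit is the required representative. *)
Theorem mean_ergodic_Fix_L2 : mean_ergodic chiS -> forall h, Fix_L2 mu S chi h ->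
  exists2 f, Fix chiS f & {ae mu, forall x, h x = f x}.
Proof.
move=> [P meP] h Fh; have [Lh hfix] := Fh; have cP := meP.1.
have mh := ((L2E mu h).1 Lh).1.
pose s n : R := 2^-1 ^+ n; have s0 n : 0 < s n by rewrite exprn_gt0.
have /choice[f fP] : forall n : nat, exists f : Cb R K, (Q (fun x => (h x - f x)%R) <= (s n ^+ 2)%:E)%E.
  by move=> n; apply: (Cb_dense_L2 compK hausK regmu Lh); rewrite exprn_gt0.
have s_small e : 0 < e -> exists N, forall n, (N <= n)%N -> s n < e.
  have q2 : 0 <= (2^-1 : R) < 1 by rewrite invr_ge0 ler0n invf_lt1// ltr1n.
  move=> /(geometric_small 1 q2)[N NP]; exists N => n /NP.
  by rewrite mul1r.
have fL1 n : (L1 (fun x => (h x - f n x)%R) <= (s n)%:E)%E.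
  by apply: L1int_le_of_L2int => //; exact: cmeasurableB.
have [|F FP] := @Cb_complete R K (fun n => P (f n)).
  move=> e e0; have e2 : 0 < e / 2 by rewrite divr_gt0.
  have [N NP] := s_small _ e2; exists N => n m Nn Nm.
  rewrite -(lin_mapB (clco_linear cP)) -lte_fin.
  apply: le_lt_trans (projection_L1_bound meP _) _.
  apply: (@le_lt_trans _ _ ((s n)%:E + (s m)%:E)%E); last first.
    by rewrite -EFinD lte_fin (splitr e) ltrD// NP.
  have -> : L1 (f n - f m) = L1 (fun x => (f n x - h x) + (h x - f m x)).
    by apply: eq_integral => x _; rewrite addrA subrK.
  apply: le_trans (L1int_triangle mu (cmeasurableB (cC _) mh) (cmeasurableB mh (cC _))) _.
  apply: leeD => //; apply: le_trans (fL1 n).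
  by rewrite le_eqVlt; apply/orP; left; apply/eqP; apply: eq_integral => x _; rewrite rnormB.
have Plin := clco_linear cP.
have [PP Prg _] := projection_of_mean_ergodic chi_rep meP.
have PF : P F = F.
  apply/eqP; rewrite -subr_eq0; apply/eqP/rnorm_le0/ler_addgt0Pr => e e0; rewrite add0r.
  have e2 : 0 < e / 2 by rewrite divr_gt0.
  have [N /(_ N (leqnn N)) FN] := FP _ e2.
  have -> : P F - F = P (F - P (f N)) + (P (f N) - F).
    by rewrite (lin_mapB Plin) -[P (P (f N))]/((P \o P) (f N)) PP addrA subrK.
  apply: le_trans (rnormD _ _) _; rewrite (rnormB (P _)) (splitr e); apply: lerD; last exact: ltW.
  apply: le_trans (ltW FN); rewrite -[leRHS]mul1r.
  by apply: clco_bound cP => g k; rewrite mul1r; exact: twist_contractive.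
exists F; first by rewrite -Prg; exists F.
have mB : cmeas (fun x => h x - F x) by exact: cmeasurableB.
have : L1 (fun x => h x - F x) = 0%E.
  apply/eqP; rewrite eq_le L1int_ge0 andbT; apply/lee_addgt0Pr => e e0; rewrite add0e.
  have e2 : 0 < e / 2 by rewrite divr_gt0.
  have [N1 N1P] := FP _ e2; have [N2 N2P] := s_small _ e2; pose n := maxn N1 N2.
  rewrite [X in L1int _ X](_ : _ = fun x => (h x - P (f n) x) + (P (f n) x - F x)); last first.
    by apply/funext => x; rewrite addrA subrK.
  apply: le_trans (L1int_triangle mu (cmeasurableB mh (cC _)) (cmeasurableB (cC (P (f n))) (cC F))) _.
  rewrite (splitr e) EFinD; apply: leeD.
    apply: le_trans (Fix_L2_hull_close Fh cP (s0 n) (fP n)) _.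
    by rewrite lee_fin ltW// N2P ?leq_maxr.
  apply: le_trans (L1_Cb (P (f n) - F)) _.
  by rewrite rnormB lee_fin ltW// N1P ?leq_maxl.
have aeF : Filter (nbhs (almost_everywhere mu)) by exact: ae_filter_ringOfSetsType.
move=> /(L1int_eq0 mB); apply: filterS => x /eqP.
by rewrite subr_eq0 => /eqP.
Qed.

End fixed_functions.

(** * Fixed functions from invariant functionals *)

Section extremal_functions.
Variables (R : realType) (K : ptopologicalType).
Hypotheses (compK : compact [set: K]) (hausK : hausdorff_space K).
Variables (G : semitopologicalSemigroupType) (S : G -> Cb R K -> Cb R K).
Hypothesis repS : markov_representation S.
Variable mu : probability (borel K) R.
Hypothesis regmu : regular_measure mu.
Hypothesis ueS : uniquely_ergodic mu S.
Hypothesis netS : exists (D : directed) (A : D -> Cb R K -> Cb R K), right_ergodic_net S A.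
Variable chi : G -> R[i].
Hypothesis chiP : is_unitary_character chi.
Local Notation chiS := (twist chi S).
Local Notation L1 h := (@L1int _ (borel K) R mu h).
Local Notation Q h := (@L2int _ (borel K) R mu h).
Local Notation cmeas h := (@cmeasurable _ (borel K) R h).
Local Notation T g := (L2_extension mu (S g)).

Let cC (u : Cb R K) : cmeas u. Proof. exact: Cb_cmeasurable. Qed.

(** For the midpoint w one has |w|^2 = (|a|^2 + |b|^2) / 2 - |a - b|^2 / 4,
    and |w| <= (1 + |w|^2) / 2. *)
Lemma parallelogram_bound (a b : R[i]) : rnorm a <= 1 -> rnorm b <= 1 ->
  rnorm ((1 / 2)%:C%C * (a + b)) + 8^-1 * rnorm (a - b) ^+ 2 <= 1.
Proof.
move=> a1 b1; set w := _ * (a + b).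
have sq1 (z : R[i]) : rnorm z <= 1 -> rnorm z ^+ 2 <= 1.
  by move=> z1; rewrite exprn_ile1 ?rnorm_ge0.
have : rnorm w ^+ 2 + 4^-1 * rnorm (a - b) ^+ 2 = (rnorm a ^+ 2 + rnorm b ^+ 2) / 2.
  by rewrite /w !rnormc_sqr; case: (a) (b) => a1' a2 [b1' b2] /=; field.
have := sq1 a a1; have := sq1 b b1; have := sqr_ge0 (rnorm w - 1).
rewrite sqrrB; lra.
Qed.

Lemma functional_norm (nu : Cb R K -> R[i]) : dual (Cb R K) nu -> (exists f, nu f <> 0) ->
  exists c : R, [/\ 0 < c, forall u, rnorm (nu u) <= c * rnorm u &
    forall e, 0 < e -> exists2 u, rnorm u <= 1 & c - e <= complex.Re (nu u)].
Proof.
move=> [nuL nuc] [f0 nuf0]; have [N N0 nuN] := continuous_rnorm_bounded nuL nuc.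
pose A := [set rnorm (nu u) | u in [set u | rnorm u <= 1]].
have Aub : has_ubound A.
  by exists N => _ [u /= u1 <-]; apply: le_trans (nuN u) _; rewrite ger_pMr.
have A0 : A 0 by exists 0; rewrite /= ?rnorm0// (lin_map0 nuL) rnorm0.
pose c := sup A.
have cA u : rnorm (nu u) <= c * rnorm u.
  have [u0|u0] := eqVneq (rnorm u) 0.
    by rewrite (rnorm_eq0 u0) (lin_map0 nuL) !rnorm0 mulr0.
  have up : 0 < rnorm u by rewrite lt_def u0 rnorm_ge0.
  have ui : 0 <= (rnorm u)^-1 by rewrite invr_ge0 ltW.
  rewrite -ler_pdivrMr// mulrC -rnormZr// -(lin_mapZ nuL); apply: ub_le_sup => //.
  by exists ((rnorm u)^-1%:C%C *: u) => //=; rewrite rnormZr// mulVf.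
exists c; split => // [|e e0].
  have nuf0' : 0 < rnorm (nu f0).
    by rewrite lt_def rnorm_ge0 andbT; apply/eqP => /rnorm_eq0.
  rewrite ltNge; apply/negP => c0; have := cA f0.
  have := mulr_le0_ge0 c0 (rnorm_ge0 f0); move: nuf0'; lra.
have [_ [u /= u1 <-] cu] := sup_adherent e0 (conj (ex_intro _ 0 A0) Aub).
have [l l1 lnu] := rotation (nu u); exists (l *: u).
  by rewrite rnormZ l1 mul1r.
by rewrite (lin_mapZ nuL) -[l *: nu u]/(l * nu u) lnu /= ltW.
Qed.

Section functional.
Variable nu : Cb R K -> R[i].
Hypothesis nuF : Fix_adjoint chiS nu.
Variable c : R.
Hypothesis c0 : 0 < c.
Hypothesis nu_c : forall u, rnorm (nu u) <= c * rnorm u.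

Let nuL : linear nu. Proof. by case: nuF => -[H _] _; exact: H. Qed.

Let nu_L1 u : ((rnorm (nu u))%:E <= c%:E * L1 u)%E.
Proof.
rewrite -integralC_cabs -EFinM lee_fin.
exact: (adjoint_fixed_L1_bound repS ueS netS chiP nuF c0 nu_c).
Qed.

(** The midpoint of two almost norming vectors is almost norming, so by
    [adjoint_fixed_L1_bound] its L^1 norm is close to 1, whereas
    [parallelogram_bound] makes that norm drop with the L^2 distance of the
    two vectors. *)
Lemma norming_close u v (e : R) : rnorm u <= 1 -> rnorm v <= 1 ->
  c - c * e <= complex.Re (nu u) -> c - c * e <= complex.Re (nu v) ->
  (Q (fun x => (u x - v x)%R) <= (8 * e)%:E)%E.
Proof.
move=> u1 v1 nuu nuv; pose w : Cb R K := (1 / 2)%:C%C *: (u + v).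
have uvC : cmeas (fun x => u x - v x) by exact: cmeasurableB.
have Lw : ((1 - e)%:E <= L1 w)%E.
  have -> : (L1 w = (complex.Re (integralC mu (cabs w)))%:E)%E by rewrite integralC_cabs.
  have nuw := nu_L1 w; rewrite -integralC_cabs -EFinM lee_fin in nuw.
  rewrite lee_fin -(ler_pM2l c0); apply: le_trans nuw.
  apply: le_trans (le_trans (ler_norm _) (Re_le_rnorm (nu w))).
  rewrite (lin_mapZ nuL) (lin_mapD nuL) -[_ *: _]/((1 / 2)%:C%C * (nu u + nu v)) Re_realM raddfD /=.
  by move: nuu nuv; lra.
have sum_le : (L1 w + (8^-1)%:E * Q (fun x => (u x - v x)%R) <= 1)%E.
  rewrite -[leRHS](@integral_cst_probability _ (borel K) R mu).
  have m2 : measurable_fun setT (fun x : borel K => (rnorm (u x - v x) ^+ 2)%:E).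
    by apply/measurable_EFinP; exact: (measurable_rnorm_sqr uvC).
  have m1 : measurable_fun setT (fun x : borel K => (rnorm (w x))%:E).
    by apply/measurable_EFinP; exact: (measurable_rnorm (cC w)).
  rewrite /L2int -ge0_integralZl_EFin//; last by move=> x _; rewrite lee_fin sqr_ge0.
  rewrite /L1int -ge0_integralD//; last 3 first.
  - by move=> x _; rewrite lee_fin rnorm_ge0.
  - by move=> x _; rewrite -EFinM lee_fin mulr_ge0 ?sqr_ge0.
  - exact: measurable_funeM.
  apply: ge0_le_integral => //.
  - by move=> x _; rewrite -EFinM -EFinD lee_fin addr_ge0 ?rnorm_ge0// mulr_ge0 ?sqr_ge0.
  - by apply: emeasurable_funD => //; exact: measurable_funeM.
  - move=> x _; rewrite -EFinM -EFinD lee_fin.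
    apply: (parallelogram_bound (a := u x) (b := v x)).
      exact: le_trans (rnorm_Cb_ge u x) u1.
    exact: le_trans (rnorm_Cb_ge v x) v1.
have Lw' : ((1 - e)%:E + (8^-1)%:E * Q (fun x => (u x - v x)%R) <= 1)%E.
  exact: le_trans (leeD Lw (lexx _)) sum_le.
move: Lw' (L2int_ge0 mu (fun x : borel K => u x - v x)).
case: (L2int mu (fun x : borel K => u x - v x)) => [q||].
- by rewrite -EFinM -EFinD !lee_fin -addrA gerDl addrC subr_le0 ler_pdivrMl.
- by rewrite gt0_muley ?lte_fin ?invr_gt0// addey.
- by rewrite leeNy_eq.
Qed.

End functional.

(** Vectors u_n of norm at most 1 with nu u_n tending to the norm c of nu are
    L^2 Cauchy by [norming_close]; let h be their limit. Since nu (chi(g) S_g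
    u_n) = nu u_n, the same lemma shows that chi(g) S_g u_n and u_n have the
    same limit, so h is fixed. For a continuous f equal to h almost everywhere
    nu (f - u_n) tends to 0, so nu f = c. *)
Theorem Fix_L2_of_functional nu : Fix_adjoint chiS nu -> (exists f, nu f <> 0) ->
  exists2 h, Fix_L2 mu S chi h &
    forall f : Cb R K, {ae mu, forall x, h x = f x} -> nu f <> 0.
Proof.
move=> nuF /(functional_norm nuF.1)[c [c0 nu_c c_attained]]; have [nuL nuc] := nuF.1.
have p0 n : 0 < (4^-1 ^+ n : R) by rewrite exprn_gt0// invr_gt0.
(* the division by 8 makes the L^2 distances fit [riesz_fischer] *)
pose e n : R := 4^-1 ^+ n / 8.
have e0 n : 0 < e n by rewrite divr_gt0.
have /choice[u uP] : forall n : nat, exists u : Cb R K, rnorm u <= 1 /\ c - c * e n <= complex.Re (nu u).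
  by move=> n; have [|u u1 nuu] := c_attained (c * e n); [rewrite mulr_gt0|exists u].
have [||h [mh hP]] := @riesz_fischer _ (borel K) R mu (fun n => u n).
- by move=> n; exact: cC.
- move=> n; apply: le_trans (norming_close nuF c0 nu_c (uP n.+1).1 (uP n).1 _ (uP n).2) _.
    apply: le_trans (uP n.+1).2; rewrite lerD2l lerN2 ler_pM2l// /e exprS.
    by have := p0 n; set p := 4^-1 ^+ n; lra.
  by rewrite lee_fin /e; lra.
have Lh : L2 mu h.
  apply/L2E; split => //.
  rewrite [X in L2int _ X](_ : _ = fun x => (h x - u 0%N x) + u 0%N x); last first.
    by apply/funext => x; rewrite subrK.
  apply: le_lt_trans (L2int_split mu ltr01 (cmeasurableB mh (cC _)) (cC _)) _.
  apply: lte_add_pinfty; apply: lte_mul_pinfty => //; last exact: Cb_L2int_fin.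
  by apply: le_lt_trans (hP 0%N) _; rewrite ltry.
have small (d : R) : 0 < d -> exists n, 4 * 4^-1 ^+ n < d.
  have q4 : 0 <= (4^-1 : R) < 1 by rewrite invr_ge0 ler0n invf_lt1// ltr1n.
  by move=> /(geometric_small 4 q4)[n nd]; exists n; exact: nd.
exists h.
  split => // g; apply: small_ae_eq => //.
    by apply: cmeasurableZ; exact: (L2_extension_measurable compK hausK repS regmu ueS g Lh).
  move=> d d0; have [n nd] := small (d / 16) (divr_gt0 d0 (ltr0n _ 16)).
  have mT := L2_extension_measurable compK hausK repS regmu ueS g Lh.
  have B1 := le_trans (twist_L2_close compK hausK repS regmu ueS chiP g (u n) Lh) (hP n).
  have B2 : (Q (fun x => (chiS g (u n) x - u n x)%R) <= (8 * e n)%:E)%E.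
    apply: (norming_close nuF c0 nu_c) (uP n).1 _ (uP n).2.
      exact: le_trans (twist_contractive repS chiP g (u n)) (uP n).1.
    by rewrite -[nu (chiS g (u n))]/((nu \o chiS g) (u n)) nuF.2; exact: (uP n).2.
  have B3 := hP n; rewrite L2int_sub_sym in B3.
  have B12 := L2int_chain (cmeasurableZ _ mT) (cC _) (cC _) B1 B2.
  apply: le_trans (L2int_chain (cmeasurableZ _ mT) (cC _) mh B12 B3) _.
  by rewrite lee_fin /e; move: nd; have := p0 n; set p := 4^-1 ^+ n; lra.
move=> f hf nuf0; have [n nd] := small (1 / 8) (divr_gt0 ltr01 (ltr0n _ 8)).
have aeF : Filter (nbhs (almost_everywhere mu)) by exact: ae_filter_ringOfSetsType.
have Qf : (Q (fun x => (f x - u n x)%R) <= (4 * 4^-1 ^+ n)%:E)%E.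
  rewrite (_ : L2int mu _ = Q (fun x => h x - u n x)); first exact: hP.
  apply: L2int_eq; [exact: cmeasurableB|exact: cmeasurableB|].
  by apply: filterS hf => x ->.
have s2 : 0 < 1 / 2 :> R by rewrite divr_gt0.
have Lf : (L1 (fun x => (f x - u n x)%R) <= (1 / 2)%:E)%E.
  apply: L1int_le_of_L2int => //; first exact: cmeasurableB.
  by apply: le_trans Qf _; rewrite lee_fin; move: nd; lra.
have := adjoint_fixed_L1_bound repS ueS netS chiP nuF c0 nu_c (f - u n).
rewrite (lin_mapB nuL) nuf0 sub0r rnormN => H.
have : complex.Re (integralC mu (cabs (f - u n))) <= 1 / 2.
  by rewrite -lee_fin integralC_cabs.
have := le_trans (ler_norm _) (Re_le_rnorm (nu (u n))).
have := (uP n).2; have e8 : c * e n <= c * (1 / 8).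
  rewrite ler_pM2l// /e; move: nd; have := p0 n; set p := 4^-1 ^+ n; lra.
move=> H1 H2 /(ler_wpM2l (ltW c0)); move: e8 H1 H2 H; lra.
Qed.

(** Applied to the difference of two invariant functionals. *)
Theorem Fix_L2_separates :
  (forall h, Fix_L2 mu S chi h -> exists2 f, Fix chiS f & {ae mu, forall x, h x = f x}) ->
  separates (Fix chiS) (Fix_adjoint chiS).
Proof.
move=> H nu1 nu2 F1 F2 nu12; have [[L1' c1'] inv1] := F1; have [[L2' c2'] inv2] := F2.
pose nu f : R[i] := nu1 f - nu2 f.
have nuF : Fix_adjoint chiS nu.
  split; last first.
    move=> g; apply/funext => f; rewrite /nu /=.
    by rewrite -[in RHS](inv1 g) -[in RHS](inv2 g).
  split=> [a f k|f]; first by rewrite /nu L1' L2' scalerBr opprD addrACA.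
  by apply: (cvgB (c1' f) (c2' f)).
have [|h Fh hnu] := Fix_L2_of_functional nuF.
  apply: contrapT => nu0; apply: nu12; apply/funext => f; apply/eqP.
  rewrite -subr_eq0; apply/eqP; apply: contrapT => nuf; apply: nu0.
  by exists f.
have [f Ff hf] := H h Fh; exists f => //.
by move=> nuf; apply: (hnu f hf); rewrite /nu nuf subrr.
Qed.

End extremal_functions.

(** * The equivalences *)

(** Right translations of the opposite semigroup are the left translations of
    G. *)
Lemma right_amenable_opposite (R : realType) (G : semitopologicalSemigroupType) :
  right_amenable R (opposite G) ->
  exists2 m : Cb R G -> R[i], is_mean m & forall g F, m (ltransl g F) = m F.
Proof.
move=> [m mm minv]; exists m; first exact: mm.
move=> g F; rewrite -[RHS](minv g F); congr m.
exact: CbP.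
Qed.

Theorem theorem1p7 (R : realType) (K : ptopologicalType)
    (compK : compact [set: K]) (hausK : hausdorff_space K)
    (G : semitopologicalSemigroupType) (S : G -> Cb R K -> Cb R K)
    (repS : markov_representation S)
    (mu : probability (borel K) R) (regmu : regular_measure mu)
    (ueS : uniquely_ergodic mu S) :
  (right_amenable R (opposite G) ->
   forall chi : G -> R[i], is_unitary_character chi ->
   let chiS := twist chi S in
   let net := right_ergodic_net chiS in
   [<-> forall h, Fix_L2 mu S chi h ->
          exists2 f, Fix chiS f & {ae mu, forall x, h x = f x};
        mean_ergodic chiS;
        separates (Fix chiS) (Fix_adjoint chiS);
        direct_sum (Fix chiS) (lin_rg chiS);
        some_net net (weakly_convergent_in (Fix chiS));
        every_net net (weakly_convergent_in [set: Cb R K]);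
        every_net net (weakly_convergent_in (Fix chiS));
        some_net net (norm_convergent_in (Fix chiS));
        every_net net (norm_convergent_in [set: Cb R K]);
        every_net net (norm_convergent_in (Fix chiS))] /\
   (forall P, mean_ergodic_projection chiS P ->
     [/\ projection_onto_along P (Fix chiS) (lin_rg chiS),
         every_net net (strong_limit P) & every_net net (weak_limit P)]) /\
   (mean_ergodic chiS -> forall (D : directed) (A : D -> Cb R K -> Cb R K) (P : Cb R K -> Cb R K), net D A ->
     strong_limit P A \/ weak_limit P A ->
     mean_ergodic_projection chiS P /\
     projection_onto_along P (Fix chiS) (lin_rg chiS))) /\
  (amenable R G ->
   forall chi : G -> R[i], is_unitary_character chi ->
   let chiS := twist chi S in
   let net := ergodic_net chiS in
   [<-> forall h, Fix_L2 mu S chi h ->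
          exists2 f, Fix chiS f & {ae mu, forall x, h x = f x};
        mean_ergodic chiS;
        separates (Fix chiS) (Fix_adjoint chiS);
        direct_sum (Fix chiS) (lin_rg chiS);
        some_net net (weakly_convergent_in [set: Cb R K]);
        some_net net (weakly_convergent_in (Fix chiS));
        every_net net (weakly_convergent_in [set: Cb R K]);
        every_net net (weakly_convergent_in (Fix chiS));
        some_net net (norm_convergent_in [set: Cb R K]);
        some_net net (norm_convergent_in (Fix chiS));
        every_net net (norm_convergent_in [set: Cb R K]);
        every_net net (norm_convergent_in (Fix chiS))] /\
   (forall P, mean_ergodic_projection chiS P ->
     [/\ projection_onto_along P (Fix chiS) (lin_rg chiS),
         every_net net (strong_limit P) & every_net net (weak_limit P)]) /\
   (forall (D : directed) (A : D -> Cb R K -> Cb R K) (P : Cb R K -> Cb R K), net D A ->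
     strong_limit P A \/ weak_limit P A ->
     mean_ergodic_projection chiS P /\
     projection_onto_along P (Fix chiS) (lin_rg chiS))).
Proof.
have complK := @Cb_complete R K.
have rS : bounded_representation S by case: repS.
split=> [raG|aG] chi chiP chiS net.
  have [m mm ml] := right_amenable_opposite raG.
  have rV : bounded_representation chiS by exact: twist_representation.
  have netS := right_ergodic_net_exists rS mm ml.
  have [D0 [A0 netA0]] := right_ergodic_net_exists rV mm ml.
  (* each assertion is compared with mean ergodicity *)
  have sepME : separates (Fix chiS) (Fix_adjoint chiS) -> mean_ergodic chiS.
    by apply: separates_mean_ergodic => //; exists D0, A0.
  have fixME : (forall h, Fix_L2 mu S chi h ->
      exists2 f, Fix chiS f & {ae mu, forall x, h x = f x}) -> mean_ergodic chiS.
    by move=> H; apply: sepME; exact: (Fix_L2_separates compK hausK repS regmu ueS netS chiP).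
  have MEnorm : mean_ergodic chiS -> every_net net (norm_convergent_in (Fix chiS)).
    exact: mean_ergodic_norm_convergent.
  have weakME : some_net net (weakly_convergent_in (Fix chiS)) -> mean_ergodic chiS.
    by move=> [D [A [netA wA]]]; apply: sepME; exact: weakly_convergent_separates netA.1 wA.
  have everyME : every_net net (weakly_convergent_in setT) -> mean_ergodic chiS.
    move=> /(right_weak_limit_fix rV) wV; apply: weakME; exists D0, A0.
    by split=> //; exact: wV.
  split; last split.
  - tfae.
    + exact: fixME.
    + move=> ME; apply: (weakly_convergent_separates netA0.1).
      by apply: strong_weakly_convergent; exact: MEnorm.
    + by move=> /sepME; exact: mean_ergodic_direct_sum.
    + move=> ds; exists D0, A0; split=> //; apply: strong_weakly_convergent.
      exact: (direct_sum_norm_convergent rV ds netA0).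
    + move=> /weakME/MEnorm nV D A netA; apply/weakly_convergentW/strong_weakly_convergent.
      exact: nV.
    + exact: right_weak_limit_fix.
    + move=> wV; have ME : mean_ergodic chiS by apply: weakME; exists D0, A0; split=> //; exact: wV.
      by exists D0, A0; split=> //; exact: MEnorm.
    + move=> [D [A [netA nA]]]; have ME : mean_ergodic chiS.
        by apply: weakME; exists D, A; split=> //; exact: strong_weakly_convergent.
      by move=> D' A' netA'; apply: norm_convergentW; exact: MEnorm.
    + move=> nV; apply: MEnorm; apply: everyME => D A netA.
      by apply: strong_weakly_convergent; exact: nV.
    + move=> nV; apply: (mean_ergodic_Fix_L2 compK hausK repS regmu ueS netS chiP).
      apply: weakME; exists D0, A0; split=> //; apply: strong_weakly_convergent.
      exact: nV.
  - by move=> P; exact: mean_ergodic_projection_limits.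
  - by move=> [P meP]; exact: mean_ergodic_limit meP.
have [m mm minv] := aG.
have rV : bounded_representation chiS by exact: twist_representation.
have netS := right_ergodic_net_exists rS mm (fun g F => (minv g F).2).
have [D0 [A0 netA0]] := ergodic_net_exists rV mm minv.
have sepME : separates (Fix chiS) (Fix_adjoint chiS) -> mean_ergodic chiS.
  by apply: separates_mean_ergodic => //; exists D0, A0; split=> //; exact: netA0.1.
have fixME : (forall h, Fix_L2 mu S chi h ->
    exists2 f, Fix chiS f & {ae mu, forall x, h x = f x}) -> mean_ergodic chiS.
  by move=> H; apply: sepME; exact: (Fix_L2_separates compK hausK repS regmu ueS netS chiP).
have MEnorm : mean_ergodic chiS -> every_net net (norm_convergent_in (Fix chiS)).
  by move=> ME D A netA; exact: (mean_ergodic_norm_convergent rV ME netA.1).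
(* weak limits of a two-sided ergodic net are fixed points *)
have wFix (D : directed) (A : D -> Cb R K -> Cb R K) : net D A ->
    weakly_convergent_in setT A -> weakly_convergent_in (Fix chiS) A.
  by move=> netA wA f; have [h _ Ah] := wA f; exists h => //; exact: (ergodic_weak_limit_fix rV netA Ah).
have weakME : some_net net (weakly_convergent_in setT) -> mean_ergodic chiS.
  move=> [D [A [netA wA]]]; apply: sepME.
  by apply: (weakly_convergent_separates netA.1.1); exact: wFix.
have normME : some_net net (norm_convergent_in setT) -> mean_ergodic chiS.
  move=> [D [A [netA nA]]]; apply: weakME; exists D, A.
  by split=> //; exact: strong_weakly_convergent.
split; last split.
- tfae.
  + exact: fixME.
  + move=> ME; apply: (weakly_convergent_separates netA0.1.1).
    by apply: strong_weakly_convergent; exact: MEnorm.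
  + by move=> /sepME; exact: mean_ergodic_direct_sum.
  + move=> ds; exists D0, A0; split=> //; apply/weakly_convergentW/strong_weakly_convergent.
    exact: (direct_sum_norm_convergent rV ds netA0.1).
  + move=> [D [A [netA wA]]]; exists D, A; split=> //; exact: wFix.
  + move=> [D [A [netA wA]]]; have ME : mean_ergodic chiS.
      by apply: weakME; exists D, A; split=> //; exact: weakly_convergentW wA.
    move=> D' A' netA'; apply/weakly_convergentW/strong_weakly_convergent.
    exact: MEnorm.
  + by move=> wV D A netA; apply: wFix => //; exact: wV.
  + move=> wV; have ME : mean_ergodic chiS.
      by apply: weakME; exists D0, A0; split=> //; apply: weakly_convergentW; exact: wV.
    by exists D0, A0; split=> //; apply: norm_convergentW; exact: MEnorm.
  + by move=> [D [A [netA nA]]]; exists D, A; split=> //; apply: MEnorm => //; apply: normME; exists D, A.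
  + move=> [D [A [netA nA]]] D' A' netA'; apply: norm_convergentW.
    apply: MEnorm netA'; apply: normME; exists D, A; split=> //; exact: norm_convergentW nA.
  + move=> nV; apply: MEnorm; apply: normME; exists D0, A0; split=> //; exact: nV.
  + move=> nV; apply: (mean_ergodic_Fix_L2 compK hausK repS regmu ueS netS chiP).
    by apply: normME; exists D0, A0; split=> //; apply: norm_convergentW; exact: nV.
- move=> P meP; have [pP sP wP] := mean_ergodic_projection_limits rV meP.
  by split=> // D A netA; [exact: sP netA.1|exact: wP netA.1].
- move=> D A P netA limP; have [Q meQ] : mean_ergodic chiS.
    apply: weakME; exists D, A; split=> // f; exists (P f) => //.
    exact: strong_or_weak_limit limP f.
  exact: (mean_ergodic_limit rV meQ netA.1 limP).
Qed.
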